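(* Let $r\ge0$ be an integer and let $s$ be a fixed complex number with $\operatorname{Re}s<1$. Let $\zeta^{(r)}(s,\alpha)=\frac{\partial^r}{\partial s^r}\zeta(s,\alpha)$. As a function of $\alpha$ on the unit interval $[0,1]$, $\zeta^{(r)}(s,\alpha)$ has the Fourier series $$\zeta^{(r)}(s,\alpha)=\sum_{|n|\ge1}e^{2\pi i n\alpha}(2\pi i n)^{s-1}\sum_{\ell=0}^{r}(-1)^{r-\ell}\binom{r}{\ell}\Gamma^{(r-\ell)}(1-s)\,\log^{\ell}(2\pi i n),$$ the equality holding for $0<\alpha<1$.
   Context: The Hurwitz zeta function $\zeta(s,\alpha)$ is defined by $\zeta(s,\alpha)=\sum_{n\ge 0}(n+\alpha)^{-s}$ for $\operatorname{Re}s>1$ and by analytic continuation in $s$. $\Gamma^{(k)}$ is the $k$-th derivative of the gamma function, and $\log^\ell x=(\log x)^\ell$. Logarithms and complex powers take their principal values. The Fourier series on $[0,1]$ of an integrable function $f$ is $\sum_{n\in\mathbb Z}c_n e^{2\pi i n\alpha}$ with $c_n=\int_0^1 f(\alpha)e^{-2\pi i n\alpha}\,d\alpha$; sums over $|n|\ge1$ run over all nonzero integers and are limits of symmetric partial sums. *)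

(* Defs.v *)
From Stdlib Require Import Reals ZArith.
From Coquelicot Require Import Coquelicot.

Open Scope R_scope.

Definition Cexp (z : C) : C :=
  (exp (Re z) * cos (Im z), exp (Re z) * sin (Im z)).

(* Principal argument of z <> 0, with values in (-PI, PI]. *)
Definition Carg (z : C) : R :=
  if Rle_dec 0 (Im z) then acos (Re z / Cmod z) else - acos (Re z / Cmod z).

Definition Clog (z : C) : C := (ln (Cmod z), Carg z).

(* Principal value of z ^ w for z <> 0; Coquelicot's [Cpow] only has natural
   exponents. *)
Definition Cpower (z w : C) : C := Cexp (w * Clog z)%C.

Definition C_derive_n (k : nat) (f : C -> C) : C -> C := Nat.iter k C_derive f.

(* Euler's integral: this is the gamma function on the half-plane 0 < Re z,
   and an unspecified value where the integral diverges. *)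
Definition CGamma (z : C) : C :=
  RInt_gen (V := C_R_CompleteNormedModule)
    (fun t : R => (Cpower (RtoC t) (z - 1) * RtoC (exp (- t)))%C)
    (at_right 0) (Rbar_locally p_infty).

Definition analytic_at (f : C -> C) (z0 : C) : Prop :=
  exists (a : nat -> C) (rho : R), 0 < rho /\
    forall z : C, Cmod (z - z0)%C < rho -> is_pseries a (z - z0)%C (f z).

(* [zeta s a] is the Hurwitz zeta function: for each a > 0 it is the sum of the
   Dirichlet series on 1 < Re s, continued analytically in s.  As C \ {1} is
   connected, this determines [zeta s a] for all s <> 1 and a > 0; its values
   elsewhere are arbitrary. *)
Definition is_Hurwitz_zeta (zeta : C -> R -> C) : Prop :=
  forall a : R, 0 < a ->
    (forall s : C, 1 < Re s ->
       is_series (fun n : nat => Cpower (RtoC (INR n + a)) (- s)%C) (zeta s a)) /\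
    (forall s : C, s <> RtoC 1 -> analytic_at (fun z : C => zeta z a) s).

(* e^{2 pi i n x} *)
Definition Fourier_exp (n : Z) (x : R) : C := Cexp (RtoC (2 * PI * IZR n * x) * Ci)%C.

(* Integrals over [0,1] are improper at both ends, because zeta(s,a) is
   unbounded as a -> 0 when 0 < Re s.  Absolute integrability makes them
   coincide with Lebesgue integrals. *)
Definition integrable01 (f : R -> C) : Prop :=
  ex_RInt_gen (V := C_R_NormedModule) f (at_right 0) (at_left 1) /\
  ex_RInt_gen (fun x : R => Cmod (f x)) (at_right 0) (at_left 1).

Definition is_Fourier_coeff (f : R -> C) (n : Z) (c : C) : Prop :=
  is_RInt_gen (V := C_R_NormedModule)
    (fun x : R => (f x * Fourier_exp (- n) x)%C) (at_right 0) (at_left 1) c.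

(* The sum of [u n] over the integers 1 <= |n| <= N. *)
Definition symmetric_sum (u : Z -> C) (N : nat) : C :=
  sum_n_m (fun k : nat => (u (Z.of_nat k) + u (- Z.of_nat k)%Z)%C) 1 N.

Definition two_pi_i (n : Z) : C := (RtoC (2 * PI * IZR n) * Ci)%C.

Definition zeta_coeff (r : nat) (s : C) (n : Z) : C :=
  (Cpower (two_pi_i n) (s - 1) *
   sum_n (fun l : nat =>
     RtoC ((-1) ^ (r - l) * Binomial.C r l) *
     C_derive_n (r - l) CGamma (1 - s) *
     Cpow (Clog (two_pi_i n)) l) r)%C.

(* Main.v *)
Require Import Defs.
From Stdlib Require Import Reals ZArith Lra Lia Psatz FunctionalExtensionality.
From Coquelicot Require Import Coquelicot.

Open Scope R_scope.

(* Put c_n(s) = Gamma(1-s) (2 pi i n)^(s-1) and e(x) = exp(2 pi i x).  Summation by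
   parts turns (e(x) - 1) sum c_n e(nx) into a series that converges absolutely,
   locally uniformly in s, for all Re s < 1, and is O(x^d) and O((1-x)^d) at the ends
   of [0,1] for some d > 0.

   For real 0 < s < 1 the Fourier coefficients of zeta(s,x) unfold to
   int_0^oo x^(-s) e(-nx) dx, which is c_n(s) after turning the ray of integration to
   the real axis, and Dini's criterion gives Hurwitz' formula on 0 < x < 1.  By the
   identity theorem, (e(x) - 1) zeta(s,x) is the summed-by-parts series for all
   Re s < 1, and comparing Taylor coefficients in s gives the same for every
   s-derivative.

   Conversely, let f satisfy (e(x) - 1) f(x) = BV(x) on (0,1), with BV the summed-by-parts
   series of coefficients c_n that tend to 0.  Then f is integrable, and its Fourier
   coefficients d_n satisfy d_(n-1) - d_n = c_(n-1) - c_n; so d_n - c_n is constant, and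
   is 0 by the Riemann-Lebesgue lemma. *)

(** * Complex sequences and series *)

(** The obstacle is that the series converges only conditionally when 0 <= Re s < 1, so it can be
    neither differentiated in s nor integrated in x term by term. The differences of its
    coefficients are smaller by a factor 1/|n|: they are summable even against a weight |n|^d with a
    small d > 0. This spare weight is the source of the decay x^d at the ends, and dividing by e(x)
    - 1, which has simple zeros there, leaves the integrable singularity x^(d-1).

    Analyticity means expansion in a power series on a disc, and contour integrals are avoided.
    Cauchy's estimates come from averaging over a circle with the orthogonality of exponentials; the
    ray is turned by differentiating in the angle. Cauchy's estimates also take care of the
    s-derivatives: bounds for the powers (2 pi i n)^(z-1) and their differences on a disc around s
    pass to all Taylor coefficients with one constant per order, so that powers of log(2 pi i n) are
    never estimated. The Gamma factor does not depend on n and is multiplied in separately as a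
    Taylor series. *)

Definition Clim (u : nat -> C) (l : C) : Prop :=
  forall eps : R, 0 < eps -> exists N : nat, forall n : nat, (N <= n)%nat -> Cmod (u n - l)%C < eps.

(** The indices run below [n], unlike in [sum_n]: the empty sum exists and [Csum u (n + m)] splits
    without an off-by-one. *)
Fixpoint Csum (u : nat -> C) (n : nat) : C :=
  match n with O => RtoC 0 | S m => (Csum u m + u m)%C end.

Fixpoint Rsum (u : nat -> R) (n : nat) : R :=
  match n with O => 0 | S m => Rsum u m + u m end.

Lemma Cmod_minus_sym (a b : C) : Cmod (a - b) = Cmod (b - a).
Proof. rewrite <- Cmod_opp; f_equal; ring. Qed.

Lemma Cminus_0_r (z : C) : (z - 0)%C = z.
Proof. ring. Qed.

Lemma Cmod_triangle3 (a b c : C) : Cmod (a - c) <= Cmod (a - b) + Cmod (b - c).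
Proof. replace (a - c)%C with ((a - b) + (b - c))%C by ring; apply Cmod_triangle. Qed.

Lemma Cmod_minus_le (a b : C) : Cmod (a - b) <= Cmod a + Cmod b.
Proof. rewrite <- (Cmod_opp b); apply Cmod_triangle. Qed.

Lemma Cmod_minus_ge (a b : C) : Cmod a - Cmod b <= Cmod (a - b).
Proof.
  generalize (Cmod_triangle (a - b) b); replace (a - b + b)%C with a by ring; lra.
Qed.

Lemma Cmod_small_eq (a b : C) : (forall eps, 0 < eps -> Cmod (a - b) <= eps) -> a = b.
Proof.
  intro H; apply Ceq_minus, Cmod_eq_0; apply Rle_antisym; [|apply Cmod_ge_0].
  apply le_epsilon; intros e He; rewrite Rplus_0_l; auto.
Qed.

Lemma ball_C_Cmod (x y : C) (eps : R) :
  Cmod (y - x) < eps -> @ball C_UniformSpace x eps y.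
Proof.
  intro H; generalize (Rmax_Cmod (y - x)%C); intro H1.
  split; unfold ball; simpl; unfold AbsRing_ball, abs, minus, plus, opp; simpl.
  - eapply Rle_lt_trans; [|exact H]; eapply Rle_trans; [|exact H1]; apply Rmax_l.
  - eapply Rle_lt_trans; [|exact H]; eapply Rle_trans; [|exact H1]; apply Rmax_r.
Qed.

(** The uniform structure of C is the product one, so its balls are squares; 2 is a crude substitute
    for sqrt 2. *)
Lemma Cmod_ball_C (x y : C) (eps : R) :
  @ball C_UniformSpace x eps y -> Cmod (y - x) < 2 * eps.
Proof.
  intros [H1 H2]; unfold ball in H1, H2; simpl in H1, H2;
    unfold AbsRing_ball, abs, minus, plus, opp in H1, H2; simpl in H1, H2.
  generalize (Cmod_triangle (RtoC (fst (y - x)%C)) (RtoC (snd (y - x)%C) * Ci)%C).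
  replace (RtoC (fst (y - x)%C) + RtoC (snd (y - x)%C) * Ci)%C with (y - x)%C.
  2:{ apply injective_projections; simpl; ring. }
  rewrite Cmod_mult, Cmod_Ci, !Cmod_R; simpl; unfold Rminus in *; lra.
Qed.

Lemma filterlim_Cmod {T} (F : (T -> Prop) -> Prop) {FF : Filter F} (u : T -> C) (l : C) :
  filterlim u F (@locally C_UniformSpace l) <->
  (forall eps, 0 < eps -> F (fun t => Cmod (u t - l) < eps)).
Proof.
  split.
  - intros H eps He. apply (H (fun y => Cmod (y - l) < eps)).
    assert (He2 : 0 < eps / 2) by lra.
    exists (mkposreal _ He2); intros y Hy; apply Cmod_ball_C in Hy; simpl in Hy; lra.
  - intros H P [eps HP]; change (F (fun t => P (u t))).
    apply (filter_imp (fun t => Cmod (u t - l) < eps)); [|apply H, cond_pos].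
    intros t Ht; apply HP, ball_C_Cmod, Ht.
Qed.

Lemma filterlim_Clim (u : nat -> C) (l : C) :
  filterlim u eventually (@locally C_UniformSpace l) <-> Clim u l.
Proof. exact (filterlim_Cmod eventually u l). Qed.

Lemma sum_n_Csum (u : nat -> C) (n : nat) : @sum_n C_AbelianMonoid u n = Csum u (S n).
Proof.
  induction n; [rewrite sum_O; simpl; ring|].
  rewrite sum_Sn, IHn; reflexivity.
Qed.

Lemma Clim_incr_1 (u : nat -> C) (l : C) : Clim (fun n => u (S n)) l <-> Clim u l.
Proof.
  split; intros H eps He; destruct (H eps He) as [N HN].
  - exists (S N); intros [|n] Hn; [lia|]; apply HN; lia.
  - exists N; intros n Hn; apply HN; lia.
Qed.

Lemma Clim_ext (u v : nat -> C) (l : C) : (forall n, u n = v n) -> Clim u l -> Clim v l.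
Proof. intros E H eps He; destruct (H eps He) as [N HN]; exists N; intros; rewrite <- E; auto. Qed.

Lemma is_series_Clim (u : nat -> C) (l : C) :
  @is_series C_AbsRing C_NormedModule u l <-> Clim (Csum u) l.
Proof.
  unfold is_series; rewrite <- Clim_incr_1, <- filterlim_Clim.
  split; apply filterlim_ext; intro n; [|symmetry]; apply (sum_n_Csum u n).
Qed.

Definition PS (a : nat -> C) (w l : C) : Prop := Clim (Csum (fun m => a m * w ^ m)%C) l.

Lemma is_pseries_PS (a : nat -> C) (w l : C) :
  @is_pseries C_AbsRing C_NormedModule a w l <-> PS a w l.
Proof.
  assert (E : forall n, scal (@pow_n C_AbsRing w n) (a n : C_NormedModule) = (a n * w ^ n)%C).
  { intro n; exact (Cmult_comm (w ^ n) (a n)). }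
  unfold is_pseries, PS; rewrite <- is_series_Clim; split.
  - exact (is_series_ext _ _ l E).
  - exact (is_series_ext _ _ l (fun n => eq_sym (E n))).
Qed.

Lemma Clim_unique (u : nat -> C) (l l' : C) : Clim u l -> Clim u l' -> l = l'.
Proof.
  intros H H'; apply Cmod_small_eq; intros e He.
  destruct (H (e / 2)) as [N HN]; [lra|]; destruct (H' (e / 2)) as [N' HN']; [lra|].
  specialize (HN (max N N') (Nat.le_max_l _ _)); specialize (HN' (max N N') (Nat.le_max_r _ _)).
  generalize (Cmod_triangle3 l (u (max N N')) l'); rewrite (Cmod_minus_sym l (u _)); lra.
Qed.

Lemma Clim_const (l : C) : Clim (fun _ => l) l.
Proof.
  intros e He; exists O; intros; replace (l - l)%C with (RtoC 0) by ring; now rewrite Cmod_0.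
Qed.

Lemma Clim_plus (u v : nat -> C) (l m : C) :
  Clim u l -> Clim v m -> Clim (fun n => u n + v n)%C (l + m)%C.
Proof.
  intros H H' e He.
  destruct (H (e / 2)) as [N HN]; [lra|]; destruct (H' (e / 2)) as [N' HN']; [lra|].
  exists (max N N'); intros n Hn; specialize (HN n ltac:(lia)); specialize (HN' n ltac:(lia)).
  replace (u n + v n - (l + m))%C with ((u n - l) + (v n - m))%C by ring.
  eapply Rle_lt_trans; [apply Cmod_triangle|lra].
Qed.

Lemma Clim_scal (c : C) (u : nat -> C) (l : C) :
  Clim u l -> Clim (fun n => c * u n)%C (c * l)%C.
Proof.
  intros H e He.
  assert (Hc := Cmod_ge_0 c).
  destruct (H (e / (Cmod c + 1))) as [N HN]; [apply Rdiv_lt_0_compat; lra|].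
  exists N; intros n Hn; specialize (HN n Hn).
  replace (c * u n - c * l)%C with (c * (u n - l))%C by ring; rewrite Cmod_mult.
  apply Rle_lt_trans with ((Cmod c + 1) * Cmod (u n - l)).
  - apply Rmult_le_compat_r; [apply Cmod_ge_0|lra].
  - apply (Rmult_lt_compat_l (Cmod c + 1)) in HN; [|lra].
    replace ((Cmod c + 1) * (e / (Cmod c + 1))) with e in HN by (field; lra); exact HN.
Qed.

Lemma Clim_opp (u : nat -> C) (l : C) : Clim u l -> Clim (fun n => - u n)%C (- l)%C.
Proof.
  intro H; replace (- l)%C with (RtoC (-1) * l)%C by ring.
  eapply Clim_ext; [|apply Clim_scal, H]; intro; simpl; ring.
Qed.

Lemma Clim_minus (u v : nat -> C) (l m : C) :
  Clim u l -> Clim v m -> Clim (fun n => u n - v n)%C (l - m)%C.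
Proof. intros; apply Clim_plus; [|apply Clim_opp]; assumption. Qed.

Lemma Clim_le (u : nat -> C) (l b : C) (M : R) :
  Clim u l -> (exists N, forall n, (N <= n)%nat -> Cmod (u n - b) <= M) -> Cmod (l - b) <= M.
Proof.
  intros H [N HN]; apply le_epsilon; intros e He; destruct (H e He) as [N' HN'].
  specialize (HN (max N N') (Nat.le_max_l _ _)); specialize (HN' (max N N') (Nat.le_max_r _ _)).
  generalize (Cmod_triangle3 l (u (max N N')) b); rewrite (Cmod_minus_sym l (u _)); lra.
Qed.

Lemma Clim_squeeze (u : nat -> C) (l : C) (v : nat -> R) :
  (forall n, Cmod (u n - l) <= v n) -> is_lim_seq v 0 -> Clim u l.
Proof.
  intros H Hv e He; apply is_lim_seq_spec in Hv; destruct (Hv (mkposreal e He)) as [N HN].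
  exists N; intros n Hn; specialize (HN n Hn); simpl in HN; rewrite Rminus_0_r in HN.
  eapply Rle_lt_trans; [apply H|]; apply Rabs_lt_between in HN; lra.
Qed.

Lemma Clim_abs (u : nat -> C) (l : C) : Clim u l -> is_lim_seq (fun n => Cmod (u n - l)) 0.
Proof.
  intro H; apply is_lim_seq_spec; intros e; destruct (H e (cond_pos e)) as [N HN].
  exists N; intros n Hn; rewrite Rminus_0_r, Rabs_pos_eq; [auto|apply Cmod_ge_0].
Qed.

Lemma Clim_bounded (u : nat -> C) (l : C) :
  Clim u l -> exists M, forall n, Cmod (u n) <= M.
Proof.
  intro H; destruct (H 1 Rlt_0_1) as [N HN].
  assert (HB : forall k, exists M, forall n, (n < k)%nat -> Cmod (u n) <= M).
  { induction k as [|k [M HM]]; [exists 0; lia|].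
    exists (Rmax M (Cmod (u k))); intros n Hn; destruct (Nat.eq_dec n k) as [->|].
    - apply Rmax_r.
    - eapply Rle_trans; [apply HM; lia|apply Rmax_l]. }
  destruct (HB N) as [M HM]; exists (Rmax M (Cmod l + 1)); intro n.
  destruct (Nat.lt_ge_cases n N) as [h|h].
  - eapply Rle_trans; [apply HM, h|apply Rmax_l].
  - specialize (HN n h); generalize (Cmod_triangle (u n - l) l).
    replace (u n - l + l)%C with (u n) by ring; generalize (Rmax_r M (Cmod l + 1)); lra.
Qed.

Lemma Clim_mult (u v : nat -> C) (l m : C) :
  Clim u l -> Clim v m -> Clim (fun n => u n * v n)%C (l * m)%C.
Proof.
  intros Hu Hv.
  destruct (Clim_bounded _ _ Hv) as [M HM].
  apply Clim_squeeze with (fun n => Cmod (u n - l) * M + Cmod l * Cmod (v n - m)).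
  - intro n; replace (u n * v n - l * m)%C with ((u n - l) * v n + l * (v n - m))%C by ring.
    eapply Rle_trans; [apply Cmod_triangle|]; rewrite !Cmod_mult.
    apply Rplus_le_compat_r, Rmult_le_compat_l; [apply Cmod_ge_0|apply HM].
  - replace (Finite 0) with (Rbar_plus (Rbar_mult 0 M) (Rbar_mult (Cmod l) 0))
      by (simpl; f_equal; ring).
    apply is_lim_seq_plus'; apply is_lim_seq_mult';
      auto using Clim_abs, is_lim_seq_const.
Qed.

Lemma Clim_Cauchy (u : nat -> C) :
  (forall eps, 0 < eps -> exists N, forall n m, (N <= n)%nat -> (N <= m)%nat -> Cmod (u n - u m) < eps) ->
  exists l, Clim u l.
Proof.
  intro H.
  assert (Hf : Cauchy_crit (fun n => fst (u n))).
  { intros e He; destruct (H e He) as [N HN]; exists N; intros n m Hn Hm; unfold Rdist.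
    eapply Rle_lt_trans; [|apply (HN n m); lia]. apply (re_le_Cmod (u n - u m)%C). }
  assert (Hs : Cauchy_crit (fun n => snd (u n))).
  { intros e He; destruct (H e He) as [N HN]; exists N; intros n m Hn Hm; unfold Rdist.
    eapply Rle_lt_trans; [|apply (HN n m); lia].
    eapply Rle_trans; [|apply (Rmax_Cmod (u n - u m)%C)]; apply Rmax_r. }
  destruct (Rcomplete.R_complete _ Hf) as [a Ha]; destruct (Rcomplete.R_complete _ Hs) as [b Hb].
  exists (a, b); intros e He.
  destruct (Ha (e / 2)) as [N HN]; [lra|]; destruct (Hb (e / 2)) as [N' HN']; [lra|].
  exists (max N N'); intros n Hn; specialize (HN n ltac:(lia)); specialize (HN' n ltac:(lia)).
  replace e with (2 * (e / 2)) by field.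
  apply Cmod_ball_C; split; assumption.
Qed.

(** * Finite sums and series with nonnegative terms *)

Lemma Csum_ext (u v : nat -> C) (n : nat) :
  (forall k, (k < n)%nat -> u k = v k) -> Csum u n = Csum v n.
Proof. induction n; intro H; simpl; [reflexivity|]; rewrite IHn, H; auto. Qed.

Lemma Csum_plus (u v : nat -> C) (n : nat) : Csum (fun k => u k + v k)%C n = (Csum u n + Csum v n)%C.
Proof. induction n; simpl; [ring|rewrite IHn; ring]. Qed.

Lemma Csum_minus (u v : nat -> C) (n : nat) : Csum (fun k => u k - v k)%C n = (Csum u n - Csum v n)%C.
Proof. induction n; simpl; [ring|rewrite IHn; ring]. Qed.

Lemma Csum_scal (c : C) (u : nat -> C) (n : nat) : Csum (fun k => c * u k)%C n = (c * Csum u n)%C.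
Proof. induction n; simpl; [ring|rewrite IHn; ring]. Qed.

Lemma Csum_zero (u : nat -> C) (n : nat) : (forall k, (k < n)%nat -> u k = RtoC 0) -> Csum u n = RtoC 0.
Proof. intro H; induction n; simpl; [reflexivity|]; rewrite IHn, H; auto; ring. Qed.

Lemma Csum_app (u : nat -> C) (n m : nat) :
  Csum u (n + m) = (Csum u n + Csum (fun k => u (n + k)%nat) m)%C.
Proof.
  induction m; [rewrite Nat.add_0_r; simpl; ring|].
  rewrite Nat.add_succ_r; simpl; rewrite IHm; ring.
Qed.

Lemma Csum_swap (u : nat -> nat -> C) (n m : nat) :
  Csum (fun i => Csum (u i) m) n = Csum (fun j => Csum (fun i => u i j) n) m.
Proof.
  induction n; simpl; [symmetry; apply Csum_zero; reflexivity|].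
  rewrite IHn, <- Csum_plus; reflexivity.
Qed.

Lemma Csum_single (u : nat -> C) (n i : nat) :
  (i < n)%nat -> (forall k, (k < n)%nat -> k <> i -> u k = RtoC 0) -> Csum u n = u i.
Proof.
  induction n; intros Hi H; [lia|]; simpl; destruct (Nat.eq_dec i n) as [->|].
  - rewrite Csum_zero; [ring|]; intros; apply H; lia.
  - rewrite IHn, (H n); try lia; [ring|]; intros; apply H; lia.
Qed.

Lemma Cmod_Csum_le (u : nat -> C) (A : nat -> R) (n : nat) :
  (forall k, (k < n)%nat -> Cmod (u k) <= A k) -> Cmod (Csum u n) <= Rsum A n.
Proof.
  induction n; intro H; simpl; [rewrite Cmod_0; lra|].
  eapply Rle_trans; [apply Cmod_triangle|]; apply Rplus_le_compat; auto.
Qed.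

Lemma Rsum_ext (u v : nat -> R) (n : nat) :
  (forall k, (k < n)%nat -> u k = v k) -> Rsum u n = Rsum v n.
Proof. induction n; intro H; simpl; [reflexivity|]; rewrite IHn, H; auto. Qed.

Lemma Rsum_le (u v : nat -> R) (n : nat) :
  (forall k, (k < n)%nat -> u k <= v k) -> Rsum u n <= Rsum v n.
Proof. induction n; intro H; simpl; [lra|]; apply Rplus_le_compat; auto. Qed.

Lemma Rsum_scal (c : R) (u : nat -> R) (n : nat) : Rsum (fun k => c * u k) n = c * Rsum u n.
Proof. induction n; simpl; [ring|rewrite IHn; ring]. Qed.

Lemma Rsum_app (u : nat -> R) (n m : nat) :
  Rsum u (n + m) = Rsum u n + Rsum (fun k => u (n + k)%nat) m.
Proof.
  induction m; [rewrite Nat.add_0_r; simpl; ring|].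
  rewrite Nat.add_succ_r; simpl; rewrite IHm; ring.
Qed.

Lemma Rsum_telescope (v : nat -> R) (n : nat) : Rsum (fun k => v k - v (S k)) n = v O - v n.
Proof. induction n; simpl; [ring|rewrite IHn; ring]. Qed.

Lemma Rsum_pos (u : nat -> R) (n : nat) : (forall k, 0 <= u k) -> 0 <= Rsum u n.
Proof. intro H; induction n; simpl; [lra|]; specialize (H n); lra. Qed.

Lemma Rsum_mono (u : nat -> R) (n m : nat) : (forall k, 0 <= u k) -> (n <= m)%nat -> Rsum u n <= Rsum u m.
Proof.
  intros H Hnm; replace m with (n + (m - n))%nat by lia; rewrite Rsum_app.
  generalize (Rsum_pos (fun k => u (n + k)%nat) (m - n) (fun k => H _)); lra.
Qed.

(** The sum is encoded as the supremum of the partial sums: [l - Rsum A N] is then a nonnegative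
    tail and serves directly as an error bound. *)
Definition is_sum (A : nat -> R) (l : R) : Prop :=
  (forall n, 0 <= A n) /\ (forall n, Rsum A n <= l) /\
  (forall eps, 0 < eps -> exists N, forall n, (N <= n)%nat -> l - eps < Rsum A n).

Lemma is_sum_bounded (A : nat -> R) (M : R) :
  (forall n, 0 <= A n) -> (forall n, Rsum A n <= M) -> exists l, is_sum A l.
Proof.
  intros H0 HM.
  destruct (completeness (fun x => exists n, x = Rsum A n)) as [l [Hl1 Hl2]].
  - exists M; intros x [n ->]; apply HM.
  - exists 0, O; reflexivity.
  - exists l; repeat split; auto.
    + intro n; apply Hl1; exists n; reflexivity.
    + intros e He; apply Classical_Prop.NNPP; intro Hn.
      assert (l <= l - e); [|lra].
      apply Hl2; intros x [n ->].
      destruct (Rle_lt_dec (Rsum A n) (l - e)) as [h|h]; [exact h|].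
      exfalso; apply Hn; exists n; intros m Hm.
      eapply Rlt_le_trans; [exact h|apply Rsum_mono; auto].
Qed.

Lemma is_sum_le (A B : nat -> R) (l : R) :
  (forall n, 0 <= A n <= B n) -> is_sum B l -> exists l', is_sum A l'.
Proof.
  intros H [_ [HB _]]; apply is_sum_bounded with l; [apply H|].
  intro n; eapply Rle_trans; [apply Rsum_le; intros; apply H|apply HB].
Qed.

Lemma is_sum_scal (c : R) (A : nat -> R) (l : R) :
  0 <= c -> is_sum A l -> is_sum (fun n => c * A n) (c * l).
Proof.
  intros Hc [H0 [H1 H2]]; repeat split.
  - intro n; apply Rmult_le_pos; auto.
  - intro n; rewrite Rsum_scal; apply Rmult_le_compat_l; auto.
  (* Dividing by [c + 1] covers [c = 0]. *)
  - intros e He; destruct (H2 (e / (c + 1))) as [N HN]; [apply Rdiv_lt_0_compat; lra|].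
    exists N; intros n Hn; specialize (HN n Hn); specialize (H1 n); rewrite Rsum_scal.
    assert (E : (c + 1) * (e / (c + 1)) = e) by (field; lra).
    set (d := e / (c + 1)) in *; assert (0 < d) by (apply Rdiv_lt_0_compat; lra); nra.
Qed.

(** Weierstrass' test with the tail kept explicit. The error depends on the majorant only, so a
    majorant free of a parameter yields convergence uniform in that parameter. *)
Lemma series_dominated (u : nat -> C) (A : nat -> R) (S : R) :
  (forall n, Cmod (u n) <= A n) -> is_sum A S ->
  exists l, Clim (Csum u) l /\ forall N, Cmod (l - Csum u N) <= S - Rsum A N.
Proof.
  intros Hu [H0 [H1 H2]].
  assert (HT : forall N n, (N <= n)%nat -> Cmod (Csum u n - Csum u N) <= S - Rsum A N).
  { intros N n Hn; replace n with (N + (n - N))%nat by lia; rewrite Csum_app.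
    set (k := (n - N)%nat).
    replace (_ - _)%C with (Csum (fun j => u (N + j)%nat) k) by ring.
    eapply Rle_trans; [apply (Cmod_Csum_le _ (fun j => A (N + j)%nat)); intros; apply Hu|].
    specialize (H1 (N + k)%nat); rewrite Rsum_app in H1; lra. }
  destruct (Clim_Cauchy (Csum u)) as [l Hl].
  - intros e He; destruct (H2 (e / 2)) as [N HN]; [lra|]; exists N; intros n m Hn Hm.
    generalize (HT N n Hn) (HT N m Hm) (HN N (le_n _)) (Cmod_triangle3 (Csum u n) (Csum u N) (Csum u m)).
    rewrite (Cmod_minus_sym (Csum u N) (Csum u m)); lra.
  - exists l; split; [exact Hl|]; intro N; apply Clim_le with (1 := Hl).
    exists N; intros n Hn; auto.
Qed.

Lemma Clim_series_bound (u : nat -> C) (A : nat -> R) (S : R) (l : C) (N : nat) :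
  (forall n, Cmod (u n) <= A n) -> is_sum A S -> Clim (Csum u) l ->
  Cmod (l - Csum u N) <= S - Rsum A N.
Proof.
  intros Hu HA Hl; destruct (series_dominated u A S Hu HA) as [l' [Hl' H]].
  rewrite (Clim_unique _ _ _ Hl Hl'); apply H.
Qed.

Lemma is_sum_lim (A : nat -> R) (S : R) : is_sum A S -> is_lim_seq (fun N => S - Rsum A N) 0.
Proof.
  intros [H0 [H1 H2]]; apply is_lim_seq_spec; intros e.
  destruct (H2 e (cond_pos e)) as [N HN]; exists N; intros n Hn.
  specialize (HN n Hn); specialize (H1 n); rewrite Rminus_0_r, Rabs_pos_eq; lra.
Qed.

Lemma Clim_terms (u : nat -> C) (l : C) : Clim (Csum u) l -> Clim u 0.
Proof.
  intro H; replace (RtoC 0) with (l - l)%C by ring.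
  apply Clim_ext with (fun n => Csum u (S n) - Csum u n)%C; [intro; simpl; ring|].
  apply Clim_minus; [apply (Clim_incr_1 (Csum u))|]; exact H.
Qed.

Lemma geometric_sum (q : R) : 0 <= q < 1 -> is_sum (fun n => q ^ n) (/ (1 - q)).
Proof.
  intro Hq.
  assert (E : forall n, Rsum (fun k => q ^ k) n = / (1 - q) - q ^ n * / (1 - q)).
  { induction n; simpl; [ring|]; rewrite IHn; field; lra. }
  assert (Hi : 0 < / (1 - q)) by (apply Rinv_0_lt_compat; lra).
  assert (Hp : forall n, 0 <= q ^ n) by (intro; apply pow_le; lra).
  repeat split; auto.
  - intro n; rewrite E; specialize (Hp n); nra.
  - intros e He.
    assert (L := is_lim_seq_geom q ltac:(rewrite Rabs_pos_eq; lra)).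
    apply is_lim_seq_spec in L.
    destruct (L (mkposreal (e * (1 - q)) ltac:(apply Rmult_lt_0_compat; lra))) as [N HN].
    exists N; intros n Hn; specialize (HN n Hn); simpl in HN; rewrite E.
    rewrite Rminus_0_r, Rabs_pos_eq in HN by auto.
    assert (q ^ n * / (1 - q) < e * (1 - q) * / (1 - q)) by (apply Rmult_lt_compat_r; assumption).
    rewrite Rmult_assoc, Rinv_r in H by lra; lra.
Qed.

(** * Complex-valued functions of a real variable *)

Lemma exp_le_compat (x y : R) : x <= y -> exp x <= exp y.
Proof. intros [H| ->]; [apply Rlt_le, exp_increasing, H|apply Rle_refl]. Qed.

Lemma Cexp_plus (z w : C) : Cexp (z + w) = (Cexp z * Cexp w)%C.
Proof.
  apply injective_projections; unfold Cexp; cbn -[Re Im]; rewrite re_plus, im_plus, exp_plus, ?cos_plus, ?sin_plus; ring.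
Qed.

Lemma Cexp_0 : Cexp 0 = RtoC 1.
Proof. apply injective_projections; unfold Cexp, RtoC; simpl; rewrite exp_0, ?cos_0, ?sin_0; ring. Qed.

Lemma Cmod_polar (r t : R) : 0 <= r -> Cmod (r * cos t, r * sin t) = r.
Proof.
  intro Hr; unfold Cmod; simpl.
  replace (_ + _) with (r * r) by (generalize (sin2_cos2 t); unfold Rsqr; intro H; nra).
  apply sqrt_square, Hr.
Qed.

Lemma Cmod_Cexp (z : C) : Cmod (Cexp z) = exp (Re z).
Proof. apply Cmod_polar, Rlt_le, exp_pos. Qed.

Lemma Cexp_RtoC (x : R) : Cexp (RtoC x) = RtoC (exp x).
Proof. apply injective_projections; unfold Cexp, RtoC; simpl; rewrite ?cos_0, ?sin_0; ring. Qed.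

Lemma Cmod_le_exp (z : C) : Cmod (Cexp z) <= exp (Cmod z).
Proof.
  rewrite Cmod_Cexp; apply exp_le_compat, Rle_trans with (2 := re_le_Cmod z), Rle_abs.
Qed.

Lemma fst_Cmod_le (z : C) : Rabs (fst z) <= Cmod z.
Proof. eapply Rle_trans; [apply Rmax_l|apply Rmax_Cmod]. Qed.

Lemma snd_Cmod_le (z : C) : Rabs (snd z) <= Cmod z.
Proof. eapply Rle_trans; [apply Rmax_r|apply Rmax_Cmod]. Qed.

Definition Ccont (f : R -> C) (x : R) : Prop := @continuous R_UniformSpace C_UniformSpace f x.

Lemma Ccont_eps (f : R -> C) (x : R) :
  Ccont f x <-> forall eps, 0 < eps -> locally x (fun y => Cmod (f y - f x) < eps).
Proof. exact (filterlim_Cmod (locally x) f (f x)). Qed.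

Lemma Ccont_pair (f : R -> C) (x : R) :
  continuous (fun t => fst (f t)) x -> continuous (fun t => snd (f t)) x -> Ccont f x.
Proof.
  intros H1 H2 P [eps HP].
  apply filterlim_locally with (eps := eps) in H1.
  apply filterlim_locally with (eps := eps) in H2.
  unfold filtermap; generalize (filter_and _ _ H1 H2); apply filter_imp.
  intros y [Hy1 Hy2]; apply HP; split; assumption.
Qed.

Lemma Ccont_fst (f : R -> C) (x : R) : Ccont f x -> continuous (fun t => fst (f t)) x.
Proof.
  intro H; apply (continuous_comp f fst); [exact H|].
  rewrite (surjective_pairing (f x)); apply continuous_fst.
Qed.

Lemma Ccont_snd (f : R -> C) (x : R) : Ccont f x -> continuous (fun t => snd (f t)) x.
Proof.
  intro H; apply (continuous_comp f snd); [exact H|].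
  rewrite (surjective_pairing (f x)); apply continuous_snd.
Qed.

Lemma Ccont_const (c : C) (x : R) : Ccont (fun _ => c) x.
Proof. apply continuous_const. Qed.

Lemma Ccont_RtoC (f : R -> R) (x : R) : continuous f x -> Ccont (fun t => RtoC (f t)) x.
Proof. intro H; apply Ccont_pair; simpl; [exact H|apply continuous_const]. Qed.

Lemma Ccont_plus (f g : R -> C) (x : R) : Ccont f x -> Ccont g x -> Ccont (fun t => f t + g t)%C x.
Proof.
  intros Hf Hg; apply Ccont_pair; simpl.
  - apply (continuous_plus (fun t => fst (f t)) (fun t => fst (g t))); apply Ccont_fst; assumption.
  - apply (continuous_plus (fun t => snd (f t)) (fun t => snd (g t))); apply Ccont_snd; assumption.
Qed.

Lemma Ccont_mult (f g : R -> C) (x : R) : Ccont f x -> Ccont g x -> Ccont (fun t => f t * g t)%C x.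
Proof.
  intros Hf Hg.
  generalize (Ccont_fst _ _ Hf) (Ccont_fst _ _ Hg) (Ccont_snd _ _ Hf) (Ccont_snd _ _ Hg).
  intros H1 H2 H3 H4; apply Ccont_pair; simpl.
  - apply (continuous_minus (fun t => fst (f t) * fst (g t)) (fun t => snd (f t) * snd (g t)));
      apply (continuous_mult (K := R_AbsRing)); assumption.
  - apply (continuous_plus (fun t => fst (f t) * snd (g t)) (fun t => snd (f t) * fst (g t)));
      apply (continuous_mult (K := R_AbsRing)); assumption.
Qed.

Lemma Ccont_opp (f : R -> C) (x : R) : Ccont f x -> Ccont (fun t => - f t)%C x.
Proof.
  intros Hf; apply Ccont_pair; simpl.
  - apply (continuous_opp (fun t => fst (f t))), Ccont_fst, Hf.
  - apply (continuous_opp (fun t => snd (f t))), Ccont_snd, Hf.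
Qed.

Lemma Ccont_minus (f g : R -> C) (x : R) : Ccont f x -> Ccont g x -> Ccont (fun t => f t - g t)%C x.
Proof. intros; apply Ccont_plus; [|apply Ccont_opp]; assumption. Qed.

Lemma Ccont_Cmod (f : R -> C) (x : R) : Ccont f x -> continuous (fun t => Cmod (f t)) x.
Proof.
  intro H; apply filterlim_locally; intro eps.
  generalize (proj1 (Ccont_eps f x) H eps (cond_pos eps)); apply filter_imp; intros y Hy.
  unfold ball; simpl; unfold AbsRing_ball, abs, minus, plus, opp; simpl.
  apply Rabs_def1; generalize (Cmod_minus_ge (f y) (f x)) (Cmod_minus_ge (f x) (f y));
    rewrite (Cmod_minus_sym (f x) (f y)); lra.
Qed.

Lemma Ccont_Cexp (f : R -> C) (x : R) : Ccont f x -> Ccont (fun t => Cexp (f t)) x.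
Proof.
  intro H; generalize (Ccont_fst _ _ H) (Ccont_snd _ _ H); intros H1 H2.
  assert (E : continuous (fun t => exp (fst (f t))) x) by (apply (continuous_comp _ exp); [exact H1|apply continuous_exp]).
  apply Ccont_pair; unfold Cexp; cbn -[Re Im]; unfold Re, Im.
  - apply (continuous_mult (K := R_AbsRing) (fun t => exp (fst (f t)))); [exact E|].
    apply (continuous_comp _ cos); [exact H2|apply continuous_cos].
  - apply (continuous_mult (K := R_AbsRing) (fun t => exp (fst (f t)))); [exact E|].
    apply (continuous_comp _ sin); [exact H2|apply continuous_sin].
Qed.

Lemma Ccont_inv (f : R -> C) (x : R) : f x <> RtoC 0 -> Ccont f x -> Ccont (fun t => / f t)%C x.
Proof.
  intros Hn H; apply Ccont_eps; intros e He.
  apply Cmod_gt_0 in Hn; set (m := Cmod (f x)) in *.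
  assert (Hd : 0 < Rmin (m / 2) (e * (m / 2 * m))).
  { apply Rmin_pos; [lra|]; apply Rmult_lt_0_compat; [lra|]; apply Rmult_lt_0_compat; lra. }
  generalize (proj1 (Ccont_eps f x) H _ Hd); apply filter_imp; intros y Hy.
  assert (Hy1 := Rlt_le_trans _ _ _ Hy (Rmin_l _ _)).
  assert (Hy2 := Rlt_le_trans _ _ _ Hy (Rmin_r _ _)).
  assert (Hm : m / 2 < Cmod (f y)).
  { generalize (Cmod_minus_ge (f x) (f y)); rewrite Cmod_minus_sym; unfold m in *; lra. }
  assert (f y <> RtoC 0) by (apply Cmod_gt_0; lra).
  assert (f x <> RtoC 0) by (apply Cmod_gt_0; unfold m in *; lra).
  replace (/ f y - / f x)%C with ((f x - f y) / (f y * f x))%C by (field; auto).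
  rewrite Cmod_div, Cmod_mult by (apply Cmult_neq_0; auto); fold m.
  rewrite Cmod_minus_sym; apply Rmult_lt_reg_r with (Cmod (f y) * m);
    [apply Rmult_lt_0_compat; lra|].
  unfold Rdiv at 1; rewrite Rmult_assoc, Rinv_l by (apply Rmult_integral_contrapositive; lra).
  rewrite Rmult_1_r; eapply Rlt_le_trans; [exact Hy2|].
  apply Rmult_le_compat_l; [lra|]; apply Rmult_le_compat_r; lra.
Qed.

Lemma Ccont_ext_loc (f g : R -> C) (x : R) : locally x (fun t => f t = g t) -> Ccont f x -> Ccont g x.
Proof. apply continuous_ext_loc. Qed.

Definition Cderiv (F : R -> C) (x : R) (l : C) : Prop :=
  is_derive (fun t => fst (F t)) x (fst l) /\ is_derive (fun t => snd (F t)) x (snd l).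

Lemma Cderiv_cont (F : R -> C) (x : R) (l : C) : Cderiv F x l -> Ccont F x.
Proof.
  intros [H1 H2]; apply Ccont_pair;
    apply (ex_derive_continuous (K := R_AbsRing) (V := R_NormedModule)); eexists; eassumption.
Qed.

Lemma Cderiv_ext (F : R -> C) (x : R) (l l' : C) : l = l' -> Cderiv F x l -> Cderiv F x l'.
Proof. intros ->; auto. Qed.

Lemma Cderiv_const (c : C) (x : R) : Cderiv (fun _ => c) x 0.
Proof. split; simpl; auto_derive; auto. Qed.

Lemma Cderiv_RtoC (f : R -> R) (x l : R) : is_derive f x l -> Cderiv (fun t => RtoC (f t)) x (RtoC l).
Proof. intro H; split; simpl; [exact H|auto_derive; auto]. Qed.

Lemma Cderiv_plus (F G : R -> C) (x : R) (l m : C) :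
  Cderiv F x l -> Cderiv G x m -> Cderiv (fun t => F t + G t)%C x (l + m)%C.
Proof.
  intros [H1 H2] [H3 H4]; split; simpl.
  - exact (is_derive_plus _ _ _ _ _ H1 H3).
  - exact (is_derive_plus _ _ _ _ _ H2 H4).
Qed.

Lemma Cderiv_minus (F G : R -> C) (x : R) (l m : C) :
  Cderiv F x l -> Cderiv G x m -> Cderiv (fun t => F t - G t)%C x (l - m)%C.
Proof.
  intros [H1 H2] [H3 H4]; split; simpl.
  - exact (is_derive_minus _ _ _ _ _ H1 H3).
  - exact (is_derive_minus _ _ _ _ _ H2 H4).
Qed.

Lemma Cderiv_mult (F G : R -> C) (x : R) (l m : C) :
  Cderiv F x l -> Cderiv G x m -> Cderiv (fun t => F t * G t)%C x (l * G x + F x * m)%C.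
Proof.
  intros [H1 H2] [H3 H4]; split; simpl.
  - generalize (is_derive_minus _ _ _ _ _ (is_derive_mult _ _ _ _ _ H1 H3 Rmult_comm) (is_derive_mult _ _ _ _ _ H2 H4 Rmult_comm)).
    intro H; evar_last; [exact H|]; unfold minus, plus, opp, mult; simpl; ring.
  - generalize (is_derive_plus _ _ _ _ _ (is_derive_mult _ _ _ _ _ H1 H4 Rmult_comm) (is_derive_mult _ _ _ _ _ H2 H3 Rmult_comm)).
    intro H; evar_last; [exact H|]; unfold minus, plus, opp, mult; simpl; ring.
Qed.

Lemma Cderiv_scal (c : C) (F : R -> C) (x : R) (l : C) :
  Cderiv F x l -> Cderiv (fun t => c * F t)%C x (c * l)%C.
Proof.
  intro H; eapply Cderiv_ext; [|apply Cderiv_mult; [apply Cderiv_const|exact H]]; cbv beta; ring.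
Qed.

Lemma Cderiv_Cexp (F : R -> C) (x : R) (l : C) :
  Cderiv F x l -> Cderiv (fun t => Cexp (F t)) x (l * Cexp (F x))%C.
Proof.
  intros [H1 H2].
  assert (E := is_derive_comp exp _ _ _ _ (is_derive_exp _) H1).
  assert (Ec := is_derive_comp cos _ _ _ _ (is_derive_cos _) H2).
  assert (Es := is_derive_comp sin _ _ _ _ (is_derive_sin _) H2).
  split; unfold Cexp; cbn -[Re Im]; unfold Re, Im.
  - evar_last; [exact (is_derive_mult _ _ _ _ _ E Ec Rmult_comm)|].
    unfold plus, mult, scal, opp; simpl; unfold mult; simpl; ring.
  - evar_last; [exact (is_derive_mult _ _ _ _ _ E Es Rmult_comm)|].
    unfold plus, mult, scal, opp; simpl; unfold mult; simpl; ring.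
Qed.

(* Project on the direction of F b - F a. *)
Lemma Cderiv_le (F f : R -> C) (g dg : R -> R) (a b : R) :
  a <= b -> (forall x, a <= x <= b -> Cderiv F x (f x)) ->
  (forall x, a <= x <= b -> is_derive g x (dg x)) ->
  (forall x, a <= x <= b -> Cmod (f x) <= dg x) ->
  Cmod (F b - F a) <= g b - g a.
Proof.
  intros Hab HF Hg Hfg; set (u := (F b - F a)%C).
  set (psi := fun t => Cmod u * g t - (fst u * fst (F t) + snd u * snd (F t))).
  set (dpsi := fun t => Cmod u * dg t - (fst u * fst (f t) + snd u * snd (f t))).
  assert (Hpsi : forall x, a <= x <= b -> is_derive psi x (dpsi x)).
  { intros x Hx; destruct (HF x Hx) as [H1 H2]; specialize (Hg x Hx).
    apply (is_derive_minus (K := R_AbsRing) (V := R_NormedModule) (fun t => Cmod u * g t)).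
    - apply (is_derive_scal g), Hg.
    - apply (is_derive_plus (K := R_AbsRing) (V := R_NormedModule) (fun t => fst u * fst (F t)));
        [apply (is_derive_scal (fun t => fst (F t))), H1|apply (is_derive_scal (fun t => snd (F t))), H2]. }
  assert (Hd : forall x, a <= x <= b -> 0 <= dpsi x).
  { intros x Hx; unfold dpsi.
    assert (fst u * fst (f x) + snd u * snd (f x) <= Cmod u * Cmod (f x)).
    { rewrite <- (Cmod_conj u), <- Cmod_mult.
      eapply Rle_trans; [|eapply Rle_trans; [apply Rle_abs|apply fst_Cmod_le]]; simpl; lra. }
    generalize (Rmult_le_compat_l _ _ _ (Cmod_ge_0 u) (Hfg x Hx)); lra. }
  assert (Hle : psi a <= psi b).
  { destruct (MVT_gen psi a b dpsi) as [c [Hc Ec]].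
    - rewrite Rmin_left, Rmax_right by lra; intros x Hx; apply Hpsi; lra.
    - rewrite Rmin_left, Rmax_right by lra; intros x Hx; apply continuity_pt_filterlim.
      apply (ex_derive_continuous (K := R_AbsRing) (V := R_NormedModule)); eexists; apply Hpsi, Hx.
    - rewrite Rmin_left, Rmax_right in Hc by lra.
      generalize (Rmult_le_pos _ _ (Hd c Hc) (proj1 (Rminus_le_0 a b) Hab)); lra. }
  assert (E : Cmod u ^ 2 = fst u * (fst (F b) - fst (F a)) + snd u * (snd (F b) - snd (F a))).
  { rewrite Cmod2_alt; unfold Re, Im, u; simpl; ring. }
  unfold psi in Hle.
  (* The projection argument divides by [Cmod u]; for [u = 0] it remains to see that [g]
     increases. *)
  destruct (Req_dec (Cmod u) 0) as [E0|E0].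
  - rewrite E0.
    destruct (MVT_gen g a b dg) as [c [Hc Ec]].
    + rewrite Rmin_left, Rmax_right by lra; intros x Hx; apply Hg; lra.
    + rewrite Rmin_left, Rmax_right by lra; intros x Hx; apply continuity_pt_filterlim.
      apply (ex_derive_continuous (K := R_AbsRing) (V := R_NormedModule)); eexists; apply Hg, Hx.
    + rewrite Rmin_left, Rmax_right in Hc by lra; rewrite Ec.
      apply Rmult_le_pos; [|lra]; eapply Rle_trans; [apply Cmod_ge_0|apply Hfg, Hc].
  - assert (0 < Cmod u) by (generalize (Cmod_ge_0 u); lra).
    apply Rmult_le_reg_l with (Cmod u); [assumption|].
    replace (Cmod u * Cmod u) with (Cmod u ^ 2) by ring; rewrite E; clearbody u; lra.
Qed.

Lemma Cderiv_le_const (F f : R -> C) (K a b : R) :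
  a <= b -> (forall x, a <= x <= b -> Cderiv F x (f x)) ->
  (forall x, a <= x <= b -> Cmod (f x) <= K) ->
  Cmod (F b - F a) <= K * (b - a).
Proof.
  intros Hab HF Hf; replace (K * (b - a)) with (K * b - K * a) by ring.
  apply (Cderiv_le F f (fun t => K * t) (fun _ => K)); auto.
  intros x _; evar_last; [apply (is_derive_scal (fun t => t)), is_derive_id|]; unfold one; simpl; ring.
Qed.

(** * Taylor polynomials of the complex exponential *)

Definition exp_poly (n : nat) (z : C) : C := Csum (fun m => (RtoC (/ INR (fact m)) * z ^ m)%C) n.

Lemma exp_poly_S (n : nat) (z : C) : exp_poly (S n) z = (exp_poly n z + RtoC (/ INR (fact n)) * z ^ n)%C.
Proof. reflexivity. Qed.

Lemma exp_poly_0 (n : nat) : exp_poly (S n) 0 = RtoC 1.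
Proof.
  induction n; rewrite exp_poly_S.
  - unfold exp_poly; simpl; rewrite Rinv_1; ring.
  - rewrite IHn, Cpow_S; ring.
Qed.

Lemma Cderiv_scal_l (w : C) (x : R) : Cderiv (fun x => RtoC x * w)%C x w.
Proof.
  eapply Cderiv_ext; [|apply Cderiv_mult; [apply Cderiv_RtoC, is_derive_id|apply Cderiv_const]].
  unfold one; simpl; ring.
Qed.

Lemma Cderiv_pow (w : C) (n : nat) (x : R) :
  Cderiv (fun x => ((RtoC x * w) ^ (S n))%C) x (RtoC (INR (S n)) * w * (RtoC x * w) ^ n)%C.
Proof.
  induction n.
  - apply Cderiv_ext with (w * 1 + RtoC x * w * 0)%C; [simpl; ring|].
    apply (Cderiv_mult (fun x => RtoC x * w)%C (fun _ => RtoC 1)); [apply Cderiv_scal_l|apply Cderiv_const].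
  - eapply Cderiv_ext; [|apply (Cderiv_mult (fun x => RtoC x * w)%C (fun x => (RtoC x * w) ^ (S n))%C); [apply Cderiv_scal_l|exact IHn]].
    rewrite (S_INR (S n)), RtoC_plus, !Cpow_S; ring.
Qed.

Lemma exp_poly_deriv (w : C) (n : nat) (x : R) :
  Cderiv (fun x => exp_poly (S n) (RtoC x * w)) x (w * exp_poly n (RtoC x * w))%C.
Proof.
  induction n.
  - apply Cderiv_ext with (RtoC 0); [unfold exp_poly; simpl; ring|].
    apply (Cderiv_const (0 + RtoC (/ INR 1) * 1)%C).
  - eapply Cderiv_ext; [|apply (Cderiv_plus (fun x => exp_poly (S n) (RtoC x * w)) (fun x => RtoC (/ INR (fact (S n))) * (RtoC x * w) ^ (S n))%C);
      [exact IHn|apply Cderiv_scal, Cderiv_pow]].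
    rewrite exp_poly_S, Cmult_plus_distr_l; f_equal.
    replace (RtoC (/ INR (fact n))) with (RtoC (/ INR (fact (S n))) * RtoC (INR (S n)))%C; [ring|].
    rewrite <- RtoC_mult; f_equal; rewrite fact_simpl, mult_INR; field.
    split; [apply INR_fact_neq_0|apply not_0_INR; lia].
Qed.

(** Induction on [N]: along the ray t w, the derivative of the remainder of order N + 1 is w times
    the remainder of order N, and the bound is integrated from 0. The fixed end [T] keeps exp(T |w|)
    constant during this integration. *)
Lemma Cexp_taylor_aux (w : C) (N : nat) (T t : R) : 0 <= t <= T ->
  Cmod (Cexp (RtoC t * w) - exp_poly N (RtoC t * w)) <= exp (T * Cmod w) * ((t * Cmod w) ^ N / INR (fact N)).
Proof.
  revert t; induction N as [|N IH]; intros t Ht.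
  - unfold exp_poly; simpl Csum; simpl INR; simpl pow; replace (Cexp _ - 0)%C with (Cexp (RtoC t * w)) by ring.
    replace (1 / 1) with 1 by field; rewrite Rmult_1_r.
    eapply Rle_trans; [apply Cmod_le_exp|]; apply exp_le_compat; rewrite Cmod_mult, Cmod_R, Rabs_pos_eq by lra.
    apply Rmult_le_compat_r; [apply Cmod_ge_0|lra].
  - set (P := fun N t => (Cexp (RtoC t * w) - exp_poly N (RtoC t * w))%C).
    assert (HP : forall x, Cderiv (P (S N)) x (w * P N x)%C).
    { intro x; apply Cderiv_ext with (w * Cexp (RtoC x * w) - w * exp_poly N (RtoC x * w))%C; [unfold P; ring|].
      apply (Cderiv_minus (fun x => Cexp (RtoC x * w)) (fun x => exp_poly (S N) (RtoC x * w))).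
      - apply Cderiv_Cexp, Cderiv_scal_l.
      - apply exp_poly_deriv. }
    assert (E0 : P (S N) 0 = RtoC 0).
    { unfold P; replace (RtoC 0 * w)%C with (RtoC 0) by ring; rewrite Cexp_0, exp_poly_0; ring. }
    set (g := fun t => exp (T * Cmod w) * ((t * Cmod w) ^ (S N) / INR (fact (S N)))).
    change (Cmod (P (S N) t) <= g t).
    replace (P (S N) t) with (P (S N) t - P (S N) 0)%C by (rewrite E0; ring).
    replace (g t) with (g t - g 0) by (unfold g; simpl; unfold Rdiv; ring).
    apply (Cderiv_le (P (S N)) (fun x => w * P N x)%C g (fun t => Cmod w * (exp (T * Cmod w) * ((t * Cmod w) ^ N / INR (fact N)))));
      [lra|auto| |].
    + intros x _; unfold g; auto_derive; [exact I|].
      change (pred (S N)) with N; change (fact N + N * fact N)%nat with (fact (S N)).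
      change (match N with O => 1 | S _ => INR N + 1 end) with (INR (S N)).
      rewrite fact_simpl, mult_INR; field.
      split; [apply INR_fact_neq_0|apply not_0_INR; lia].
    + intros x Hx; rewrite Cmod_mult; apply Rmult_le_compat_l; [apply Cmod_ge_0|].
      apply IH; lra.
Qed.

Lemma Cexp_taylor (w : C) (N : nat) :
  Cmod (Cexp w - exp_poly N w) <= exp (Cmod w) * (Cmod w ^ N / INR (fact N)).
Proof.
  generalize (Cexp_taylor_aux w N 1 1 ltac:(lra)).
  rewrite !Rmult_1_l, Cmult_1_l; auto.
Qed.

Lemma pow_fact_le_exp (x : R) (n : nat) : 0 <= x -> x ^ n / INR (fact n) <= exp x.
Proof.
  intro Hx; assert (H := is_exp_Reals x); apply is_pseries_R in H.
  assert (HP : forall k, 0 <= / INR (fact k) * x ^ k).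
  { intro k; apply Rmult_le_pos; [left; apply Rinv_0_lt_compat, INR_fact_lt_0|apply pow_le, Hx]. }
  assert (Hs : forall m, sum_n (fun k => / INR (fact k) * x ^ k) m = Rsum (fun k => / INR (fact k) * x ^ k) (S m)).
  { induction m; [rewrite sum_O; simpl; ring|]; rewrite sum_Sn, IHm; reflexivity. }
  assert (Hl : is_lim_seq (sum_n (fun k => / INR (fact k) * x ^ k)) (exp x)) by exact H.
  apply (is_lim_seq_le_loc (fun _ => x ^ n / INR (fact n)) (sum_n (fun k => / INR (fact k) * x ^ k)) (x ^ n / INR (fact n)) (exp x));
    [|apply is_lim_seq_const|exact Hl].
  exists n; intros m Hm; rewrite Hs.
  eapply Rle_trans; [|apply (Rsum_mono _ (S n)); [exact HP|lia]]; simpl.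
  generalize (Rsum_pos _ n HP); unfold Rdiv; lra.
Qed.

(** * Integrals of complex-valued functions *)

Definition CInt (f : R -> C) (a b : R) (l : C) : Prop := @is_RInt C_R_NormedModule f a b l.

Lemma norm_C_R (z : C) : @norm R_AbsRing C_R_NormedModule z = Cmod z.
Proof.
  change (sqrt (Rabs (fst z) ^ 2 + Rabs (snd z) ^ 2) = Cmod z); unfold Cmod.
  rewrite !pow2_abs; reflexivity.
Qed.

Lemma CInt_parts (f : R -> C) (a b : R) (l : C) :
  CInt f a b l <-> is_RInt (fun t => fst (f t)) a b (fst l) /\ is_RInt (fun t => snd (f t)) a b (snd l).
Proof.
  split.
  - intro H; split; [apply (is_RInt_fct_extend_fst f a b l H)|apply (is_RInt_fct_extend_snd f a b l H)].
  - intros [H1 H2]; rewrite (surjective_pairing l).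
    apply (is_RInt_fct_extend_pair (U := R_NormedModule) (V := R_NormedModule) f); assumption.
Qed.

Lemma CInt_ext (f g : R -> C) (a b : R) (l : C) :
  (forall x, Rmin a b < x < Rmax a b -> f x = g x) -> CInt f a b l -> CInt g a b l.
Proof. apply is_RInt_ext. Qed.

Lemma CInt_unique (f : R -> C) (a b : R) (l l' : C) : CInt f a b l -> CInt f a b l' -> l = l'.
Proof.
  rewrite !CInt_parts; intros [H1 H2] [H3 H4]; apply injective_projections.
  - rewrite <- (is_RInt_unique _ _ _ _ H1); apply is_RInt_unique, H3.
  - rewrite <- (is_RInt_unique _ _ _ _ H2); apply is_RInt_unique, H4.
Qed.

Lemma CInt_plus (f g : R -> C) (a b : R) (l m : C) :
  CInt f a b l -> CInt g a b m -> CInt (fun t => f t + g t)%C a b (l + m)%C.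
Proof. intros; apply (is_RInt_plus (V := C_R_NormedModule)); assumption. Qed.

Lemma CInt_scal (c : C) (f : R -> C) (a b : R) (l : C) :
  CInt f a b l -> CInt (fun t => c * f t)%C a b (c * l)%C.
Proof.
  rewrite !CInt_parts; intros [H1 H2]; split; simpl.
  - apply (is_RInt_minus (V := R_NormedModule) (fun t => fst c * fst (f t)) (fun t => snd c * snd (f t)));
      apply (is_RInt_scal (V := R_NormedModule)); assumption.
  - apply (is_RInt_plus (V := R_NormedModule) (fun t => fst c * snd (f t)) (fun t => snd c * fst (f t)));
      apply (is_RInt_scal (V := R_NormedModule)); assumption.
Qed.

Lemma CInt_minus (f g : R -> C) (a b : R) (l m : C) :
  CInt f a b l -> CInt g a b m -> CInt (fun t => f t - g t)%C a b (l - m)%C.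
Proof. intros; apply (is_RInt_minus (V := C_R_NormedModule)); assumption. Qed.

Lemma CInt_const (c : C) (a b : R) : CInt (fun _ => c) a b (RtoC (b - a) * c)%C.
Proof.
  apply CInt_parts; split; simpl.
  - evar_last; [apply (is_RInt_const (V := R_NormedModule))|]; unfold scal; simpl; unfold mult; simpl; ring.
  - evar_last; [apply (is_RInt_const (V := R_NormedModule))|]; unfold scal; simpl; unfold mult; simpl; ring.
Qed.

Lemma CInt_zero (a b : R) : CInt (fun _ => RtoC 0) a b 0.
Proof. generalize (CInt_const 0 a b); rewrite Cmult_0_r; auto. Qed.

Lemma CInt_Csum (f : nat -> R -> C) (a b : R) (l : nat -> C) (n : nat) :
  (forall k, CInt (f k) a b (l k)) -> CInt (fun t => Csum (fun k => f k t) n) a b (Csum l n).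
Proof.
  intro H; induction n; simpl.
  - apply CInt_zero.
  - apply CInt_plus; auto.
Qed.

Lemma CInt_Chasles (f : R -> C) (a b c : R) (l m : C) :
  CInt f a b l -> CInt f b c m -> CInt f a c (l + m)%C.
Proof. apply (is_RInt_Chasles (V := C_R_NormedModule)). Qed.

Lemma CInt_swap (f : R -> C) (a b : R) (l : C) : CInt f b a l -> CInt f a b (- l)%C.
Proof. apply (is_RInt_swap (V := C_R_NormedModule)). Qed.

Lemma ex_CInt (f : R -> C) (a b : R) :
  (forall x, Rmin a b <= x <= Rmax a b -> Ccont f x) -> exists l, CInt f a b l.
Proof. intro H; apply (ex_RInt_continuous (V := C_R_CompleteNormedModule) f), H. Qed.

Lemma CInt_norm_le (f : R -> C) (g : R -> R) (a b : R) (l : C) (m : R) :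
  a <= b -> (forall x, a <= x <= b -> Cmod (f x) <= g x) ->
  CInt f a b l -> is_RInt g a b m -> Cmod l <= m.
Proof.
  intros Hab Hfg Hf Hg; rewrite <- norm_C_R.
  apply (norm_RInt_le (V := C_R_NormedModule) f g a b); auto.
  intros; rewrite norm_C_R; auto.
Qed.

Lemma CInt_norm_const (f : R -> C) (K a b : R) (l : C) :
  a <= b -> (forall x, a <= x <= b -> Cmod (f x) <= K) -> CInt f a b l -> Cmod l <= K * (b - a).
Proof.
  intros Hab H Hl; apply (CInt_norm_le f (fun _ => K) a b); auto.
  evar_last; [apply (is_RInt_const (V := R_NormedModule))|]; unfold scal; simpl; unfold mult; simpl; ring.
Qed.

Lemma CInt_Cderiv (F f : R -> C) (a b : R) :
  (forall x, Rmin a b <= x <= Rmax a b -> Cderiv F x (f x)) ->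
  (forall x, Rmin a b <= x <= Rmax a b -> Ccont f x) ->
  CInt f a b (F b - F a)%C.
Proof.
  intros HF Hf; apply CInt_parts; split.
  - apply (is_RInt_derive (V := R_CompleteNormedModule) (fun t => fst (F t))); intros x Hx.
    + apply HF, Hx.
    + apply Ccont_fst, Hf, Hx.
  - apply (is_RInt_derive (V := R_CompleteNormedModule) (fun t => snd (F t))); intros x Hx.
    + apply HF, Hx.
    + apply Ccont_snd, Hf, Hx.
Qed.

Lemma CInt_comp_lin (f : R -> C) (u v a b : R) (l : C) :
  CInt f (u * a + v) (u * b + v) l -> CInt (fun y => RtoC u * f (u * y + v)%R)%C a b l.
Proof.
  rewrite !CInt_parts; intros [H1 H2].
  apply (is_RInt_comp_lin (V := R_NormedModule)) in H1; apply (is_RInt_comp_lin (V := R_NormedModule)) in H2.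
  split; simpl.
  - eapply is_RInt_ext; [|exact H1]; intros; unfold scal; simpl; unfold mult; simpl; ring.
  - eapply is_RInt_ext; [|exact H2]; intros; unfold scal; simpl; unfold mult; simpl; ring.
Qed.

Lemma CInt_shift (f : R -> C) (v a b : R) (l : C) :
  CInt f (a + v) (b + v) l -> CInt (fun y => f (y + v)) a b l.
Proof.
  intro H; apply CInt_ext with (fun y => RtoC 1 * f (1 * y + v)%R)%C.
  - intros; rewrite Rmult_1_l; ring.
  - apply CInt_comp_lin; rewrite !Rmult_1_l; exact H.
Qed.

(** * The exponentials exp(2 pi i n x) *)

Lemma Fourier_exp_eq (n : Z) (x : R) :
  Fourier_exp n x = (cos (2 * PI * IZR n * x), sin (2 * PI * IZR n * x)).
Proof.
  unfold Fourier_exp, Cexp, Ci, RtoC; cbn -[PI IZR cos sin exp].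
  replace (2 * PI * IZR n * x * 0 - 0 * 1) with 0 by ring.
  replace (2 * PI * IZR n * x * 1 + 0 * 0) with (2 * PI * IZR n * x) by ring.
  rewrite exp_0, !Rmult_1_l; reflexivity.
Qed.

Lemma Fourier_exp_plus (n m : Z) (x : R) :
  Fourier_exp (n + m) x = (Fourier_exp n x * Fourier_exp m x)%C.
Proof. unfold Fourier_exp; rewrite <- Cexp_plus, plus_IZR; f_equal; rewrite <- Cmult_plus_distr_r, <- RtoC_plus; f_equal; f_equal; ring. Qed.

Lemma Fourier_exp_add (n : Z) (x y : R) :
  Fourier_exp n (x + y) = (Fourier_exp n x * Fourier_exp n y)%C.
Proof. unfold Fourier_exp; rewrite <- Cexp_plus; f_equal; rewrite <- Cmult_plus_distr_r, <- RtoC_plus; f_equal; f_equal; ring. Qed.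

Lemma Fourier_exp_0 (x : R) : Fourier_exp 0 x = RtoC 1.
Proof. unfold Fourier_exp; rewrite <- Cexp_0; f_equal; rewrite Rmult_0_r, Rmult_0_l; ring. Qed.

Lemma Fourier_exp_at_0 (n : Z) : Fourier_exp n 0 = RtoC 1.
Proof. unfold Fourier_exp; rewrite <- Cexp_0; f_equal; rewrite Rmult_0_r; ring. Qed.

Lemma Cmod_Fourier_exp (n : Z) (x : R) : Cmod (Fourier_exp n x) = 1.
Proof. unfold Fourier_exp; rewrite Cmod_Cexp, re_mult_Ci; simpl; rewrite Ropp_0; apply exp_0. Qed.

Lemma Fourier_exp_nat_1 (n : nat) : Fourier_exp (Z.of_nat n) 1 = RtoC 1.
Proof.
  rewrite Fourier_exp_eq, <- INR_IZR_INZ.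
  replace (2 * PI * INR n * 1) with (0 + 2 * INR n * PI) by ring.
  rewrite cos_period, sin_period, cos_0, sin_0; reflexivity.
Qed.

Lemma Fourier_exp_at_1 (n : Z) : Fourier_exp n 1 = RtoC 1.
Proof.
  destruct (Z_le_gt_dec 0 n) as [h|h].
  - rewrite <- (Z2Nat.id n h); apply Fourier_exp_nat_1.
  - assert (E : (Fourier_exp n 1 * Fourier_exp (- n) 1)%C = RtoC 1).
    { rewrite <- Fourier_exp_plus, Z.add_opp_diag_r; apply Fourier_exp_0. }
    rewrite <- (Z2Nat.id (- n)) in E by lia; rewrite Fourier_exp_nat_1, Cmult_1_r in E; exact E.
Qed.

Lemma Fourier_exp_deriv (n : Z) (x : R) : Cderiv (Fourier_exp n) x (two_pi_i n * Fourier_exp n x)%C.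
Proof.
  unfold Fourier_exp; apply (Cderiv_Cexp (fun x => RtoC (2 * PI * IZR n * x) * Ci)%C).
  unfold two_pi_i; eapply Cderiv_ext; [|apply Cderiv_mult; [apply Cderiv_RtoC|apply Cderiv_const]].
  2:{ apply (is_derive_scal (fun t => t)), is_derive_id. }
  unfold one; simpl; rewrite Rmult_1_r; ring.
Qed.

Lemma Fourier_exp_cont (n : Z) (x : R) : Ccont (Fourier_exp n) x.
Proof. eapply Cderiv_cont, Fourier_exp_deriv. Qed.

Lemma two_pi_i_nz (n : Z) : n <> 0%Z -> two_pi_i n <> RtoC 0.
Proof.
  intro Hn; unfold two_pi_i; apply Cmult_neq_0; [|apply Ci_nz].
  intro H; apply RtoC_inj in H; apply Rmult_integral in H; destruct H as [H|H].
  - generalize PI_RGT_0; lra.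
  - apply Hn, eq_IZR, H.
Qed.

Lemma Fourier_exp_int (n : Z) : CInt (Fourier_exp n) 0 1 (if Z.eq_dec n 0 then RtoC 1 else RtoC 0).
Proof.
  destruct (Z.eq_dec n 0) as [->|Hn].
  - apply CInt_ext with (fun _ => RtoC 1); [intros; symmetry; apply Fourier_exp_0|].
    generalize (CInt_const 1 0 1); rewrite Rminus_0_r, Cmult_1_r; auto.
  - replace (RtoC 0) with (/ two_pi_i n * Fourier_exp n 1 - / two_pi_i n * Fourier_exp n 0)%C
      by (rewrite Fourier_exp_at_1, Fourier_exp_at_0; ring).
    apply (CInt_Cderiv (fun x => / two_pi_i n * Fourier_exp n x)%C).
    + intros x _; eapply Cderiv_ext; [|apply Cderiv_scal, Fourier_exp_deriv].
      field; apply two_pi_i_nz, Hn.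
    + intros; apply Fourier_exp_cont.
Qed.

Lemma Fourier_exp_lip (n : Z) (x : R) : Cmod (Fourier_exp n x - 1) <= 2 * PI * (Rabs (IZR n) * Rabs x).
Proof.
  assert (Hp := PI_RGT_0).
  assert (H : forall n x, 0 <= x -> Cmod (Fourier_exp n x - 1) <= 2 * PI * (Rabs (IZR n) * x)).
  { clear n x; intros n x Hx; rewrite <- (Fourier_exp_at_0 n).
    replace (2 * PI * (Rabs (IZR n) * x)) with ((2 * PI * Rabs (IZR n)) * (x - 0)) by ring.
    apply (Cderiv_le_const _ (fun x => two_pi_i n * Fourier_exp n x)%C); [exact Hx| |].
    - intros; apply Fourier_exp_deriv.
    - intros y _; rewrite Cmod_mult, Cmod_Fourier_exp, Rmult_1_r; unfold two_pi_i.
      rewrite Cmod_mult, Cmod_Ci, Cmod_R, Rabs_mult, Rmult_1_r, (Rabs_pos_eq (2 * PI)) by lra; lra. }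
  destruct (Rle_lt_dec 0 x) as [h|h]; [rewrite (Rabs_pos_eq x) by lra; apply H, h|].
  replace (Fourier_exp n x) with (Fourier_exp (- n) (- x)).
  - rewrite (Rabs_left x) by lra; rewrite <- (Rabs_Ropp (IZR n)), <- opp_IZR; apply H; lra.
  - unfold Fourier_exp; do 3 f_equal; rewrite opp_IZR; ring.
Qed.

(** * Improper integrals along filters *)

Definition CIntg (f : R -> C) (Fa Fb : (R -> Prop) -> Prop) (l : C) : Prop :=
  @is_RInt_gen C_R_NormedModule f Fa Fb l.

(** The common side condition for improper integrals: pointwise hypotheses on the integrand are then
    required on [D] only, for instance away from a singular endpoint. *)
Definition spans (Fa Fb : (R -> Prop) -> Prop) (D : R -> Prop) : Prop :=
  filter_prod Fa Fb (fun ab => fst ab <= snd ab /\ forall x, fst ab <= x <= snd ab -> D x).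

Lemma spans_open (a b : R) (D : R -> Prop) :
  a < b -> (forall x, a < x < b -> D x) -> spans (at_right a) (at_left b) D.
Proof.
  intros Hab HD; exists (fun x => a < x < (a + b) / 2) (fun x => (a + b) / 2 < x < b).
  - assert (h : 0 < (b - a) / 2) by lra; exists (mkposreal _ h); intros y Hy Hy'.
    unfold ball in Hy; simpl in Hy; unfold AbsRing_ball, abs, minus, plus, opp in Hy; simpl in Hy.
    apply Rabs_lt_between in Hy; lra.
  - assert (h : 0 < (b - a) / 2) by lra; exists (mkposreal _ h); intros y Hy Hy'.
    unfold ball in Hy; simpl in Hy; unfold AbsRing_ball, abs, minus, plus, opp in Hy; simpl in Hy.
    apply Rabs_lt_between in Hy; lra.
  - simpl; intros x y Hx Hy; split; [lra|]; intros; apply HD; lra.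
Qed.

Lemma spans_point_r (a b : R) (D : R -> Prop) :
  a < b -> (forall x, a < x <= b -> D x) -> spans (at_right a) (at_point b) D.
Proof.
  intros Hab HD; exists (fun x => a < x < b) (fun x => x = b).
  - assert (h : 0 < b - a) by lra; exists (mkposreal _ h); intros y Hy Hy'.
    unfold ball in Hy; simpl in Hy; unfold AbsRing_ball, abs, minus, plus, opp in Hy; simpl in Hy.
    apply Rabs_lt_between in Hy; lra.
  - reflexivity.
  - simpl; intros x y Hx ->; split; [lra|]; intros; apply HD; lra.
Qed.

Lemma spans_infty (a : R) (D : R -> Prop) :
  (forall x, a < x -> D x) -> spans (at_right a) (Rbar_locally p_infty) D.
Proof.
  intros HD; exists (fun x => a < x < a + 1) (fun x => a + 1 < x).
  - exists (mkposreal _ Rlt_0_1); intros y Hy Hy'.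
    unfold ball in Hy; simpl in Hy; unfold AbsRing_ball, abs, minus, plus, opp in Hy; simpl in Hy.
    apply Rabs_lt_between in Hy; lra.
  - exists (a + 1); auto.
  - simpl; intros x y Hx Hy; split; [lra|]; intros; apply HD; lra.
Qed.

Section Improper.

Context {Fa Fb : (R -> Prop) -> Prop} {FFa : ProperFilter Fa} {FFb : ProperFilter Fb}.

Lemma CIntg_unique (f : R -> C) (l l' : C) : CIntg f Fa Fb l -> CIntg f Fa Fb l' -> l = l'.
Proof.
  intros H H'.
  assert (PFa : ProperFilter' Fa) by apply Proper_StrongProper, FFa.
  assert (PFb : ProperFilter' Fb) by apply Proper_StrongProper, FFb.
  rewrite <- (is_RInt_gen_unique (V := C_R_CompleteNormedModule) f l H).
  apply (is_RInt_gen_unique (V := C_R_CompleteNormedModule) f l' H').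
Qed.

Lemma CIntg_ext (f g : R -> C) (D : R -> Prop) (l : C) :
  spans Fa Fb D -> (forall x, D x -> f x = g x) -> CIntg f Fa Fb l -> CIntg g Fa Fb l.
Proof.
  intros HD E; apply is_RInt_gen_ext; try typeclasses eauto.
  revert HD; unfold spans; apply filter_imp; intros [a b]; simpl; intros [Hab H] x Hx.
  rewrite Rmin_left, Rmax_right in Hx by lra; apply E, H; lra.
Qed.

Lemma CIntg_plus (f g : R -> C) (l m : C) :
  CIntg f Fa Fb l -> CIntg g Fa Fb m -> CIntg (fun t => f t + g t)%C Fa Fb (l + m)%C.
Proof. intros H H'; exact (is_RInt_gen_plus f g l m H H'). Qed.

Lemma CIntg_minus (f g : R -> C) (l m : C) :
  CIntg f Fa Fb l -> CIntg g Fa Fb m -> CIntg (fun t => f t - g t)%C Fa Fb (l - m)%C.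
Proof. intros H H'; exact (is_RInt_gen_minus f g l m H H'). Qed.

Lemma CIntg_scal (c : C) (f : R -> C) (l : C) :
  CIntg f Fa Fb l -> CIntg (fun t => c * f t)%C Fa Fb (c * l)%C.
Proof.
  intros H P HP.
  assert (HP' : @locally C_UniformSpace l (fun y => P (c * y)%C)).
  { assert (HL : filterlim (fun y => c * y)%C (@locally C_UniformSpace l) (@locally C_UniformSpace (c * l)%C)).
    { apply (filterlim_Cmod _ (fun y => c * y)%C); intros e He.
      assert (Hc := Cmod_ge_0 c).
      assert (Hd : 0 < e / (2 * (Cmod c + 1))) by (apply Rdiv_lt_0_compat; lra).
      exists (mkposreal _ Hd); intros y Hy; apply Cmod_ball_C in Hy; simpl in Hy.
      replace (c * y - c * l)%C with (c * (y - l))%C by ring; rewrite Cmod_mult.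
      apply Rle_lt_trans with ((Cmod c + 1) * Cmod (y - l)).
      - apply Rmult_le_compat_r; [apply Cmod_ge_0|lra].
      - apply (Rmult_lt_compat_l (Cmod c + 1)) in Hy; [|lra].
        replace ((Cmod c + 1) * (2 * (e / (2 * (Cmod c + 1))))) with e in Hy by (field; lra); exact Hy. }
    apply HL, HP. }
  generalize (H _ HP'); unfold filtermapi; apply filter_imp; intros [a b] [y [Hy HPy]].
  exists (c * y)%C; split; [apply CInt_scal, Hy|exact HPy].
Qed.

Lemma CIntg_zero : CIntg (fun _ => RtoC 0) Fa Fb 0.
Proof.
  intros P HP; unfold filtermapi; apply filter_forall; intros [a b]; exists (RtoC 0); split; [|apply locally_singleton in HP; exact HP].
  apply CInt_zero.
Qed.

Lemma CIntg_Csum (f : nat -> R -> C) (l : nat -> C) (n : nat) :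
  (forall k, (k < n)%nat -> CIntg (f k) Fa Fb (l k)) ->
  CIntg (fun t => Csum (fun k => f k t) n) Fa Fb (Csum l n).
Proof.
  intro H; induction n; simpl; [apply CIntg_zero|apply CIntg_plus; auto].
Qed.

Lemma CIntg_norm_le (f : R -> C) (g : R -> R) (D : R -> Prop) (l : C) (m : R) :
  spans Fa Fb D -> (forall x, D x -> Cmod (f x) <= g x) ->
  CIntg f Fa Fb l -> is_RInt_gen g Fa Fb m -> Cmod l <= m.
Proof.
  intros HD Hfg Hf Hg; rewrite <- norm_C_R.
  refine (RInt_gen_norm (V := C_R_CompleteNormedModule) f g l m _ _ Hf Hg).
  - revert HD; unfold spans; apply filter_imp; intros [a b] [H _]; exact H.
  - revert HD; unfold spans; apply filter_imp; intros [a b] [_ H] x Hx.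
    change (@norm R_AbsRing C_R_NormedModule (f x) <= g x); rewrite norm_C_R; apply Hfg, H, Hx.
Qed.

(** Cauchy's criterion for the truncated integrals: two pairs of endpoints are compared by moving
    one endpoint at a time. *)
Lemma CIntg_dominated (f : R -> C) (g : R -> R) (D : R -> Prop) (m : R) :
  spans Fa Fb D -> (forall x, D x -> Ccont f x) -> (forall x, D x -> Cmod (f x) <= g x) ->
  is_RInt_gen g Fa Fb m -> exists l, CIntg f Fa Fb l /\ Cmod l <= m.
Proof.
  intros HD Hc Hfg Hg.
  set (I := fun ab : R * R => @RInt C_R_CompleteNormedModule f (fst ab) (snd ab)).
  assert (HI : forall a b, a <= b -> (forall x, a <= x <= b -> D x) -> CInt f a b (I (a, b))).
  { intros a b Hab H; apply (RInt_correct (V := C_R_CompleteNormedModule)).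
    apply (ex_RInt_continuous (V := C_R_CompleteNormedModule)); intros x Hx.
    rewrite Rmin_left, Rmax_right in Hx by lra; apply Hc, H, Hx. }
  assert (HL : exists l, filterlim I (filter_prod Fa Fb) (@locally C_R_CompleteNormedModule l)).
  { apply (filterlim_locally_cauchy (U := C_R_CompleteNormedModule)); intros eps.
    assert (Hg' := Hg (fun y => Rabs (y - m) < eps / 8)).
    assert (He : 0 < eps / 8) by (generalize (cond_pos eps); lra).
    assert (HB : locally m (fun y => Rabs (y - m) < eps / 8)) by (exists (mkposreal _ He); auto).
    specialize (Hg' HB); unfold filtermapi in Hg'.
    destruct (filter_and (F := filter_prod Fa Fb) _ _ HD Hg') as [Qa Qb HQa HQb HQ]; cbn [fst snd] in HQ.
    (* Moving an endpoint changes the integral of [f] by at most the change of the integral of [g],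
       and the two integrals of [g] are both within eps/8 of [m]. *)
    assert (key : forall a a' b, Qa a -> Qa a' -> Qb b -> a <= a' -> forall l, CInt f a a' l -> Cmod l <= eps / 4).
    { intros a a' b Ha Ha' Hb Haa l Hl.
      destruct (HQ a b Ha Hb) as [[H1 H2] [y [Hy Hym]]].
      destruct (HQ a' b Ha' Hb) as [[H1' H2'] [y' [Hy' Hym']]].
      apply Rle_trans with (y - y').
      - apply (CInt_norm_le f g a a'); auto; [intros; apply Hfg, H2; lra|].
        evar_last; [apply (is_RInt_Chasles (V := R_NormedModule) g a b a'); [exact Hy|apply (is_RInt_swap (V := R_NormedModule)), Hy']|].
        reflexivity.
      - apply Rabs_lt_between in Hym; apply Rabs_lt_between in Hym'; lra. }
    assert (key' : forall a b b', Qa a -> Qb b -> Qb b' -> b <= b' -> forall l, CInt f b b' l -> Cmod l <= eps / 4).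
    { intros a b b' Ha Hb Hb' Hbb l Hl.
      destruct (HQ a b Ha Hb) as [[H1 H2] [y [Hy Hym]]].
      destruct (HQ a b' Ha Hb') as [[H1' H2'] [y' [Hy' Hym']]].
      apply Rle_trans with (y' - y).
      - apply (CInt_norm_le f g b b'); auto; [intros; apply Hfg, H2'; lra|].
        evar_last; [apply (is_RInt_Chasles (V := R_NormedModule) g b a b'); [apply (is_RInt_swap (V := R_NormedModule)), Hy|exact Hy']|].
        unfold plus, opp; simpl; ring.
      - apply Rabs_lt_between in Hym; apply Rabs_lt_between in Hym'; lra. }
    exists (fun ab => Qa (fst ab) /\ Qb (snd ab)); split.
    { exists Qa Qb; auto. }
    assert (HA : forall a a' b, Qa a -> Qa a' -> Qb b -> Cmod (I (a, b) - I (a', b)) <= eps / 4).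
    { intros a a' b Ha Ha' Hb.
      destruct (HQ a b Ha Hb) as [[H1 H2] _]; destruct (HQ a' b Ha' Hb) as [[H1' H2'] _].
      assert (HJ : CInt f a a' (I (a, b) - I (a', b))%C).
      { apply (CInt_Chasles f a b a'); [apply HI|apply CInt_swap, HI]; auto. }
      destruct (Rle_lt_dec a a') as [h|h].
      - apply (key a a' b); auto.
      - rewrite Cmod_minus_sym; apply (key a' a b); auto; try lra.
        replace (I (a', b) - I (a, b))%C with (- (I (a, b) - I (a', b)))%C by ring; apply CInt_swap, HJ. }
    assert (HB' : forall a b b', Qa a -> Qb b -> Qb b' -> Cmod (I (a, b) - I (a, b')) <= eps / 4).
    { intros a b b' Ha Hb Hb'.
      destruct (HQ a b Ha Hb) as [[H1 H2] _]; destruct (HQ a b' Ha Hb') as [[H1' H2'] _].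
      assert (HJ : CInt f b b' (I (a, b') - I (a, b))%C).
      { replace (I (a, b') - I (a, b))%C with (- I (a, b) + I (a, b'))%C by ring.
        apply (CInt_Chasles f b a b'); [apply CInt_swap, HI|apply HI]; auto. }
      destruct (Rle_lt_dec b b') as [h|h].
      - rewrite Cmod_minus_sym; apply (key' a b b'); auto.
      - apply (key' a b' b); auto; try lra.
        replace (I (a, b) - I (a, b'))%C with (- (I (a, b') - I (a, b)))%C by ring; apply CInt_swap, HJ. }
    intros [a b] [a' b'] [Ha Hb] [Ha' Hb']; simpl in Ha, Hb, Ha', Hb'.
    apply ball_C_Cmod; generalize (HA a' a b' Ha' Ha Hb') (HB' a b' b Ha Hb' Hb)
      (Cmod_triangle3 (I (a', b')) (I (a, b')) (I (a, b))) (cond_pos eps); lra. }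
  destruct HL as [l Hl].
  assert (Hfl : CIntg f Fa Fb l).
  { intros P HP; specialize (Hl P HP); unfold filtermap in Hl; unfold filtermapi.
    generalize (filter_and (F := filter_prod Fa Fb) _ _ HD Hl); apply filter_imp; intros [a b] [[Hab H] HPI].
    exists (I (a, b)); split; [apply HI; assumption|exact HPI]. }
  exists l; split; [exact Hfl|]; apply (CIntg_norm_le f g D l m); assumption.
Qed.

End Improper.

Lemma is_RInt_gen_primitive (Fa Fb : (R -> Prop) -> Prop) {FFa : Filter Fa} {FFb : Filter Fb}
  (g G : R -> R) (D : R -> Prop) (la lb : R) :
  spans Fa Fb D -> (forall x, D x -> is_derive G x (g x)) -> (forall x, D x -> continuous g x) ->
  filterlim G Fa (locally la) -> filterlim G Fb (locally lb) -> is_RInt_gen g Fa Fb (lb - la).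
Proof.
  intros HD HG Hg Ha Hb P HP.
  assert (HL : filterlim (fun ab => G (snd ab) - G (fst ab)) (filter_prod Fa Fb) (locally (lb - la))).
  { apply (filterlim_comp_2 (H := locally la)  (G := locally lb) (fun ab => G (snd ab)) (fun ab => G (fst ab)) Rminus).
    - apply (filterlim_comp _ _ _ snd G _ Fb); [apply filterlim_snd|exact Hb].
    - apply (filterlim_comp _ _ _ fst G _ Fa); [apply filterlim_fst|exact Ha].
    - apply (filterlim_comp_2 (G := locally lb) (H := locally (- la)) fst (fun x => - snd x) Rplus).
      + apply filterlim_fst.
      + apply (filterlim_comp _ _ _ snd Ropp _ (locally la)); [apply filterlim_snd|apply (filterlim_opp (V := R_NormedModule))].
      + apply (filterlim_plus (V := R_NormedModule)). }
  generalize (filter_and (F := filter_prod Fa Fb) _ _ HD (HL P HP)); unfold filtermapi; apply filter_imp; intros [a b] [[Hab H] HPG].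
  exists (G b - G a); split; [|exact HPG]; simpl in *.
  apply (is_RInt_derive (V := R_CompleteNormedModule) G); intros x Hx;
    rewrite Rmin_left, Rmax_right in Hx by lra; auto.
Qed.

(** * Power series and the identity theorem *)

Lemma Rsum_geometric (q : R) (n : nat) : (1 - q) * Rsum (fun m => q ^ m) n = 1 - q ^ n.
Proof. induction n; simpl; [ring|]; rewrite Rmult_plus_distr_l, IHn; ring. Qed.

(** Multiplication by [1 - q] lowers the degree of the polynomial factor by one, which reduces the
    series met when differentiating power series to the geometric one. *)
Lemma Rsum_geometric_1 (q : R) (n : nat) :
  (1 - q) * Rsum (fun m => INR (S m) * q ^ m) n = Rsum (fun m => q ^ m) n - INR n * q ^ n.
Proof.
  induction n; [simpl; ring|]; cbn [Rsum]; rewrite Rmult_plus_distr_l, IHn, S_INR; simpl pow; ring.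
Qed.

Lemma Rsum_geometric_2 (q : R) (n : nat) :
  (1 - q) * Rsum (fun m => INR (S m) * INR (S (S m)) * q ^ m) n
  = 2 * Rsum (fun m => INR (S m) * q ^ m) n - INR n * INR (S n) * q ^ n.
Proof.
  induction n; [simpl; ring|]; cbn [Rsum]; rewrite Rmult_plus_distr_l, IHn, !S_INR; simpl pow; ring.
Qed.

Lemma geometric_1_sum (q : R) : 0 <= q < 1 -> exists l, is_sum (fun m => INR (S m) * q ^ m) l.
Proof.
  intro Hq; assert (Hp : forall n, 0 <= q ^ n) by (intro; apply pow_le; lra).
  apply is_sum_bounded with (/ (1 - q) * / (1 - q)).
  - intro n; apply Rmult_le_pos; [apply pos_INR|apply Hp].
  - intro n; apply Rmult_le_reg_l with (1 - q); [lra|]; rewrite Rsum_geometric_1.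
    rewrite <- Rmult_assoc, Rinv_r, Rmult_1_l by lra.
    generalize (proj1 (proj2 (geometric_sum q Hq)) n) (Rmult_le_pos _ _ (pos_INR n) (Hp n)); lra.
Qed.

Lemma geometric_2_sum (q : R) : 0 <= q < 1 -> exists l, is_sum (fun m => INR (S m) * INR (S (S m)) * q ^ m) l.
Proof.
  intro Hq; assert (Hp : forall n, 0 <= q ^ n) by (intro; apply pow_le; lra).
  destruct (geometric_1_sum q Hq) as [l Hl].
  apply is_sum_bounded with (2 * l * / (1 - q)).
  - intro n; repeat apply Rmult_le_pos; auto using pos_INR.
  - intro n; apply Rmult_le_reg_l with (1 - q); [lra|]; rewrite Rsum_geometric_2.
    replace ((1 - q) * (2 * l * / (1 - q))) with (2 * l) by (field; lra).
    generalize (proj1 (proj2 Hl) n) (Rmult_le_pos _ _ (Rmult_le_pos _ _ (pos_INR n) (pos_INR (S n))) (Hp n)); lra.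
Qed.

(** Radius and coefficients are explicit, unlike in [analytic_at]: sums of infinitely many functions
    require one disc common to all of them. *)
Definition PSon (f : C -> C) (z0 : C) (r : R) (a : nat -> C) : Prop :=
  0 < r /\ forall z, Cmod (z - z0) < r -> PS a (z - z0) (f z).

Lemma analytic_at_PSon (f : C -> C) (z0 : C) : analytic_at f z0 <-> exists r a, PSon f z0 r a.
Proof.
  split.
  - intros (a & r & Hr & H); exists r, a; split; [exact Hr|]; intros; apply is_pseries_PS; auto.
  - intros (r & a & Hr & H); exists a, r; split; [exact Hr|]; intros; apply is_pseries_PS; auto.
Qed.

Lemma PSon_ext (f g : C -> C) (z0 : C) (r : R) (a : nat -> C) :
  (forall z, Cmod (z - z0) < r -> f z = g z) -> PSon f z0 r a -> PSon g z0 r a.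
Proof. intros E [Hr H]; split; [exact Hr|]; intros z Hz; rewrite <- E by exact Hz; auto. Qed.

Lemma PSon_le (f : C -> C) (z0 : C) (r r' : R) (a : nat -> C) :
  0 < r' <= r -> PSon f z0 r a -> PSon f z0 r' a.
Proof. intros Hr' [Hr H]; split; [lra|]; intros; apply H; lra. Qed.

(** The series converges at the point z0 + rho, so its terms there are bounded. *)
Lemma PSon_coef_bound (f : C -> C) (z0 : C) (r rho : R) (a : nat -> C) :
  PSon f z0 r a -> 0 < rho < r -> exists M, 0 <= M /\ forall m, Cmod (a m) * rho ^ m <= M.
Proof.
  intros [Hr H] Hrho.
  assert (E : (z0 + rho - z0)%C = RtoC rho) by ring.
  specialize (H (z0 + rho)%C); rewrite E, Cmod_R, Rabs_pos_eq in H by lra.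
  destruct (Clim_bounded _ _ (Clim_terms _ _ (H ltac:(lra)))) as [M HM].
  assert (HM' : forall m, Cmod (a m) * rho ^ m <= M).
  { intro m; specialize (HM m); rewrite Cmod_mult, Cmod_pow, Cmod_R, Rabs_pos_eq in HM by lra; exact HM. }
  exists M; split; [|exact HM'].
  eapply Rle_trans; [|apply (HM' O)]; simpl; rewrite Rmult_1_r; apply Cmod_ge_0.
Qed.

Lemma PS_term_bound (a : nat -> C) (w : C) (rho M q : R) :
  0 < rho -> (forall m, Cmod (a m) * rho ^ m <= M) -> Cmod w <= q * rho ->
  forall m, Cmod (a m * w ^ m) <= M * q ^ m.
Proof.
  intros Hrho Ha Hw m; rewrite Cmod_mult, Cmod_pow.
  assert (Hq : 0 <= q) by (apply Rmult_le_reg_r with rho; [exact Hrho|]; generalize (Cmod_ge_0 w); lra).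
  apply Rle_trans with (Cmod (a m) * (q * rho) ^ m).
  - apply Rmult_le_compat_l; [apply Cmod_ge_0|]; apply pow_incr; split; [apply Cmod_ge_0|exact Hw].
  - rewrite Rpow_mult_distr; generalize (Rmult_le_compat_r _ _ _ (pow_le _ m Hq) (Ha m)); lra.
Qed.

Lemma PS_bound_pos (a : nat -> C) (rho M : R) : (forall m, Cmod (a m) * rho ^ m <= M) -> 0 <= M.
Proof. intro H; eapply Rle_trans; [|apply (H O)]; simpl; rewrite Rmult_1_r; apply Cmod_ge_0. Qed.

Lemma PS_remainder (a : nat -> C) (w l : C) (rho M q : R) (N : nat) :
  0 < rho -> (forall m, Cmod (a m) * rho ^ m <= M) -> 0 <= q < 1 -> Cmod w <= q * rho ->
  PS a w l -> Cmod (l - Csum (fun m => a m * w ^ m)%C N) <= M * q ^ N / (1 - q).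
Proof.
  intros Hrho Ha Hq Hw Hl.
  eapply Rle_trans; [apply (Clim_series_bound _ (fun m => M * q ^ m) (M * / (1 - q)) l N)|].
  - apply (PS_term_bound a w rho M q Hrho Ha Hw).
  - apply is_sum_scal; [apply (PS_bound_pos _ _ _ Ha)|apply geometric_sum, Hq].
  - exact Hl.
  - rewrite (Rsum_scal M (fun m => q ^ m)); generalize (Rsum_geometric q N); intro H.
    apply Rmult_le_reg_l with (1 - q); [lra|].
    replace ((1 - q) * (M * q ^ N / (1 - q))) with (M * q ^ N) by (field; lra).
    replace ((1 - q) * (M * / (1 - q) - M * Rsum (fun m => q ^ m) N))
      with (M - M * ((1 - q) * Rsum (fun m => q ^ m) N)) by (field; lra).
    rewrite H; lra.
Qed.

Lemma pow_lim_0 (c q : R) : 0 <= q < 1 -> is_lim_seq (fun n => c * q ^ n) 0.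
Proof.
  intro Hq; replace (Finite 0) with (Rbar_mult c 0) by (simpl; f_equal; ring).
  apply is_lim_seq_mult'; [apply is_lim_seq_const|apply is_lim_seq_geom; rewrite Rabs_pos_eq; lra].
Qed.

Lemma lim_seq_le_0 (x : R) (v : nat -> R) : (forall n, x <= v n) -> is_lim_seq v 0 -> x <= 0.
Proof.
  intros H Hv; apply (is_lim_seq_le (fun _ => x) v x 0 H); [apply is_lim_seq_const|exact Hv].
Qed.

(** Cauchy's estimate by averaging: integrating a partial sum at z0 + rho e(t) against e(-m t) over
    one period isolates a_m rho^m by orthogonality. The partial sum is within a geometric error of
    [f], and this error tends to 0 with the number of terms. *)
Lemma PSon_Cauchy (f : C -> C) (z0 : C) (r rho M : R) (a : nat -> C) (m : nat) :
  PSon f z0 r a -> 0 < rho < r -> (forall z, Cmod (z - z0) < r -> Cmod (f z) <= M) ->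
  Cmod (a m) * rho ^ m <= M.
Proof.
  intros HP Hrho HM.
  (* A radius strictly between [rho] and [r] makes the tails on the circle of radius [rho] geometric
     with ratio [q < 1]. *)
  set (rho1 := (rho + r) / 2); set (q := rho / rho1).
  assert (Hr1 : rho < rho1 < r) by (unfold rho1; lra).
  assert (Hq : 0 <= q < 1).
  { unfold q; split; [apply Rlt_le, Rdiv_lt_0_compat; lra|apply Rlt_div_l; lra]. }
  assert (Eq : q * rho1 = rho) by (unfold q; field; lra).
  destruct (PSon_coef_bound f z0 r rho1 a HP ltac:(lra)) as [B [HB0 HB]].
  apply Rminus_le, (lim_seq_le_0 _ (fun n => (B * q ^ m * q / (1 - q)) * q ^ n)); [|apply pow_lim_0, Hq].
  (* More than [m] terms, so that the partial sum contains the index [m]. *)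
  intro n; set (N := (S m + n)%nat).
  assert (HN : Cmod (a m * rho ^ m)%C <= (M + B * q ^ N / (1 - q)) * (1 - 0)).
  { apply (CInt_norm_const (fun t => Csum (fun k => a k * rho ^ k * (Fourier_exp (Z.of_nat k - Z.of_nat m) t))%C N)); [lra| |].
    - intros t _; set (w := (rho * Fourier_exp 1 t)%C).
      assert (Hw : Cmod w = rho) by (unfold w; rewrite Cmod_mult, Cmod_Fourier_exp, Cmod_R, Rabs_pos_eq; lra).
      assert (Ew : forall k, (w ^ k = rho ^ k * Fourier_exp (Z.of_nat k) t)%C).
      { induction k; [simpl; rewrite Fourier_exp_0; ring|].
        rewrite !Cpow_S, IHk, Nat2Z.inj_succ; unfold Z.succ; rewrite Fourier_exp_plus; unfold w; ring. }
      rewrite (Csum_ext _ (fun k => Fourier_exp (- Z.of_nat m) t * (a k * w ^ k))%C).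
      2:{ intros k _; rewrite Ew; unfold Z.sub; rewrite Fourier_exp_plus; ring. }
      rewrite Csum_scal, Cmod_mult, Cmod_Fourier_exp, Rmult_1_l.
      assert (Ez : (z0 + w - z0)%C = w) by ring.
      assert (Hz : Cmod (z0 + w - z0) < r) by (rewrite Ez, Hw; lra).
      assert (HR := PS_remainder a w (f (z0 + w)%C) rho1 B q N ltac:(lra) HB Hq ltac:(lra)).
      destruct HP as [_ HP]; specialize (HP _ Hz); specialize (HM _ Hz); rewrite Ez in HP.
      specialize (HR HP); generalize (Cmod_triangle3 0 (f (z0 + w)%C) (Csum (fun k => a k * w ^ k)%C N)).
      replace (0 - f (z0 + w))%C with (- f (z0 + w))%C by ring; rewrite Cmod_opp.
      rewrite (Cmod_minus_sym 0); unfold Cminus at 1; rewrite Copp_0, Cplus_0_r; lra.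
    - replace (a m * rho ^ m)%C with
        (Csum (fun k => a k * rho ^ k * (if Z.eq_dec (Z.of_nat k - Z.of_nat m) 0 then RtoC 1 else RtoC 0))%C N).
      + apply CInt_Csum; intro k; apply CInt_scal, Fourier_exp_int.
      + rewrite (Csum_single _ N m); [| |].
        * destruct (Z.eq_dec _ 0); [ring|lia].
        * unfold N; lia.
        * intros k _ Hk; destruct (Z.eq_dec _ 0); [lia|ring]. }
  rewrite Cmod_mult, Cmod_pow, Cmod_R, Rabs_pos_eq in HN by lra.
  unfold N in HN; rewrite pow_add in HN; simpl pow in HN.
  unfold Rdiv in *; lra.
Qed.

(** Weierstrass' theorem on sums of analytic functions. Cauchy's estimates bound the remainder of
    order M of each [f n] by [A n] times the same geometric factor, so the remainders can be summed
    over [n]; sums are exchanged only while both are finite. *)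
Lemma PSon_series (f : nat -> C -> C) (F : C -> C) (z0 : C) (r S : R) (a : nat -> nat -> C)
  (tau : nat -> C) (A : nat -> R) :
  (forall n, PSon (f n) z0 r (a n)) ->
  (forall n z, Cmod (z - z0) < r -> Cmod (f n z) <= A n) -> is_sum A S ->
  (forall z, Cmod (z - z0) < r -> Clim (Csum (fun n => f n z)) (F z)) ->
  (forall m, Clim (Csum (fun n => a n m)) (tau m)) ->
  PSon F z0 r tau.
Proof.
  intros Hf HA HS HF Ht; assert (Hr : 0 < r) by apply (Hf O); split; [exact Hr|].
  intros z Hz; set (w := (z - z0)%C) in *.
  set (rho := (Cmod w + r) / 2); set (q := Cmod w / rho).
  assert (Hw := Cmod_ge_0 w).
  assert (Hrho : 0 < rho < r) by (unfold rho; lra).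
  assert (Hq : 0 <= q < 1).
  { unfold q; split; [apply Rmult_le_pos; [exact Hw|left; apply Rinv_0_lt_compat; lra]|apply Rlt_div_l; unfold rho; lra]. }
  assert (Eq : Cmod w <= q * rho) by (right; unfold q; field; lra).
  assert (HCa : forall n m, Cmod (a n m) * rho ^ m <= A n).
  { intros n m; apply (PSon_Cauchy (f n) z0 r rho); auto. }
  apply Clim_squeeze with (fun M => (S / (1 - q)) * q ^ M); [|apply pow_lim_0, Hq].
  intro M; rewrite Cmod_minus_sym.
  (* [T N] is the sum over n < N of the remainders of order [M] of the [f n]; the bound is proved
     for each [N] and kept in the limit. *)
  set (T := fun N => (Csum (fun n => f n z) N - Csum (fun m => Csum (fun n => a n m) N * w ^ m) M)%C).
  assert (HT : Clim T (F z - Csum (fun m => tau m * w ^ m) M)%C).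
  { apply Clim_minus; [apply HF, Hz|].
    clear -Ht; induction M; simpl; [apply Clim_const|]; apply Clim_plus; [exact IHM|].
    eapply Clim_ext; [|replace (tau M * w ^ M)%C with (w ^ M * tau M)%C by ring; apply Clim_scal, Ht].
    intro; simpl; ring. }
  replace (F z - Csum (fun m => tau m * w ^ m) M)%C with ((F z - Csum (fun m => tau m * w ^ m) M) - 0)%C by ring.
  apply Clim_le with (1 := HT); exists O; intros N _.
  replace (T N - 0)%C with (Csum (fun n => f n z - Csum (fun m => a n m * w ^ m) M)%C N).
  - apply Rle_trans with (Rsum (fun n => (q ^ M / (1 - q)) * A n) N).
    + apply Cmod_Csum_le; intros n _.
      replace (q ^ M / (1 - q) * A n) with (A n * q ^ M / (1 - q)) by (unfold Rdiv; ring).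
      apply (PS_remainder (a n) w (f n z) rho); auto; [lra|]; apply Hf, Hz.
    + rewrite Rsum_scal; replace (S / (1 - q) * q ^ M) with (q ^ M / (1 - q) * S) by (unfold Rdiv; ring).
      apply Rmult_le_compat_l; [|apply HS].
      apply Rmult_le_pos; [apply pow_le; lra|left; apply Rinv_0_lt_compat; lra].
  - unfold T; rewrite Csum_minus, Csum_swap.
    replace (Csum (fun j => Csum (fun i => (a i j * w ^ j)%C) N) M)
      with (Csum (fun m => (Csum (fun n => a n m) N * w ^ m)%C) M); [ring|].
    apply Csum_ext; intros j _; rewrite Cmult_comm, <- Csum_scal; apply Csum_ext; intros; ring.
Qed.

Lemma PSon_const (c z0 : C) (r : R) : 0 < r -> PSon (fun _ => c) z0 r (fun m => match m with O => c | _ => RtoC 0 end).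
Proof.
  intro Hr; split; [exact Hr|]; intros z _.
  apply Clim_incr_1, Clim_ext with (fun _ => c); [|apply Clim_const].
  intro n; symmetry; induction n; [simpl; ring|].
  change (Csum ?u (S (S n))) with (Csum u (S n) + u (S n))%C; rewrite IHn; simpl; ring.
Qed.

Lemma PSon_id (z0 : C) (r : R) :
  0 < r -> PSon (fun z => z) z0 r (fun m => match m with O => z0 | 1%nat => RtoC 1 | _ => RtoC 0 end).
Proof.
  intro Hr; split; [exact Hr|]; intros z _.
  apply (proj1 (Clim_incr_1 _ _)), (proj1 (Clim_incr_1 _ _)), Clim_ext with (fun _ => z); [|apply Clim_const].
  intro n; symmetry; induction n; [simpl; ring|].
  change (Csum ?u (S (S (S n)))) with (Csum u (S (S n)) + u (S (S n)))%C; rewrite IHn; simpl; ring.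
Qed.

Lemma PSon_plus (f g : C -> C) (z0 : C) (r : R) (a b : nat -> C) :
  PSon f z0 r a -> PSon g z0 r b -> PSon (fun z => f z + g z)%C z0 r (fun m => a m + b m)%C.
Proof.
  intros [Hr Hf] [_ Hg]; split; [exact Hr|]; intros z Hz.
  eapply Clim_ext; [|apply Clim_plus; [apply Hf, Hz|apply Hg, Hz]].
  intro n; cbv beta; rewrite <- Csum_plus; apply Csum_ext; intros; ring.
Qed.

Lemma PSon_scal (c : C) (f : C -> C) (z0 : C) (r : R) (a : nat -> C) :
  PSon f z0 r a -> PSon (fun z => c * f z)%C z0 r (fun m => c * a m)%C.
Proof.
  intros [Hr Hf]; split; [exact Hr|]; intros z Hz.
  eapply Clim_ext; [|apply Clim_scal, Hf, Hz].
  intro n; cbv beta; rewrite <- Csum_scal; apply Csum_ext; intros; ring.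
Qed.

Lemma PSon_coef_ext (f : C -> C) (z0 : C) (r : R) (a b : nat -> C) :
  (forall m, a m = b m) -> PSon f z0 r a -> PSon f z0 r b.
Proof.
  intros E [Hr H]; split; [exact Hr|]; intros z Hz; eapply Clim_ext; [|apply H, Hz].
  intro n; apply Csum_ext; intros; rewrite E; reflexivity.
Qed.

Lemma PSon_minus (f g : C -> C) (z0 : C) (r : R) (a b : nat -> C) :
  PSon f z0 r a -> PSon g z0 r b -> PSon (fun z => f z - g z)%C z0 r (fun m => a m - b m)%C.
Proof.
  intros Hf Hg.
  apply (PSon_coef_ext _ _ _ (fun m => a m + RtoC (-1) * b m)%C); [intro; ring|].
  apply (PSon_ext (fun z => f z + RtoC (-1) * g z)%C); [intros; ring|].
  apply PSon_plus; [exact Hf|apply PSon_scal, Hg].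
Qed.

Lemma PSon_reflect (f : C -> C) (c z0 : C) (r : R) (a : nat -> C) :
  PSon f (c - z0)%C r a -> PSon (fun z => f (c - z)%C) z0 r (fun m => RtoC ((-1) ^ m) * a m)%C.
Proof.
  intros [Hr H]; split; [exact Hr|]; intros z Hz.
  assert (E : (c - z - (c - z0))%C = (- (z - z0))%C) by ring.
  specialize (H (c - z)%C); rewrite E, Cmod_opp in H.
  eapply Clim_ext; [|apply H, Hz].
  intro n; apply Csum_ext; intros k _.
  replace (- (z - z0))%C with (RtoC (-1) * (z - z0))%C by ring; rewrite Cpow_mult_l, RtoC_pow; ring.
Qed.

Definition Cauchy_prod (a b : nat -> C) (m : nat) : C := Csum (fun i => a i * b (m - i)%nat)%C (S m).

(** The pairs (i, j) with i + j < N, grouped by i. *)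
Lemma Csum_Cauchy_prod (a b : nat -> C) (N : nat) :
  Csum (Cauchy_prod a b) N = Csum (fun i => a i * Csum b (N - i))%C N.
Proof.
  assert (ES : forall u n, Csum u (S n) = (Csum u n + u n)%C) by reflexivity.
  induction N; [reflexivity|]; rewrite (ES (Cauchy_prod a b)), IHN; unfold Cauchy_prod.
  rewrite !ES; replace (S N - N)%nat with 1%nat by lia; replace (N - N)%nat with 0%nat by lia.
  rewrite Cplus_assoc; f_equal; [|simpl; ring].
  rewrite <- Csum_plus; apply Csum_ext; intros k Hk.
  rewrite Nat.sub_succ_l by lia; simpl; ring.
Qed.

(** The partial sum of the Cauchy product misses [Csum u N * g z] by the sum of u_i times the tail
    of v after N - i terms. Each of these N products is O(q^i q^(N-i)) = O(q^N), so the error is O(N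
    q^N). *)
Lemma PSon_mult (f g : C -> C) (z0 : C) (r : R) (a b : nat -> C) :
  PSon f z0 r a -> PSon g z0 r b -> PSon (fun z => f z * g z)%C z0 r (Cauchy_prod a b).
Proof.
  intros HF HG; assert (Hr : 0 < r) by apply HF; split; [exact Hr|].
  intros z Hz; set (w := (z - z0)%C) in *.
  set (rho := (Cmod w + r) / 2); set (q := Cmod w / rho).
  assert (Hw := Cmod_ge_0 w).
  assert (Hrho : 0 < rho < r) by (unfold rho; lra).
  assert (Hq : 0 <= q < 1).
  { unfold q; split; [apply Rmult_le_pos; [exact Hw|left; apply Rinv_0_lt_compat; lra]|apply Rlt_div_l; unfold rho; lra]. }
  assert (Eq : Cmod w <= q * rho) by (right; unfold q; field; lra).
  destruct (PSon_coef_bound f z0 r rho a HF Hrho) as [M [HM0 HM]].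
  destruct (PSon_coef_bound g z0 r rho b HG Hrho) as [M' [HM0' HM']].
  set (u := fun m => (a m * w ^ m)%C); set (v := fun m => (b m * w ^ m)%C).
  assert (HU : Clim (Csum u) (f z)) by apply HF, Hz.
  assert (HV : Clim (Csum v) (g z)) by apply HG, Hz.
  apply Clim_ext with (Csum (Cauchy_prod u v)).
  { intro n; apply Csum_ext; intros k _; unfold Cauchy_prod.
    rewrite Cmult_comm, <- Csum_scal; apply Csum_ext; intros i Hi; unfold u, v.
    replace k with (i + (k - i))%nat at 3 by lia; rewrite Cpow_add_r; ring. }
  replace (f z * g z)%C with (f z * g z - 0)%C by ring.
  apply Clim_ext with (fun N => Csum u N * g z - Csum (fun i => u i * (g z - Csum v (N - i))) N)%C.
  { intro N; rewrite Csum_Cauchy_prod, Cmult_comm, <- Csum_scal, <- Csum_minus.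
    apply Csum_ext; intros; ring. }
  apply Clim_minus; [apply Clim_mult; [exact HU|apply Clim_const]|].
  destruct (geometric_1_sum q Hq) as [l Hl].
  apply Clim_squeeze with (fun N => (M * M' / (1 - q)) * (INR (S N) * q ^ N)).
  - intro N; replace (Csum _ N - 0)%C with (Csum (fun i => u i * (g z - Csum v (N - i)))%C N) by ring.
    apply Rle_trans with (Rsum (fun _ => M * M' / (1 - q) * q ^ N) N).
    + apply Cmod_Csum_le; intros i Hi; rewrite Cmod_mult.
      replace (M * M' / (1 - q) * q ^ N) with ((M * q ^ i) * (M' * q ^ (N - i) / (1 - q))).
      2:{ replace N with (i + (N - i))%nat at 2 by lia; rewrite pow_add; unfold Rdiv; ring. }
      apply Rmult_le_compat; try apply Cmod_ge_0.
      * apply (PS_term_bound a w rho M q); auto; lra.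
      * apply (PS_remainder b w (g z) rho); auto; lra.
    + rewrite (Rsum_scal _ (fun _ => q ^ N)); apply Rmult_le_compat_l.
      * apply Rmult_le_pos; [apply Rmult_le_pos; auto|left; apply Rinv_0_lt_compat; lra].
      * assert (E : forall x k, Rsum (fun _ => x) k = INR k * x).
        { intros x; induction k; [simpl; ring|]; cbn [Rsum]; rewrite IHk, S_INR; ring. }
        rewrite E; apply Rmult_le_compat_r; [apply pow_le; lra|rewrite S_INR; lra].
  - replace (Finite 0) with (Rbar_mult (M * M' / (1 - q)) 0) by (simpl; f_equal; ring).
    apply is_lim_seq_mult'; [apply is_lim_seq_const|].
    (* (N + 1) q^N tends to 0 as a difference of consecutive tails of a convergent series. *)
    replace (Finite 0) with (Finite (0 - 0)) by (f_equal; ring).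
    apply is_lim_seq_ext with (fun N => (l - Rsum (fun m => INR (S m) * q ^ m) N) - (l - Rsum (fun m => INR (S m) * q ^ m) (S N))).
    + intro N; cbn [Rsum]; ring.
    + apply is_lim_seq_minus'; [apply is_sum_lim, Hl|].
      apply (is_lim_seq_incr_1 (fun N => l - Rsum (fun m => INR (S m) * q ^ m) N)), is_sum_lim, Hl.
Qed.

(** The factor [r] on the left avoids the exponent m - 1. The induction gives m (m + 1), which is
    then weakened to (m + 1)(m + 2) to match the series of [geometric_2_sum]. *)
Lemma Cpow_second_order (w h : C) (r : R) (m : nat) :
  0 <= r -> Cmod w <= r -> Cmod (w + h) <= r ->
  r * Cmod ((w + h) ^ (S m) - w ^ (S m) - RtoC (INR (S m)) * h * w ^ m) <= Cmod h ^ 2 * (INR (S m) * INR (S (S m)) * r ^ m).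
Proof.
  intros Hr Hw Hwh.
  assert (H : r * Cmod ((w + h) ^ (S m) - w ^ (S m) - RtoC (INR (S m)) * h * w ^ m) <= Cmod h ^ 2 * (INR m * INR (S m) * r ^ m)).
  { induction m.
    - replace ((w + h) ^ 1 - w ^ 1 - RtoC (INR 1) * h * w ^ 0)%C with (RtoC 0) by (simpl; ring).
      rewrite Cmod_0; simpl; lra.
    - set (E := ((w + h) ^ (S m) - w ^ (S m) - RtoC (INR (S m)) * h * w ^ m)%C) in *.
      replace ((w + h) ^ (S (S m)) - w ^ (S (S m)) - RtoC (INR (S (S m))) * h * w ^ (S m))%C
        with ((w + h) * E + RtoC (INR (S m)) * (h * h) * w ^ m)%C
        by (unfold E; rewrite !(S_INR (S m)), RtoC_plus, !Cpow_S; ring).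
      assert (H1 : Cmod ((w + h) * E + RtoC (INR (S m)) * (h * h) * w ^ m) <= r * Cmod E + INR (S m) * Cmod h ^ 2 * r ^ m).
      { eapply Rle_trans; [apply Cmod_triangle|]; rewrite !Cmod_mult, Cmod_R, (Rabs_pos_eq (INR (S m))) by apply pos_INR.
        apply Rplus_le_compat; [apply Rmult_le_compat_r; [apply Cmod_ge_0|exact Hwh]|].
        rewrite Cmod_pow; simpl (Cmod h ^ 2); rewrite Rmult_1_r.
        apply Rmult_le_compat_l; [apply Rmult_le_pos; [apply pos_INR|apply Rle_0_sqr]|].
        apply pow_incr; split; [apply Cmod_ge_0|exact Hw]. }
      apply (Rmult_le_compat_l r) in H1; [|exact Hr].
      eapply Rle_trans; [exact H1|].
      rewrite Rmult_plus_distr_l.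
      apply Rle_trans with (r * (Cmod h ^ 2 * (INR m * INR (S m) * r ^ m)) + r * (INR (S m) * Cmod h ^ 2 * r ^ m)).
      + apply Rplus_le_compat_r, Rmult_le_compat_l; [exact Hr|exact IHm].
      + assert (0 <= Cmod h ^ 2 * (INR (S m) * r ^ S m)).
        { apply Rmult_le_pos; [apply pow2_ge_0|apply Rmult_le_pos; [apply pos_INR|apply pow_le, Hr]]. }
        rewrite (S_INR (S m)), (S_INR m) in *; simpl (r ^ S m) in *; lra. }
  eapply Rle_trans; [exact H|]; apply Rmult_le_compat_l; [apply pow2_ge_0|].
  apply Rmult_le_compat_r; [apply pow_le, Hr|].
  assert (0 <= INR m) by apply pos_INR; rewrite !S_INR; nra.
Qed.

Lemma C_derive_quadratic (f : C -> C) (z l : C) (K d : R) :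
  0 < d -> (forall h, Cmod h < d -> Cmod (f (z + h)%C - f z - h * l) <= K * Cmod h ^ 2) -> C_derive f z = l.
Proof.
  intros Hd H; apply is_C_lim_unique.
  apply (filterlim_Cmod (locally' z) (fun x => (f x - f z) / (x - z))%C); intros e He.
  set (e' := Rmin (d / 2) (e / (2 * (Rabs K + 1)))).
  assert (HK := Rabs_pos K).
  assert (He' : 0 < e') by (apply Rmin_pos; [lra|apply Rdiv_lt_0_compat; lra]).
  exists (mkposreal _ He'); refine (fun (x : C) Hx Hxz => _).
  apply Cmod_ball_C in Hx; simpl in Hx.
  assert (H1 : e' <= d / 2) by apply Rmin_l; assert (H2 : e' <= e / (2 * (Rabs K + 1))) by apply Rmin_r.
  assert (Hn : (x - z)%C <> RtoC 0) by (apply Cminus_eq_contra; exact Hxz).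
  specialize (H (x - z)%C ltac:(lra)); replace (z + (x - z))%C with x in H by ring.
  replace ((f x - f z) / (x - z) - l)%C with ((f x - f z - (x - z) * l) / (x - z))%C by (field; exact Hn).
  rewrite Cmod_div by exact Hn.
  apply Cmod_gt_0 in Hn; apply Rlt_div_l; [exact Hn|].
  eapply Rle_lt_trans; [exact H|].
  set (c := Cmod (x - z)) in *.
  apply Rle_lt_trans with (Rabs K * c * c).
  - simpl; rewrite Rmult_1_r, Rmult_assoc; apply Rmult_le_compat_r; [nra|apply Rle_abs].
  - apply Rmult_lt_compat_r; [exact Hn|].
    apply Rle_lt_trans with (Rabs K * (2 * (e / (2 * (Rabs K + 1))))); [apply Rmult_le_compat_l; lra|].
    replace (Rabs K * (2 * (e / (2 * (Rabs K + 1))))) with (e * (Rabs K / (Rabs K + 1))) by (field; lra).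
    rewrite <- (Rmult_1_r e) at 2; apply Rmult_lt_compat_l; [exact He|]; apply Rlt_div_l; lra.
Qed.

(** The second-order remainders of the powers add up to a multiple of |h|^2, because the series with
    coefficients (m + 1)(m + 2) q^m converges. *)
Lemma PSon_derive (f : C -> C) (z0 : C) (r : R) (a : nat -> C) :
  PSon f z0 r a -> PSon (C_derive f) z0 r (fun m => RtoC (INR (S m)) * a (S m))%C.
Proof.
  intros HF; assert (Hr : 0 < r) by apply HF; split; [exact Hr|].
  intros z Hz; set (w := (z - z0)%C) in *.
  assert (Hw := Cmod_ge_0 w).
  (* |w| < s < rho < r: the first gap leaves room for the increment h, the second gives the ratio q
     < 1, the third bounds the coefficients. *)
  set (s := (2 * Cmod w + r) / 3); set (rho := (Cmod w + 2 * r) / 3); set (q := s / rho).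
  assert (Hs : Cmod w < s) by (unfold s; lra).
  assert (Hsr : 0 < s < rho) by (unfold s, rho; lra).
  assert (Hrho : 0 < rho < r) by (unfold rho; lra).
  assert (Hq : 0 <= q < 1).
  { unfold q; split; [apply Rlt_le, Rdiv_lt_0_compat; lra|apply Rlt_div_l; lra]. }
  assert (Eq : s = q * rho) by (unfold q; field; lra).
  destruct (PSon_coef_bound f z0 r rho a HF Hrho) as [M [HM0 HM]].
  assert (Ha : forall m, Cmod (a (S m)) * s ^ m <= (M / rho) * q ^ m).
  { intro m; apply Rmult_le_reg_l with rho; [lra|].
    replace (rho * (M / rho * q ^ m)) with (M * q ^ m) by (field; lra).
    rewrite Eq, Rpow_mult_distr.
    generalize (Rmult_le_compat_r (q ^ m) _ _ (pow_le q m ltac:(lra)) (HM (S m))); simpl pow; lra. }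
  destruct (geometric_1_sum q Hq) as [l1 Hl1]; destruct (geometric_2_sum q Hq) as [l2 Hl2].
  assert (HMr : 0 <= M / rho) by (apply Rmult_le_pos; [exact HM0|left; apply Rinv_0_lt_compat; lra]).
  assert (Hdom : forall m, Cmod (RtoC (INR (S m)) * a (S m) * w ^ m) <= (M / rho) * (INR (S m) * q ^ m)).
  { intro m; rewrite !Cmod_mult, Cmod_pow, Cmod_R, (Rabs_pos_eq (INR (S m))) by apply pos_INR.
    apply Rle_trans with (INR (S m) * (Cmod (a (S m)) * s ^ m)).
    - rewrite Rmult_assoc; apply Rmult_le_compat_l; [apply pos_INR|].
      apply Rmult_le_compat_l; [apply Cmod_ge_0|]; apply pow_incr; lra.
    - generalize (Rmult_le_compat_l _ _ _ (pos_INR (S m)) (Ha m)); lra. }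
  destruct (series_dominated _ _ _ Hdom (is_sum_scal _ _ _ HMr Hl1)) as [l [Hl _]].
  enough (E : C_derive f z = l) by (rewrite E; exact Hl).
  apply (C_derive_quadratic f z l (/ s * (M / rho * l2)) (s - Cmod w)); [lra|].
  intros h Hh.
  assert (Hwh : Cmod (w + h) <= s) by (eapply Rle_trans; [apply Cmod_triangle|]; lra).
  assert (L1 : Clim (Csum (fun m => a m * (w + h) ^ m)%C) (f (z + h)%C)).
  { replace (w + h)%C with (z + h - z0)%C in * by (unfold w; ring); apply HF; lra. }
  assert (L2 : Clim (Csum (fun m => a m * w ^ m)%C) (f z)) by (apply HF, Hz).
  assert (L : Clim (Csum (fun m => a (S m) * ((w + h) ^ (S m) - w ^ (S m) - RtoC (INR (S m)) * h * w ^ m))%C) (f (z + h)%C - f z - h * l)%C).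
  { eapply Clim_ext; [|apply Clim_minus; [apply Clim_minus; [apply Clim_incr_1, L1|apply Clim_incr_1, L2]|apply (Clim_scal h), Hl]].
    intro N; cbv beta; rewrite <- !Csum_scal.
    assert (EE : forall u N, Csum u (S N) = (u O + Csum (fun k => u (S k)) N)%C).
    { intros u n; change (S n) with (1 + n)%nat; rewrite Csum_app; simpl; ring. }
    rewrite !EE.
    replace (a 0%nat * (w + h) ^ 0)%C with (a O) by (simpl; ring).
    replace (a 0%nat * w ^ 0)%C with (a O) by (simpl; ring).
    match goal with |- ((a O + ?x) - (a O + ?y) - ?t)%C = _ => transitivity (x - y - t)%C; [ring|] end.
    rewrite <- !Csum_minus; apply Csum_ext; intros; rewrite !Cpow_S; ring. }
  replace (f (z + h)%C - f z - h * l)%C with ((f (z + h)%C - f z - h * l) - 0)%C by ring.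
  apply Clim_le with (1 := L); exists O; intros N _.
  rewrite Cminus_0_r.
  apply Rle_trans with (Rsum (fun m => (Cmod h ^ 2 * / s * (M / rho)) * (INR (S m) * INR (S (S m)) * q ^ m)) N).
  - apply Cmod_Csum_le; intros m _; rewrite Cmod_mult.
    generalize (Cpow_second_order w h s m ltac:(lra) ltac:(lra) Hwh); intro H2.
    apply (Rmult_le_compat_l (/ s)) in H2; [|left; apply Rinv_0_lt_compat; lra].
    rewrite <- Rmult_assoc, Rinv_l, Rmult_1_l in H2 by lra.
    apply (Rmult_le_compat_l (Cmod (a (S m)))) in H2; [|apply Cmod_ge_0].
    eapply Rle_trans; [exact H2|].
    assert (H3 : 0 <= / s * Cmod h ^ 2 * (INR (S m) * INR (S (S m)))).
    { repeat apply Rmult_le_pos; try apply pos_INR; try apply Cmod_ge_0; [left; apply Rinv_0_lt_compat; lra|lra]. }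
    generalize (Rmult_le_compat_l _ _ _ H3 (Ha m)); lra.
  - rewrite Rsum_scal.
    replace (/ s * (M / rho * l2) * Cmod h ^ 2) with ((Cmod h ^ 2 * / s * (M / rho)) * l2) by ring.
    apply Rmult_le_compat_l; [|apply Hl2].
    apply Rmult_le_pos; [apply Rmult_le_pos; [apply pow2_ge_0|left; apply Rinv_0_lt_compat; lra]|exact HMr].
Qed.

Lemma PSon_center (f : C -> C) (z0 : C) (r : R) (a : nat -> C) : PSon f z0 r a -> f z0 = a O.
Proof.
  intros [Hr H]; specialize (H z0); replace (z0 - z0)%C with (RtoC 0) in H by ring.
  rewrite Cmod_0 in H; specialize (H Hr); apply (Clim_unique _ _ _ H).
  apply Clim_incr_1, Clim_ext with (fun _ => a O); [|apply Clim_const].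
  induction n; [simpl; ring|]; change (Csum ?u (S (S n))) with (Csum u (S n) + u (S n))%C.
  rewrite <- IHn, Cpow_S; ring.
Qed.

Lemma PSon_derive_n (f : C -> C) (z0 : C) (r : R) (a : nat -> C) (k : nat) :
  PSon f z0 r a -> C_derive_n k f z0 = (RtoC (INR (fact k)) * a k)%C.
Proof.
  intro H.
  assert (G : PSon (C_derive_n k f) z0 r (fun m => RtoC (INR (fact (m + k)) / INR (fact m)) * a (m + k)%nat)%C).
  { induction k.
    - apply PSon_coef_ext with (2 := H); intro m; rewrite !Nat.add_0_r.
      unfold Rdiv; rewrite Rinv_r by apply INR_fact_neq_0; ring.
    - apply PSon_coef_ext with (2 := PSon_derive _ _ _ _ IHk); intro m.
      rewrite Cmult_assoc, <- RtoC_mult; rewrite Nat.add_succ_l, <- Nat.add_succ_r; f_equal; f_equal.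
      rewrite fact_simpl, mult_INR; field; split; [apply INR_fact_neq_0|apply not_0_INR; lia]. }
  rewrite (PSon_center _ _ _ _ G); simpl; f_equal; f_equal; field.
Qed.

(** Strong induction on the order: once the lower coefficients vanish, a zero w close to z0 makes
    a_m w^m equal to minus a remainder of size O(|w|^(m+1)), so |a_m| is O(|w|) for arbitrarily
    small w. *)
Lemma PSon_zeros_cluster (f : C -> C) (z0 d : C) (r : R) (a : nat -> C) :
  PSon f z0 r a -> d <> RtoC 0 ->
  (forall eps, 0 < eps -> exists t, 0 < Rabs t < eps /\ f (z0 + RtoC t * d)%C = RtoC 0) ->
  forall m, a m = RtoC 0.
Proof.
  intros HP Hd Hz; assert (Hr : 0 < r) by apply HP.
  destruct (PSon_coef_bound f z0 r (r / 2) a HP ltac:(lra)) as [M [HM0 HM]].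
  set (rho := r / 2) in *; assert (Hrho : 0 < rho) by (unfold rho; lra).
  apply Cmod_gt_0 in Hd.
  induction m as [m IH] using lt_wf_ind.
  apply Cmod_small_eq; intros e He; rewrite Cminus_0_r.
  (* The remainder is at most M q^(m+1) / (1 - q) with q = |w| / rho <= 1/2, hence at most K
     |w|^(m+1). *)
  set (K := 2 * M / rho ^ (S m)).
  assert (Hpm : 0 < rho ^ (S m)) by (apply pow_lt; lra).
  assert (HK : 0 <= K) by (unfold K; apply Rmult_le_pos; [lra|left; apply Rinv_0_lt_compat, Hpm]).
  set (eps := Rmin (rho / 2) (e / (K + 1))).
  assert (Heps : 0 < eps) by (apply Rmin_pos; [lra|apply Rdiv_lt_0_compat; lra]).
  destruct (Hz (eps / Cmod d)) as [t [[Ht0 Ht] Ef]]; [apply Rdiv_lt_0_compat; lra|].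
  set (w := (RtoC t * d)%C) in *.
  assert (Hw : 0 < Cmod w < eps).
  { unfold w; rewrite Cmod_mult, Cmod_R; split; [apply Rmult_lt_0_compat; lra|].
    apply (Rmult_lt_compat_r (Cmod d)) in Ht; [|lra].
    replace (eps / Cmod d * Cmod d) with eps in Ht by (field; lra); exact Ht. }
  assert (H1 : eps <= rho / 2) by apply Rmin_l; assert (H2 : eps <= e / (K + 1)) by apply Rmin_r.
  set (q := Cmod w / rho).
  assert (Eq : Cmod w = q * rho) by (unfold q; field; lra).
  assert (Hq : 0 < q <= 1 / 2) by (clearbody q; nra).
  assert (Ez : (z0 + w - z0)%C = w) by ring.
  assert (HPS : PS a w 0).
  { generalize (proj2 HP (z0 + w)%C); rewrite Ez, Ef; intro H; apply H; unfold rho in *; lra. }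
  assert (HR := PS_remainder a w 0 rho M q (S m) Hrho HM ltac:(lra) ltac:(lra) HPS).
  change (Csum ?u (S m)) with (Csum u m + u m)%C in HR; cbv beta in HR.
  rewrite Csum_zero in HR by (intros k Hk; rewrite IH by exact Hk; ring).
  replace (0 - (0 + a m * w ^ m))%C with (- (a m * w ^ m))%C in HR by ring.
  rewrite Cmod_opp, Cmod_mult, Cmod_pow in HR.
  apply Rle_trans with (K * Cmod w).
  - assert (Hwm : 0 < Cmod w ^ m) by (apply pow_lt; lra).
    apply Rmult_le_reg_r with (Cmod w ^ m); [exact Hwm|].
    eapply Rle_trans; [exact HR|].
    replace (K * Cmod w * Cmod w ^ m) with (2 * (M * q ^ (S m))).
    + apply Rle_div_l; [lra|].
      assert (0 <= M * q ^ S m) by (apply Rmult_le_pos; [exact HM0|apply pow_le; lra]); nra.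
    + unfold K, q; unfold Rdiv; rewrite Rpow_mult_distr, pow_inv; simpl; field.
      split; [apply pow_nonzero|]; lra.
  - apply Rle_trans with (K * (e / (K + 1))); [apply Rmult_le_compat_l; lra|].
    replace (K * (e / (K + 1))) with (e * (K / (K + 1))) by (field; lra).
    rewrite <- (Rmult_1_r e) at 2; apply Rmult_le_compat_l; [lra|]; apply Rle_div_l; lra.
Qed.

Lemma PSon_zero (f : C -> C) (z0 z : C) (r : R) (a : nat -> C) :
  PSon f z0 r a -> (forall m, a m = RtoC 0) -> Cmod (z - z0) < r -> f z = RtoC 0.
Proof.
  intros [Hr H] Ha Hz; apply (Clim_unique _ _ _ (H z Hz)).
  apply Clim_ext with (fun _ => RtoC 0); [|apply Clim_const].
  intro n; symmetry; apply Csum_zero; intros; rewrite Ha; ring.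
Qed.

(** Connectedness of the segment: at the supremum of the parameters up to which [g] vanishes, zeros
    accumulate, so [g] vanishes on a whole disc about that point. *)
Lemma identity_segment (g : C -> C) (z0 d : C) (eps : R) :
  d <> RtoC 0 -> (forall t, 0 <= t <= 1 -> analytic_at g (z0 + RtoC t * d)%C) ->
  0 < eps -> (forall t, 0 < t < eps -> g (z0 + RtoC t * d)%C = RtoC 0) ->
  g (z0 + d)%C = RtoC 0.
Proof.
  intros Hd Ha Heps H0.
  set (E := fun t => 0 <= t <= 1 /\ forall u, 0 < u < t -> g (z0 + RtoC u * d)%C = RtoC 0).
  destruct (completeness E) as [tau [Hub Hlub]].
  { exists 1; intros t [Ht _]; lra. }
  { exists 0; split; [lra|]; intros; lra. }
  assert (Hmin : Rmin eps 1 <= tau).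
  { apply Hub; split; [split; [apply Rmin_glb; lra|apply Rmin_r]|].
    intros u Hu; apply H0; generalize (Rmin_l eps 1); lra. }
  assert (Hmp : 0 < Rmin eps 1) by (apply Rmin_pos; lra).
  assert (Ht1 : tau <= 1) by (apply Hlub; intros t [Ht _]; lra).
  assert (Hlt : forall u, 0 < u < tau -> g (z0 + RtoC u * d)%C = RtoC 0).
  { intros u Hu; apply Classical_Prop.NNPP; intro Hn.
    assert (tau <= u); [|lra].
    apply Hlub; intros t [Ht HE]; destruct (Rle_lt_dec t u) as [h|h]; [exact h|].
    exfalso; apply Hn, HE; lra. }
  destruct (proj1 (analytic_at_PSon _ _) (Ha tau ltac:(lra))) as (r & a & HP).
  assert (Hr : 0 < r) by apply HP.
  assert (Hz : forall m, a m = RtoC 0).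
  { apply (PSon_zeros_cluster g _ d r a HP Hd); intros e He.
    (* The known zeros lie below [tau], hence the negative parameter. *)
    exists (- (Rmin e tau / 2)); assert (0 < Rmin e tau) by (apply Rmin_pos; lra).
    generalize (Rmin_l e tau) (Rmin_r e tau); intros.
    rewrite Rabs_Ropp, Rabs_pos_eq by lra; split; [lra|].
    replace (z0 + RtoC tau * d + RtoC (- (Rmin e tau / 2)) * d)%C with (z0 + RtoC (tau - Rmin e tau / 2) * d)%C.
    - apply Hlt; lra.
    - unfold Rminus; rewrite RtoC_plus; ring. }
  assert (Hd' := proj1 (Cmod_gt_0 d) Hd).
  destruct (Rlt_le_dec tau 1) as [h|h].
  (* The disc of zeros about the point of parameter [tau] would carry [E] beyond its supremum. *)
  - exfalso; set (de := Rmin (1 - tau) (r / Cmod d)).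
    assert (Hde : 0 < de) by (apply Rmin_pos; [lra|apply Rdiv_lt_0_compat; lra]).
    assert (tau + de <= tau); [|lra].
    apply Hub; split; [generalize (Rmin_l (1 - tau) (r / Cmod d)); unfold de in *; lra|].
    intros u Hu; destruct (Rlt_le_dec u tau) as [h'|h']; [apply Hlt; lra|].
    apply (PSon_zero _ _ _ _ _ HP Hz).
    replace (z0 + RtoC u * d - (z0 + RtoC tau * d))%C with (RtoC (u - tau) * d)%C by (unfold Rminus; rewrite RtoC_plus, RtoC_opp; ring).
    rewrite Cmod_mult, Cmod_R, Rabs_pos_eq by lra.
    apply Rlt_le_trans with (de * Cmod d); [apply Rmult_lt_compat_r; lra|].
    apply Rle_trans with (r / Cmod d * Cmod d); [apply Rmult_le_compat_r; [lra|apply Rmin_r]|].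
    right; field; lra.
  - replace tau with 1 in * by lra.
    replace (z0 + d)%C with (z0 + RtoC 1 * d)%C by ring.
    rewrite (PSon_center _ _ _ _ HP); apply Hz.
Qed.

Lemma analytic_at_common (f g : C -> C) (z0 : C) :
  analytic_at f z0 -> analytic_at g z0 -> exists r a b, PSon f z0 r a /\ PSon g z0 r b.
Proof.
  intros Hf Hg; apply analytic_at_PSon in Hf; apply analytic_at_PSon in Hg.
  destruct Hf as (r & a & Hf); destruct Hg as (r' & b & Hg).
  assert (0 < r) by apply Hf; assert (0 < r') by apply Hg; assert (0 < Rmin r r') by (apply Rmin_pos; lra).
  exists (Rmin r r'), a, b; split.
  - apply PSon_le with (2 := Hf); split; [assumption|apply Rmin_l].
  - apply PSon_le with (2 := Hg); split; [assumption|apply Rmin_r].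
Qed.

Lemma analytic_at_minus (f g : C -> C) (z0 : C) :
  analytic_at f z0 -> analytic_at g z0 -> analytic_at (fun z => f z - g z)%C z0.
Proof.
  intros Hf Hg; destruct (analytic_at_common f g z0 Hf Hg) as (r & a & b & Ha & Hb).
  apply analytic_at_PSon; eexists; eexists; apply PSon_minus; eassumption.
Qed.

Lemma analytic_at_mult (f g : C -> C) (z0 : C) :
  analytic_at f z0 -> analytic_at g z0 -> analytic_at (fun z => f z * g z)%C z0.
Proof.
  intros Hf Hg; destruct (analytic_at_common f g z0 Hf Hg) as (r & a & b & Ha & Hb).
  apply analytic_at_PSon; eexists; eexists; apply PSon_mult; eassumption.
Qed.

Lemma analytic_at_const (c z0 : C) : analytic_at (fun _ => c) z0.
Proof. apply analytic_at_PSon; eexists; eexists; apply (PSon_const c z0 1), Rlt_0_1. Qed.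

Lemma analytic_at_id (z0 : C) : analytic_at (fun z => z) z0.
Proof. apply analytic_at_PSon; eexists; eexists; apply (PSon_id z0 1), Rlt_0_1. Qed.

Lemma PSon_Cexp_lin (b c z0 : C) (r : R) :
  0 < r -> PSon (fun z => Cexp (b * z + c)) z0 r (fun m => Cexp (b * z0 + c) * (RtoC (/ INR (fact m)) * b ^ m))%C.
Proof.
  intro Hr; split; [exact Hr|]; intros z _; set (w := (b * (z - z0))%C).
  replace (b * z + c)%C with ((b * z0 + c) + w)%C by (unfold w; ring); rewrite (Cexp_plus (b * z0 + c)).
  apply Clim_ext with (fun n => Cexp (b * z0 + c) * exp_poly n w)%C.
  { intro n; unfold exp_poly; rewrite <- Csum_scal; apply Csum_ext; intros k _.
    unfold w; rewrite Cpow_mult_l; ring. }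
  apply Clim_scal, Clim_squeeze with (fun N => exp (Cmod w) * (Cmod w ^ N / INR (fact N))).
  - intro N; rewrite Cmod_minus_sym; apply Cexp_taylor.
  - replace (Finite 0) with (Rbar_mult (exp (Cmod w)) 0) by (simpl; f_equal; ring).
    apply is_lim_seq_mult'; [apply is_lim_seq_const|].
    apply is_lim_seq_ext with (fun n => / INR (fact n) * Cmod w ^ n); [intro; unfold Rdiv; ring|].
    apply ex_series_lim_0; exists (exp (Cmod w)).
    apply (is_pseries_R (fun n => / INR (fact n))), is_exp_Reals.
Qed.

(** * Taylor coefficients of the gamma function *)

Lemma Clog_RtoC (t : R) : 0 < t -> Clog (RtoC t) = RtoC (ln t).
Proof.
  intro Ht; unfold Clog, Carg; rewrite Cmod_R, Rabs_pos_eq by lra; simpl.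
  destruct (Rle_dec 0 0) as [_|h]; [|lra].
  unfold Rdiv; rewrite Rinv_r, acos_1 by lra; reflexivity.
Qed.

Lemma Cpower_RtoC (t : R) (w : C) : 0 < t -> Cpower (RtoC t) w = Cexp (w * RtoC (ln t)).
Proof. intro Ht; unfold Cpower; rewrite Clog_RtoC by exact Ht; reflexivity. Qed.

Lemma ln_le_linear (A t : R) : 0 < A -> 0 < t -> A * ln t - t <= A * ln A - A.
Proof.
  intros HA Ht; generalize (exp_ineq1_le (ln (t / A))).
  rewrite exp_ln, ln_div by (auto; apply Rdiv_lt_0_compat; assumption); intro H.
  apply (Rmult_le_compat_l A) in H; [|lra].
  replace (A * (t / A)) with t in H by (field; lra); lra.
Qed.

Lemma continuous_ln (t : R) : 0 < t -> continuous ln t.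
Proof. intro; apply (ex_derive_continuous (K := R_AbsRing) (V := R_NormedModule)); auto_derive; assumption. Qed.

Lemma at_right_lt (a b : R) : a < b -> at_right a (fun x => a < x < b).
Proof.
  intro h; assert (h' : 0 < b - a) by lra; exists (mkposreal _ h'); intros y Hy Hy'.
  unfold ball in Hy; simpl in Hy; unfold AbsRing_ball, abs, minus, plus, opp in Hy; simpl in Hy.
  apply Rabs_lt_between in Hy; lra.
Qed.

(** * An integrable majorant for Euler's integral *)

Section Envelope.

Variable eta : R.
Hypothesis Heta : 0 < eta.

Let p t := exp (eta * ln t).

(** With p = t^eta, the function p / (1 + p) increases from 0 to 1 on the half-line. Its derivative
    decays like t^(eta-1) at 0 and t^(-eta-1) at infinity, so it serves as one majorant at both
    ends. *)
Lemma Gamma_envelope_int :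
  is_RInt_gen (fun t => eta / t * p t / (1 + p t) ^ 2) (at_right 0) (Rbar_locally p_infty) 1.
Proof.
  assert (Hp : forall t, 0 < p t) by (intro; apply exp_pos).
  replace 1 with (1 - 0) by ring.
  apply (is_RInt_gen_primitive _ _ _ (fun t => p t / (1 + p t)) (fun t => 0 < t)).
  - apply spans_infty; auto.
  - intros t Ht; unfold p; auto_derive.
    + repeat split; try exact Ht; generalize (Hp t); unfold p; lra.
    + field; generalize (Hp t); unfold p; split; lra.
  - intros t Ht; apply (ex_derive_continuous (K := R_AbsRing) (V := R_NormedModule)); unfold p; auto_derive.
    repeat split; try lra; generalize (Hp t); unfold p; intro.
    apply Rmult_integral_contrapositive; split; lra.
  - apply filterlim_locally; intros eps.
    generalize (at_right_lt 0 (exp (ln eps / eta)) (exp_pos _)); apply filter_imp; intros t [Ht0 Ht].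
    unfold ball; simpl; unfold AbsRing_ball, abs, minus, plus, opp; simpl; rewrite Ropp_0, Rplus_0_r.
    assert (p t < eps).
    { unfold p; rewrite <- (exp_ln eps) by apply cond_pos; apply exp_increasing.
      apply ln_increasing in Ht; [|exact Ht0]; rewrite ln_exp in Ht.
      apply (Rmult_lt_compat_l eta) in Ht; [|exact Heta].
      replace (eta * (ln eps / eta)) with (ln eps) in Ht by (field; lra); exact Ht. }
    specialize (Hp t); rewrite Rabs_pos_eq by (apply Rlt_le, Rdiv_lt_0_compat; lra).
    apply Rlt_div_l; [lra|]; generalize (cond_pos eps); nra.
  - apply filterlim_locally; intros eps.
    exists (exp (- ln eps / eta)); intros t Ht.
    assert (Ht0 : 0 < t) by (generalize (exp_pos (- ln eps / eta)); lra).
    assert (/ eps < p t).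
    { unfold p; rewrite <- (exp_ln (/ eps)) by (apply Rinv_0_lt_compat, cond_pos).
      rewrite ln_Rinv by apply cond_pos; apply exp_increasing.
      apply ln_increasing in Ht; [|apply exp_pos]; rewrite ln_exp in Ht.
      apply (Rmult_lt_compat_l eta) in Ht; [|exact Heta].
      replace (eta * (- ln eps / eta)) with (- ln eps) in Ht by (field; lra); exact Ht. }
    unfold ball; simpl; unfold AbsRing_ball, abs, minus, plus, opp; simpl.
    specialize (Hp t).
    replace (p t / (1 + p t) + - (1)) with (- / (1 + p t)) by (field; lra).
    rewrite Rabs_Ropp, Rabs_pos_eq by (left; apply Rinv_0_lt_compat; lra).
    rewrite <- (Rinv_inv eps); apply Rinv_lt_contravar; [|lra].
    apply Rmult_lt_0_compat; [apply Rinv_0_lt_compat, cond_pos|lra].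
Qed.

(** The first 4 bounds (1 + p)^2 for t <= 1; the other summand is 4 times the maximum of t^(4 eta)
    e^(-t), attained at t = 4 eta. *)
Let K := 4 + 4 * exp (4 * eta * ln (4 * eta) - 4 * eta).

(** With 2 eta the real part of the centre, the left-hand side is the modulus of Euler's integrand
    times the slack exp(eta |ln t|), which pays for the powers of ln t and for moving z within a
    disc. *)
Lemma Gamma_envelope (t : R) : 0 < t ->
  exp ((2 * eta - 1) * ln t - t + eta * Rabs (ln t)) <= K / eta * (eta / t * p t / (1 + p t) ^ 2).
Proof.
  intro Ht; assert (Hp : 0 < p t) by apply exp_pos.
  replace (K / eta * (eta / t * p t / (1 + p t) ^ 2)) with (K * (/ t * p t) / (1 + p t) ^ 2) by (field; lra).
  apply Rle_div_r; [apply pow_lt; lra|].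
  replace (exp ((2 * eta - 1) * ln t - t + eta * Rabs (ln t))) with
    ((/ t * p t) * (exp (eta * ln t - t + eta * Rabs (ln t)))).
  2:{ unfold p; rewrite <- (exp_ln (/ t)) by (apply Rinv_0_lt_compat, Ht).
      rewrite ln_Rinv by exact Ht; rewrite <- !exp_plus; f_equal; ring. }
  rewrite (Rmult_assoc (/ t * p t)), (Rmult_comm K); apply Rmult_le_compat_l.
  { apply Rmult_le_pos; [left; apply Rinv_0_lt_compat, Ht|lra]. }
  unfold K; assert (He := exp_pos (4 * eta * ln (4 * eta) - 4 * eta)).
  destruct (Rle_lt_dec t 1) as [h|h].
  - assert (Hl : ln t <= 0) by (rewrite <- ln_1; apply ln_le; assumption).
    rewrite Rabs_left1 by exact Hl.
    assert (E1 : exp (eta * ln t - t + eta * - ln t) <= 1) by (rewrite <- exp_0; apply exp_le_compat; lra).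
    assert (E2 : p t <= 1) by (unfold p; rewrite <- exp_0; apply exp_le_compat; nra).
    assert ((1 + p t) ^ 2 <= 4) by nra.
    apply Rle_trans with (1 * 4); [|lra].
    apply Rmult_le_compat; [left; apply exp_pos|apply pow2_ge_0|assumption|assumption].
  - assert (Hl : 0 < ln t) by (rewrite <- ln_1; apply ln_increasing; lra).
    rewrite Rabs_pos_eq by lra.
    assert (E2 : 1 <= p t) by (unfold p; rewrite <- exp_0; apply exp_le_compat; nra).
    apply Rle_trans with (exp (eta * ln t - t + eta * ln t) * (4 * (p t * p t))).
    + apply Rmult_le_compat_l; [left; apply exp_pos|nra].
    + unfold p; rewrite <- exp_plus, <- Rmult_assoc, (Rmult_comm _ 4), Rmult_assoc, <- exp_plus.
      assert (exp (eta * ln t - t + eta * ln t + (eta * ln t + eta * ln t)) <= exp (4 * eta * ln (4 * eta) - 4 * eta)); [|lra].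
      apply exp_le_compat; generalize (ln_le_linear (4 * eta) t ltac:(lra) Ht); lra.
Qed.

Lemma Gamma_envelope_ex : exists S g, is_RInt_gen g (at_right 0) (Rbar_locally p_infty) S /\
  forall t, 0 < t -> exp ((2 * eta - 1) * ln t - t + eta * Rabs (ln t)) <= g t.
Proof.
  exists (K / eta * 1); eexists; split; [exact (is_RInt_gen_scal (V := R_NormedModule) _ (K / eta) 1 Gamma_envelope_int)|].
  intros t Ht; apply (Gamma_envelope t Ht).
Qed.

End Envelope.

(** The m-th derivative taken under the integral sign, divided by m!. *)
Definition Gamma_coef (z0 : C) (m : nat) : C :=
  RInt_gen (V := C_R_CompleteNormedModule)
    (fun t : R => Cexp ((z0 - 1) * RtoC (ln t) - RtoC t) * (RtoC (/ INR (fact m)) * RtoC (ln t) ^ m))%C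
    (at_right 0) (Rbar_locally p_infty).

Lemma RInt_gen_CIntg (Fa Fb : (R -> Prop) -> Prop) {FFa : ProperFilter Fa} {FFb : ProperFilter Fb}
  (f : R -> C) (l : C) :
  CIntg f Fa Fb l -> RInt_gen (V := C_R_CompleteNormedModule) f Fa Fb = l.
Proof.
  intro H; assert (PFa : ProperFilter' Fa) by apply Proper_StrongProper, FFa.
  assert (PFb : ProperFilter' Fb) by apply Proper_StrongProper, FFb.
  apply (is_RInt_gen_unique (V := C_R_CompleteNormedModule) f l H).
Qed.

Lemma Gamma_integrand_cont (z : C) (t : R) : 0 < t -> Ccont (fun t => Cexp ((z - 1) * RtoC (ln t) - RtoC t)) t.
Proof.
  intro Ht; apply Ccont_Cexp, Ccont_minus.
  - apply Ccont_mult; [apply Ccont_const|apply Ccont_RtoC, continuous_ln, Ht].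
  - apply Ccont_RtoC, continuous_id.
Qed.

Lemma Ccont_pow (f : R -> C) (n : nat) (x : R) : Ccont f x -> Ccont (fun t => (f t ^ n)%C) x.
Proof.
  intro H; induction n; [apply (Ccont_const 1)|].
  apply (Ccont_mult f (fun t => (f t ^ n)%C)); assumption.
Qed.

Lemma CGamma_integral (z : C) : 0 < Re z ->
  CIntg (fun t => Cexp ((z - 1) * RtoC (ln t) - RtoC t)) (at_right 0) (Rbar_locally p_infty) (CGamma z).
Proof.
  intro Hz; destruct (Gamma_envelope_ex (Re z / 2) ltac:(lra)) as (S & g & Hg & Hle).
  assert (HD : spans (at_right 0) (Rbar_locally p_infty) (fun t => 0 < t)) by (apply spans_infty; auto).
  destruct (CIntg_dominated (fun t => Cexp ((z - 1) * RtoC (ln t) - RtoC t)) g _ S HD) as [l [Hl _]];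
    [apply Gamma_integrand_cont| |exact Hg|].
  - intros t Ht; eapply Rle_trans; [|apply (Hle t Ht)].
    rewrite Cmod_Cexp; apply exp_le_compat.
    replace (Re ((z - 1) * RtoC (ln t) - RtoC t)) with ((Re z - 1) * ln t - t) by (unfold Re; simpl; ring).
    generalize (Rabs_pos (ln t)); nra.
  - replace (CGamma z) with l; [exact Hl|symmetry].
    unfold CGamma; refine (RInt_gen_CIntg _ _ _ l _); revert Hl; apply (CIntg_ext _ _ _ l HD).
    intros t Ht; rewrite Cpower_RtoC by exact Ht.
    unfold Cminus at 1; rewrite Cexp_plus, <- RtoC_opp, Cexp_RtoC; reflexivity.
Qed.

(** The factor t^(z-z0) = exp(w ln t) is expanded under the integral; its Taylor remainder of order
    N is at most q^N times an integrable function independent of N, so integration leaves an error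
    O(q^N). *)
Lemma CGamma_PSon (z0 : C) : 0 < Re z0 -> PSon CGamma z0 (Re z0 / 4) (Gamma_coef z0).
Proof.
  intro Hz0; set (x0 := Re z0) in *; set (rho := x0 / 4).
  (* Since x0/2 = 2 rho, the slack of the envelope is exp(2 rho |ln t|): one factor exp(rho |ln t|)
     is spent on exp(|v|), the other on |v|^N / N!. *)
  destruct (Gamma_envelope_ex (x0 / 2) ltac:(lra)) as (S & g & Hg & Hle).
  assert (Hrho : 0 < rho) by (unfold rho; lra).
  set (D := fun t : R => 0 < t).
  assert (HD : spans (at_right 0) (Rbar_locally p_infty) D) by (apply spans_infty; auto).
  assert (Hmod : forall (z : C) t, Cmod (Cexp ((z - 1) * RtoC (ln t) - RtoC t)) = exp ((Re z - 1) * ln t - t)).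
  { intros z t; rewrite Cmod_Cexp; f_equal; unfold Re; simpl; ring. }
  set (G := fun (z : C) (t : R) => Cexp ((z - 1) * RtoC (ln t) - RtoC t)).
  set (A := fun (m : nat) (t : R) => (G z0 t * (RtoC (/ INR (fact m)) * RtoC (ln t) ^ m))%C).
  assert (HGcont : forall z t, D t -> Ccont (G z) t) by (intros; apply Gamma_integrand_cont; assumption).
  assert (HAcont : forall m t, D t -> Ccont (A m) t).
  { intros m t Ht; apply Ccont_mult; [apply HGcont, Ht|].
    apply Ccont_mult; [apply Ccont_const|apply Ccont_pow, Ccont_RtoC, continuous_ln, Ht]. }
  assert (HA : forall m, CIntg (A m) (at_right 0) (Rbar_locally p_infty) (Gamma_coef z0 m)).
  { intro m; destruct (CIntg_dominated (A m) (fun t => / rho ^ m * g t) D (/ rho ^ m * S) HD (HAcont m)) as [l [Hl _]].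
    - intros t Ht; unfold A, G; rewrite !Cmod_mult, Hmod, Cmod_pow, !Cmod_R.
      rewrite Rabs_pos_eq by (left; apply Rinv_0_lt_compat, INR_fact_lt_0).
      generalize (Hle t Ht) (pow_fact_le_exp (rho * Rabs (ln t)) m ltac:(apply Rmult_le_pos; [lra|apply Rabs_pos])).
      rewrite Rpow_mult_distr; intros H1 H2.
      assert (Hpm : 0 < rho ^ m) by (apply pow_lt, Hrho).
      apply Rmult_le_reg_l with (rho ^ m); [exact Hpm|].
      rewrite <- Rmult_assoc with (r1 := rho ^ m) (r2 := / rho ^ m), Rinv_r, Rmult_1_l by lra.
      eapply Rle_trans; [|exact H1].
      replace (rho ^ m * (exp ((Re z0 - 1) * ln t - t) * (/ INR (fact m) * Rabs (ln t) ^ m)))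
        with (exp ((Re z0 - 1) * ln t - t) * (rho ^ m * Rabs (ln t) ^ m / INR (fact m))) by (unfold Rdiv; ring).
      apply Rle_trans with (exp ((Re z0 - 1) * ln t - t) * exp (rho * Rabs (ln t))).
      + apply Rmult_le_compat_l; [left; apply exp_pos|exact H2].
      + rewrite <- exp_plus; apply exp_le_compat; fold x0.
        generalize (Rabs_pos (ln t)); unfold rho; intro; nra.
    - apply (is_RInt_gen_scal g (/ rho ^ m) S Hg).
    - replace (Gamma_coef z0 m) with l; [exact Hl|symmetry; exact (RInt_gen_CIntg _ _ (A m) l Hl)]. }
  split; [exact Hrho|]; intros z Hz; set (w := (z - z0)%C) in *.
  set (q := Cmod w / rho).
  assert (Hw := Cmod_ge_0 w).
  assert (Hq : 0 <= q < 1).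
  { unfold q; split; [apply Rmult_le_pos; [exact Hw|left; apply Rinv_0_lt_compat; lra]|apply Rlt_div_l; lra]. }
  assert (Eq : Cmod w = q * rho) by (unfold q; field; lra).
  assert (Hrem : forall N t, D t -> Cmod (G z t - Csum (fun m => A m t * w ^ m)%C N) <= q ^ N * g t).
  { intros N t Ht; set (v := (w * RtoC (ln t))%C).
    replace (G z t) with (G z0 t * Cexp v)%C.
    2:{ unfold G, v, w; rewrite <- Cexp_plus; f_equal; ring. }
    replace (Csum (fun m => A m t * w ^ m)%C N) with (G z0 t * exp_poly N v)%C.
    2:{ unfold exp_poly; rewrite <- Csum_scal; apply Csum_ext; intros k _; unfold A, v; rewrite Cpow_mult_l; ring. }
    replace (G z0 t * Cexp v - G z0 t * exp_poly N v)%C with (G z0 t * (Cexp v - exp_poly N v))%C by ring.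
    rewrite Cmod_mult; unfold G; rewrite Hmod; fold x0.
    assert (Hv : Cmod v = q * (rho * Rabs (ln t))) by (unfold v; rewrite Cmod_mult, Cmod_R, Eq; ring).
    assert (HL : 0 <= rho * Rabs (ln t)) by (apply Rmult_le_pos; [lra|apply Rabs_pos]).
    apply Rle_trans with (exp ((x0 - 1) * ln t - t) * (exp (rho * Rabs (ln t)) * (q ^ N * exp (rho * Rabs (ln t))))).
    - apply Rmult_le_compat_l; [left; apply exp_pos|].
      eapply Rle_trans; [apply Cexp_taylor|].
      apply Rmult_le_compat; [left; apply exp_pos| | |].
      + apply Rmult_le_pos; [apply pow_le, Cmod_ge_0|left; apply Rinv_0_lt_compat, INR_fact_lt_0].
      + apply exp_le_compat; rewrite Hv; nra.
      + rewrite Hv, Rpow_mult_distr; unfold Rdiv; rewrite Rmult_assoc.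
        apply Rmult_le_compat_l; [apply pow_le; lra|apply pow_fact_le_exp, HL].
    - replace (exp ((x0 - 1) * ln t - t) * (exp (rho * Rabs (ln t)) * (q ^ N * exp (rho * Rabs (ln t)))))
        with (q ^ N * (exp ((x0 - 1) * ln t - t) * exp (rho * Rabs (ln t)) * exp (rho * Rabs (ln t)))) by ring.
      apply Rmult_le_compat_l; [apply pow_le; lra|].
      eapply Rle_trans; [|apply Hle, Ht]; rewrite <- !exp_plus; apply exp_le_compat.
      unfold rho; right; field. }
  assert (Hl : CIntg (G z) (at_right 0) (Rbar_locally p_infty) (CGamma z)).
  { apply CGamma_integral; assert (H := Rle_lt_trans _ _ _ (re_le_Cmod w) Hz).
    apply Rabs_lt_between in H; unfold w, rho, x0, Re in *; simpl in H; lra. }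
  apply Clim_squeeze with (fun N => S * q ^ N); [|apply pow_lim_0, Hq].
  intro N; rewrite Cmod_minus_sym, Rmult_comm.
  apply (CIntg_norm_le (fun t => G z t - Csum (fun m => A m t * w ^ m)%C N)%C (fun t => q ^ N * g t) D _ _ HD);
    [apply Hrem| |apply (is_RInt_gen_scal g (q ^ N) S Hg)].
  apply CIntg_minus; [exact Hl|].
  apply (CIntg_Csum (fun m t => A m t * w ^ m)%C); intros k _.
  replace (Gamma_coef z0 k * w ^ k)%C with (w ^ k * Gamma_coef z0 k)%C by ring.
  apply (CIntg_ext (fun t => w ^ k * A k t)%C _ D _ HD); [intros; ring|].
  apply CIntg_scal, HA.
Qed.

(** * The Hurwitz zeta function on the real segment 0 < s < 1 *)

(* An arbitrary value when the series diverges. *)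
Definition Cser (u : nat -> C) : C :=
  (real (Lim_seq (fun n => fst (Csum u n))), real (Lim_seq (fun n => snd (Csum u n)))).

Lemma Clim_fst (u : nat -> C) (l : C) : Clim u l -> is_lim_seq (fun n => fst (u n)) (fst l).
Proof.
  intro H; apply is_lim_seq_spec; intros e; destruct (H e (cond_pos e)) as [N HN].
  exists N; intros n Hn; eapply Rle_lt_trans; [apply (fst_Cmod_le (u n - l)%C)|auto].
Qed.

Lemma Clim_snd (u : nat -> C) (l : C) : Clim u l -> is_lim_seq (fun n => snd (u n)) (snd l).
Proof.
  intro H; apply is_lim_seq_spec; intros e; destruct (H e (cond_pos e)) as [N HN].
  exists N; intros n Hn; eapply Rle_lt_trans; [apply (snd_Cmod_le (u n - l)%C)|auto].
Qed.

Lemma Cser_eq (u : nat -> C) (l : C) : Clim (Csum u) l -> Cser u = l.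
Proof.
  intro H; unfold Cser.
  rewrite (is_lim_seq_unique _ _ (Clim_fst _ _ H)), (is_lim_seq_unique _ _ (Clim_snd _ _ H)).
  destruct l; reflexivity.
Qed.

Lemma Cser_dominated (u : nat -> C) (A : nat -> R) (S : R) :
  (forall n, Cmod (u n) <= A n) -> is_sum A S -> Clim (Csum u) (Cser u).
Proof.
  intros Hu HA; destruct (series_dominated u A S Hu HA) as [l [Hl _]].
  rewrite (Cser_eq _ _ Hl); exact Hl.
Qed.

(** Coefficients expressed by derivatives, so that those of functions merely known to have some
    expansion can be named without choosing one. *)
Definition taylor (f : C -> C) (z0 : C) (m : nat) : C := (C_derive_n m f z0 / RtoC (INR (fact m)))%C.

Lemma PSon_taylor (f : C -> C) (z0 : C) (r : R) (a : nat -> C) (m : nat) : PSon f z0 r a -> taylor f z0 m = a m.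
Proof.
  intro H; unfold taylor; rewrite (PSon_derive_n f z0 r a m H); field.
  intro E; apply RtoC_inj in E; apply (INR_fact_neq_0 _ E).
Qed.

Lemma PSon_series_taylor (f : nat -> C -> C) (z0 : C) (r S : R) (A : nat -> R) :
  (forall n, exists a, PSon (f n) z0 r a) ->
  (forall n z, Cmod (z - z0) < r -> Cmod (f n z) <= A n) -> is_sum A S ->
  PSon (fun z => Cser (fun n => f n z)) z0 r (fun m => Cser (fun n => taylor (f n) z0 m)) /\
  forall n m rho, 0 < rho < r -> Cmod (taylor (f n) z0 m) * rho ^ m <= A n.
Proof.
  intros Hf HA HS.
  assert (Hf' : forall n, PSon (f n) z0 r (taylor (f n) z0)).
  { intro n; destruct (Hf n) as [a Ha]; apply PSon_coef_ext with a; [|exact Ha].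
    intro m; symmetry; apply (PSon_taylor _ _ r), Ha. }
  assert (Hr : 0 < r) by apply (Hf' O).
  assert (HC : forall n m rho, 0 < rho < r -> Cmod (taylor (f n) z0 m) * rho ^ m <= A n).
  { intros n m rho Hrho; apply (PSon_Cauchy (f n) z0 r rho); auto. }
  split; [|exact HC].
  apply (PSon_series f _ z0 r S (fun n => taylor (f n) z0) _ A); auto.
  - intros z Hz; apply Cser_dominated with A S; auto.
  - intro m; assert (Hpm : 0 < (r / 2) ^ m) by (apply pow_lt; lra).
    apply Cser_dominated with (fun n => / (r / 2) ^ m * A n) (/ (r / 2) ^ m * S).
    + intro n; specialize (HC n m (r / 2) ltac:(lra)).
      apply Rmult_le_reg_l with ((r / 2) ^ m); [exact Hpm|].
      rewrite <- Rmult_assoc, Rinv_r by lra; lra.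
    + apply is_sum_scal; [left; apply Rinv_0_lt_compat, Hpm|exact HS].
Qed.

(** * Comparison of the zeta series with an integral *)

Definition cp (x : R) (w : C) : C := Cexp (w * RtoC (ln x)).

Lemma Cmod_cp (x : R) (w : C) : Cmod (cp x w) = Rpower x (Re w).
Proof. unfold cp, Rpower; rewrite Cmod_Cexp, re_scal_r; reflexivity. Qed.

Lemma cp_RtoC (x y : R) : cp x (RtoC y) = RtoC (Rpower x y).
Proof. unfold cp, Rpower; rewrite <- RtoC_mult, Cexp_RtoC; reflexivity. Qed.

Lemma cp_deriv (x : R) (w : C) : 0 < x -> Cderiv (fun x => cp x w) x (w * cp x (w - 1)).
Proof.
  intro Hx; unfold cp; eapply Cderiv_ext; [|apply (Cderiv_Cexp (fun x => w * RtoC (ln x))%C), Cderiv_scal, Cderiv_RtoC].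
  2:{ apply is_derive_Reals, derivable_pt_lim_ln, Hx. }
  replace ((w - 1) * RtoC (ln x))%C with (w * RtoC (ln x) + RtoC (- ln x))%C by (rewrite RtoC_opp; ring).
  rewrite Cexp_plus, Cexp_RtoC, exp_Ropp, exp_ln by exact Hx; ring.
Qed.

Lemma Rpower_antitone (c x e : R) : 0 < c <= x -> e <= 0 -> Rpower x e <= Rpower c e.
Proof.
  intros Hc He; unfold Rpower; apply exp_le_compat.
  assert (ln c <= ln x) by (apply ln_le; lra); nra.
Qed.

Lemma cp_diff (c x : R) (w : C) :
  0 < c <= x -> Re w <= 1 -> Cmod (cp x w - cp c w) <= Cmod w * Rpower c (Re w - 1) * (x - c).
Proof.
  intros Hc Hw; apply (Cderiv_le_const (fun x => cp x w) (fun x => w * cp x (w - 1))%C); [lra| |].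
  - intros y Hy; apply cp_deriv; lra.
  - intros y Hy; rewrite Cmod_mult, Cmod_cp; apply Rmult_le_compat_l; [apply Cmod_ge_0|].
    replace (Re (w - 1)) with (Re w - 1) by (unfold Re; simpl; ring); apply Rpower_antitone; lra.
Qed.

(** The integral test: by the mean value theorem kappa (n + 1 + a)^(-1-kappa) is at most a decrement
    of x^(-kappa), and the decrements telescope. The first term is set aside. *)
Lemma power_sum (a kappa : R) : 0 < a -> 0 < kappa -> exists S, is_sum (fun n => Rpower (INR n + a) (- (1 + kappa))) S.
Proof.
  intros Ha Hk.
  assert (Hpos : forall x y, 0 <= Rpower x y) by (intros; left; apply exp_pos).
  assert (Hx : forall n, 0 < INR n + a) by (intro n; generalize (pos_INR n); lra).
  assert (Hstep : forall n, kappa * Rpower (INR (S n) + a) (- (1 + kappa)) <=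
            Rpower (INR n + a) (- kappa) - Rpower (INR (S n) + a) (- kappa)).
  { intro n; rewrite S_INR; specialize (Hx n).
    destruct (MVT_gen (fun x => Rpower x (- kappa)) (INR n + a) (INR n + 1 + a) (fun x => - kappa * Rpower x (- (1 + kappa)))) as [c [Hc E]].
    - intros x H; rewrite Rmin_left, Rmax_right in H by lra.
      unfold Rpower; auto_derive; [lra|].
      replace (- (1 + kappa) * ln x) with (- kappa * ln x + - ln x) by ring.
      rewrite exp_plus, exp_Ropp with (x := ln x), exp_ln by lra; field; lra.
    - intros x H; rewrite Rmin_left, Rmax_right in H by lra; apply continuity_pt_filterlim.
      apply (ex_derive_continuous (K := R_AbsRing) (V := R_NormedModule) (fun x => Rpower x (- kappa)) x); unfold Rpower; auto_derive; lra.
    - rewrite Rmin_left, Rmax_right in Hc by lra.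
      generalize (Rpower_antitone c (INR n + 1 + a) (- (1 + kappa)) ltac:(lra) ltac:(lra)); nra. }
  apply is_sum_bounded with (Rpower a (- (1 + kappa)) + Rpower a (- kappa) / kappa); [auto|].
  intros [|n]; [simpl; apply Rplus_le_le_0_compat; [auto|]; apply Rmult_le_pos; [auto|left; apply Rinv_0_lt_compat, Hk]|].
  change (S n) with (1 + n)%nat; rewrite Rsum_app; simpl Rsum at 1; rewrite !Rplus_0_l.
  apply Rplus_le_compat_l, Rle_div_r; [exact Hk|]; rewrite Rmult_comm, <- Rsum_scal.
  eapply Rle_trans; [apply Rsum_le; intros k _; apply (Hstep k)|].
  rewrite (Rsum_telescope (fun k => Rpower (INR k + a) (- kappa))); simpl (INR 0); rewrite Rplus_0_l.
  generalize (Hpos (INR n + a) (- kappa)); lra.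
Qed.

(* (1 - z) (x^(-z) - int_x^(x+1) t^(-z) dt): summed over x = n + a, this continues (1 - z) zeta(z, a) to 0 < Re z. *)
Definition zq (x : R) (z : C) : C := ((1 - z) * cp x (- z) - cp (x + 1) (1 - z) + cp x (1 - z))%C.

(** Subtracting the integral gains one order of decay, from c^(-Re z) to c^(-1-Re z), which moves
    the abscissa of convergence from 1 to 0. Up to sign [zq c z] is the increment of [F] on
    [c, c + 1], and F' is (1 - z)(x^(-z) - c^(-z)). *)
Lemma zq_bound (c : R) (z : C) : 0 < c -> 0 <= Re z -> Cmod (zq c z) <= Cmod (1 - z) * Cmod z * Rpower c (- (1 + Re z)).
Proof.
  intros Hc Hz.
  set (F := fun x => (cp x (1 - z) - RtoC x * ((1 - z) * cp c (- z)))%C).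
  replace (zq c z) with (- (F (c + 1)%R - F c))%C by (unfold zq, F; rewrite RtoC_plus; ring).
  rewrite Cmod_opp.
  replace (Cmod (1 - z) * Cmod z * Rpower c (- (1 + Re z)))
    with (Cmod (1 - z) * Cmod z * Rpower c (- (1 + Re z)) * (c + 1 - c)) by ring.
  apply (Cderiv_le_const F (fun x => (1 - z) * (cp x (- z) - cp c (- z)))%C); [lra| |].
  - intros x Hx; apply Cderiv_ext with ((1 - z) * cp x (1 - z - 1) - (1 - z) * cp c (- z))%C.
    + replace (1 - z - 1)%C with (- z)%C by ring; ring.
    + apply (Cderiv_minus (fun x => cp x (1 - z))); [apply cp_deriv; lra|apply Cderiv_scal_l].
  - intros x Hx; rewrite Cmod_mult, Rmult_assoc; apply Rmult_le_compat_l; [apply Cmod_ge_0|].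
    eapply Rle_trans; [apply cp_diff; [lra|]; unfold Re in *; simpl; lra|].
    rewrite Cmod_opp.
    replace (Re (- z) - 1) with (- (1 + Re z)) by (unfold Re; simpl; ring).
    rewrite <- (Rmult_1_r (Cmod z * Rpower c (- (1 + Re z)))) at 2.
    apply Rmult_le_compat_l; [|lra].
    apply Rmult_le_pos; [apply Cmod_ge_0|left; apply exp_pos].
Qed.

Lemma Re_dist_le (z z0 : C) (r : R) : Cmod (z - z0) < r -> Re z0 - r < Re z < Re z0 + r.
Proof.
  intro H; generalize (Rle_lt_trans _ _ _ (re_le_Cmod (z - z0)%C) H); intro H'.
  apply Rabs_lt_between in H'; unfold Re in *; simpl in H'; lra.
Qed.

Lemma Cmod_dist_le (z z0 : C) (r : R) : Cmod (z - z0) < r -> Cmod z <= Cmod z0 + r.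
Proof. intro H; generalize (Cmod_minus_ge z z0); lra. Qed.

Lemma PSon_cp (x : R) (b : C) (z0 : C) (r : R) : 0 < r ->
  exists a, PSon (fun z => cp x (b - z)) z0 r a.
Proof.
  intro Hr; eexists; eapply PSon_ext; [|apply (PSon_Cexp_lin (- RtoC (ln x)) (b * RtoC (ln x)) z0 r Hr)].
  intros z _; unfold cp; f_equal; ring.
Qed.

Lemma zq_PSon (x : R) (z0 : C) (r : R) : 0 < r -> exists a, PSon (zq x) z0 r a.
Proof.
  intro Hr.
  destruct (PSon_cp x 0 z0 r Hr) as [a1 H1]; destruct (PSon_cp (x + 1) 1 z0 r Hr) as [a2 H2];
    destruct (PSon_cp x 1 z0 r Hr) as [a3 H3].
  eexists; eapply PSon_ext; [|apply PSon_plus; [apply PSon_minus; [apply PSon_mult;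
    [apply PSon_minus; [apply (PSon_const 1), Hr|apply PSon_id, Hr]|exact H1]|exact H2]|exact H3]].
  intros z _; cbv beta; unfold zq; replace (0 - z)%C with (- z)%C by ring; ring.
Qed.

Lemma zq_series_dominated (a : R) (z0 : C) : 0 < a -> 0 < Re z0 ->
  exists A S, is_sum A S /\ forall n z, Cmod (z - z0) < Re z0 / 2 -> Cmod (zq (INR n + a) z) <= A n.
Proof.
  intros Ha Hz0; set (r := Re z0 / 2).
  destruct (power_sum a r Ha ltac:(unfold r; lra)) as [S HS].
  (* The exponential allows the exponent 1 + Re z to be replaced by 1 + r even where [INR n + a] is
     below 1: there -ln(INR n + a) <= |ln a|, and 0 <= Re z - r <= 2 r. *)
  set (B := (1 + (Cmod z0 + r)) * (Cmod z0 + r) * exp (2 * r * Rabs (ln a))).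
  assert (Hr : 0 < r) by (unfold r; lra).
  assert (Hc := Cmod_ge_0 z0).
  assert (HB : 0 <= B) by (unfold B; apply Rmult_le_pos; [apply Rmult_le_pos; lra|left; apply exp_pos]).
  exists (fun n => B * Rpower (INR n + a) (- (1 + r))), (B * S).
  split; [apply is_sum_scal; assumption|].
  intros n z Hz; fold r in Hz.
  assert (Hn := pos_INR n).
  generalize (Re_dist_le _ _ _ Hz) (Cmod_dist_le _ _ _ Hz); intros HR HM.
  eapply Rle_trans; [apply zq_bound; [lra|unfold r in *; lra]|].
  unfold B; rewrite Rmult_assoc.
  apply Rle_trans with ((1 + (Cmod z0 + r)) * ((Cmod z0 + r) * (exp (2 * r * Rabs (ln a)) * Rpower (INR n + a) (- (1 + r))))); [|right; ring].
  apply Rmult_le_compat; [apply Cmod_ge_0| | |].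
  - apply Rmult_le_pos; [apply Cmod_ge_0|left; apply exp_pos].
  - eapply Rle_trans; [apply Cmod_minus_le|]; rewrite Cmod_1; lra.
  - apply Rmult_le_compat; [apply Cmod_ge_0|left; apply exp_pos|lra|].
    unfold Rpower; rewrite <- exp_plus; apply exp_le_compat.
    assert (H1 : - ln (INR n + a) <= Rabs (ln a)).
    { assert (ln a <= ln (INR n + a)) by (apply ln_le; lra).
      generalize (Rle_abs (- ln a)); rewrite Rabs_Ropp; lra. }
    assert (H2 := Rabs_pos (ln a)).
    assert (0 <= Re z - r <= 2 * r) by (unfold r in *; lra).
    generalize (Rmult_le_compat_l (Re z - r) _ _ ltac:(lra) H1) (Rmult_le_compat_r (Rabs (ln a)) (Re z - r) (2 * r) H2 ltac:(lra)); lra.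
Qed.

Definition zQ (a : R) (z : C) : C := Cser (fun n => zq (INR n + a) z).

Lemma zQ_analytic (a : R) (z0 : C) : 0 < a -> 0 < Re z0 -> analytic_at (zQ a) z0.
Proof.
  intros Ha Hz0; destruct (zq_series_dominated a z0 Ha Hz0) as (A & S & HS & HA).
  apply analytic_at_PSon; exists (Re z0 / 2); eexists.
  apply (PSon_series_taylor (fun n => zq (INR n + a)) z0 (Re z0 / 2) S A); auto.
  intro n; apply zq_PSon; lra.
Qed.

Lemma zQ_lim (a : R) (z : C) : 0 < a -> 0 < Re z -> Clim (Csum (fun n => zq (INR n + a) z)) (zQ a z).
Proof.
  intros Ha Hz; destruct (zq_series_dominated a z Ha Hz) as (A & S & HS & HA).
  apply Cser_dominated with A S; [|exact HS]; intro n; apply HA.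
  replace (z - z)%C with (RtoC 0) by ring; rewrite Cmod_0; lra.
Qed.

Lemma Csum_zq (a : R) (z : C) (N : nat) :
  Csum (fun n => zq (INR n + a) z) N =
  ((1 - z) * Csum (fun n => cp (INR n + a) (- z)) N - cp (INR N + a) (1 - z) + cp a (1 - z))%C.
Proof.
  induction N; [simpl; rewrite Rplus_0_l; ring|].
  cbn [Csum]; rewrite IHN; unfold zq; rewrite S_INR.
  replace (INR N + 1 + a) with (INR N + a + 1) by ring; ring.
Qed.

Lemma cp_lim_0 (a : R) (w : C) : 0 < a -> Re w < 0 -> Clim (fun N => cp (INR N + a) w) 0.
Proof.
  intros Ha Hw e He.
  destruct (INR_unbounded (exp (ln e / Re w))) as [N HN]; exists N; intros n Hn.
  rewrite Cminus_0_r, Cmod_cp; unfold Rpower; rewrite <- (exp_ln e) by exact He.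
  apply exp_increasing.
  assert (HNn : INR N <= INR n) by (apply le_INR, Hn).
  assert (H : ln e / Re w < ln (INR n + a)).
  { rewrite <- (ln_exp (ln e / Re w)); apply ln_increasing; [apply exp_pos|lra]. }
  apply (Rmult_lt_gt_compat_neg_l (Re w)) in H; [|exact Hw].
  replace (Re w * (ln e / Re w)) with (ln e) in H by (field; lra); lra.
Qed.

(** The subtracted integrals telescope, and the upper boundary term (N + a)^(1-z) tends to 0 because
    1 < Re z. *)
Lemma zeta_zQ_right (zeta : C -> R -> C) (a : R) (z : C) : is_Hurwitz_zeta zeta -> 0 < a -> 1 < Re z ->
  ((1 - z) * zeta z a)%C = (zQ a z - cp a (1 - z))%C.
Proof.
  intros Hzeta Ha Hz; destruct (Hzeta a Ha) as [Hs _]; specialize (Hs z Hz); apply is_series_Clim in Hs.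
  assert (H1 := zQ_lim a z Ha ltac:(lra)).
  assert (Hs' : Clim (Csum (fun n => cp (INR n + a) (- z))) (zeta z a)).
  { eapply Clim_ext; [|exact Hs]; intro n; apply Csum_ext; intros k _.
    apply Cpower_RtoC; generalize (pos_INR k); lra. }
  assert (H2 : Clim (Csum (fun n => zq (INR n + a) z)) ((1 - z) * zeta z a - 0 + cp a (1 - z))%C).
  { eapply Clim_ext; [intro n; symmetry; apply Csum_zq|].
    apply Clim_plus; [|apply Clim_const]; apply Clim_minus; [apply Clim_scal, Hs'|].
    apply cp_lim_0; [exact Ha|unfold Re in *; simpl; lra]. }
  rewrite (Clim_unique _ _ _ H1 H2); ring.
Qed.

(** Continuation from the half-plane of convergence along a segment that bypasses the pole at 1. *)
Lemma zeta_zQ_real (zeta : C -> R -> C) (a s : R) : is_Hurwitz_zeta zeta -> 0 < a -> 0 < s < 1 ->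
  ((1 - s) * zeta s a)%C = (zQ a s - cp a (1 - s))%C.
Proof.
  intros Hzeta Ha Hs.
  set (g := fun z => ((1 - z) * zeta z a - (zQ a z - cp a (1 - z)))%C).
  enough (E : g (RtoC s) = RtoC 0) by (apply Ceq_minus; exact E).
  (* The segment from 2 + i to s has imaginary part 1 - t, so it meets the real axis only at s; its
     real part exceeds 1 while t < 1/2. *)
  set (z0 := (2, 1) : C); set (d := (s - 2, -1) : C).
  replace (RtoC s) with (z0 + d)%C by (apply injective_projections; unfold z0, d; simpl; ring).
  apply identity_segment with (1 / 2); [| |lra|].
  - intro E; apply (f_equal fst) in E; unfold d in E; simpl in E; lra.
  - intros t Ht.
    assert (ER : Re (z0 + RtoC t * d)%C = 2 + t * (s - 2)) by (unfold Re, z0, d; simpl; ring).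
    assert (EI : Im (z0 + RtoC t * d)%C = 1 - t) by (unfold Im, z0, d; simpl; ring).
    set (z := (z0 + RtoC t * d)%C) in *.
    assert (HR : 0 < Re z) by (rewrite ER; nra).
    assert (Hz1 : z <> RtoC 1).
    { intro E; rewrite E in ER, EI; simpl in ER, EI; assert (t = 1) by lra; subst t; lra. }
    apply analytic_at_minus; [apply analytic_at_mult; [apply analytic_at_minus; [apply (analytic_at_const 1)|apply analytic_at_id]|]|].
    + apply (Hzeta a Ha), Hz1.
    + apply analytic_at_minus; [apply zQ_analytic; assumption|].
      destruct (PSon_cp a 1 z 1 Rlt_0_1) as [b Hb]; apply analytic_at_PSon; eauto.
  - intros t Ht; unfold g; rewrite (zeta_zQ_right zeta); auto; [ring|].
    unfold Re, z0, d; simpl; nra.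
Qed.

(** For 0 < s < 1 the partial sums grow like N^(1-s) / (1 - s); removing this term leaves a sequence
    that converges to zeta(s, x). *)
Definition zPhi (s : R) (N : nat) (x : R) : C :=
  (Csum (fun n => cp (INR n + x) (- s)) N - cp (INR N + x) (1 - s) / (1 - s))%C.

Lemma one_minus_nz (s : R) : s < 1 -> (1 - RtoC s)%C <> RtoC 0.
Proof. intros Hs; rewrite <- RtoC_minus; intro E; apply RtoC_inj in E; lra. Qed.

Lemma zPhi_zq (s x : R) (N : nat) : s < 1 ->
  zPhi s N x = (/ (1 - s) * (Csum (fun n => zq (INR n + x) s) N - cp x (1 - s)))%C.
Proof. intro Hs; rewrite Csum_zq; unfold zPhi; field; apply one_minus_nz, Hs. Qed.

Lemma zeta_real_lim (zeta : C -> R -> C) (a s : R) : is_Hurwitz_zeta zeta -> 0 < a -> 0 < s < 1 ->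
  Clim (fun N => zPhi s N a) (zeta (RtoC s) a).
Proof.
  intros Hzeta Ha Hs; assert (Hn := one_minus_nz s ltac:(lra)).
  replace (zeta (RtoC s) a) with (/ (1 - RtoC s) * (zQ a s - cp a (1 - s)))%C.
  - eapply Clim_ext; [intro N; symmetry; apply zPhi_zq; lra|].
    apply Clim_scal, Clim_minus; [|apply Clim_const].
    apply zQ_lim; [exact Ha|simpl; lra].
  - rewrite <- (zeta_zQ_real zeta a s Hzeta Ha Hs); field; exact Hn.
Qed.

(** * Rotation of the contour: Fourier transform of a power *)

Lemma is_derive_quadratic (f : R -> R) (x l K d : R) : 0 < d ->
  (forall h, Rabs h < d -> Rabs (f (x + h) - f x - h * l) <= K * h ^ 2) -> is_derive f x l.
Proof.
  intros Hd H; apply is_derive_Reals; intros e He.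
  assert (HK := Rabs_pos K).
  assert (Hm : 0 < Rmin d (e / (Rabs K + 1))) by (apply Rmin_pos; [exact Hd|apply Rdiv_lt_0_compat; lra]).
  exists (mkposreal _ Hm); intros h Hh0 Hh; simpl in Hh.
  assert (Hh1 := Rlt_le_trans _ _ _ Hh (Rmin_l _ _)); assert (Hh2 := Rlt_le_trans _ _ _ Hh (Rmin_r _ _)).
  replace ((f (x + h) - f x) / h - l) with ((f (x + h) - f x - h * l) / h) by (field; exact Hh0).
  assert (Hp := Rabs_pos_lt h Hh0).
  unfold Rdiv; rewrite Rabs_mult, Rabs_inv.
  apply Rlt_div_l; [exact Hp|]; eapply Rle_lt_trans; [apply H, Hh1|].
  rewrite <- (pow2_abs h); simpl; rewrite Rmult_1_r.
  apply Rle_lt_trans with (Rabs K * Rabs h * Rabs h).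
  - rewrite <- Rmult_assoc; apply Rmult_le_compat_r; [lra|]; apply Rmult_le_compat_r; [lra|apply Rle_abs].
  - apply Rmult_lt_compat_r; [exact Hp|].
    apply Rle_lt_trans with (Rabs K * (e / (Rabs K + 1))); [apply Rmult_le_compat_l; lra|].
    replace (Rabs K * (e / (Rabs K + 1))) with (e * (Rabs K / (Rabs K + 1))) by (field; lra).
    rewrite <- (Rmult_1_r e) at 2; apply Rmult_lt_compat_l; [exact He|]; apply Rlt_div_l; lra.
Qed.

Lemma Cderiv_quadratic (F : R -> C) (x : R) (l : C) (K d : R) : 0 < d ->
  (forall h, Rabs h < d -> Cmod (F (x + h)%R - F x - RtoC h * l) <= K * h ^ 2) -> Cderiv F x l.
Proof.
  intros Hd H; split; apply is_derive_quadratic with K d; try exact Hd; intros h Hh; (eapply Rle_trans; [|apply (H h Hh)]).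
  - eapply Rle_trans; [|apply fst_Cmod_le]; right; simpl; f_equal; ring.
  - eapply Rle_trans; [|apply snd_Cmod_le]; right; simpl; f_equal; ring.
Qed.

(** The mean value inequality is applied to F', and then to F(t) - t F'(x). *)
Lemma Cderiv_second_order (F F' F'' : R -> C) (B x h : R) :
  (forall t, Rmin x (x + h) <= t <= Rmax x (x + h) -> Cderiv F t (F' t) /\ Cderiv F' t (F'' t) /\ Cmod (F'' t) <= B) ->
  Cmod (F (x + h)%R - F x - RtoC h * F' x) <= B * h ^ 2.
Proof.
  intros H.
  set (lo := Rmin x (x + h)) in *; set (hi := Rmax x (x + h)) in *.
  assert (Hx : lo <= x <= hi) by (split; [apply Rmin_l|apply Rmax_l]).
  assert (Hxh : lo <= x + h <= hi) by (split; [apply Rmin_r|apply Rmax_r]).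
  assert (HB0 : 0 <= B) by (eapply Rle_trans; [apply Cmod_ge_0|apply (H x Hx)]).
  assert (HL : forall a b, lo <= a <= b -> b <= hi -> Cmod (F' b - F' a) <= B * (b - a)).
  { intros a b Hab Hb; apply (Cderiv_le_const F' F''); [lra| |]; intros; apply H; lra. }
  set (G := fun t => (F t - RtoC t * F' x)%C).
  replace (F (x + h)%R - F x - RtoC h * F' x)%C with (G (x + h)%R - G x)%C by (unfold G; rewrite RtoC_plus; ring).
  assert (HG : forall t, lo <= t <= hi -> Cderiv G t (F' t - F' x)%C).
  { intros; apply Cderiv_minus; [apply H; assumption|apply Cderiv_scal_l]. }
  destruct (Rle_lt_dec 0 h) as [h0|h0].
  - replace (B * h ^ 2) with (B * h * (x + h - x)) by ring.
    apply (Cderiv_le_const G (fun t => F' t - F' x)%C); [lra|intros; apply HG; lra|].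
    intros t Ht; eapply Rle_trans; [apply HL; lra|]; apply Rmult_le_compat_l; lra.
  - rewrite Cmod_minus_sym; replace (B * h ^ 2) with (B * (- h) * (x - (x + h))) by ring.
    apply (Cderiv_le_const G (fun t => F' t - F' x)%C); [lra|intros; apply HG; lra|].
    intros t Ht; rewrite Cmod_minus_sym; eapply Rle_trans; [apply HL; lra|]; apply Rmult_le_compat_l; lra.
Qed.

Section Rotation.

Variables (s e : R).
Hypothesis (Hs : 0 < s < 1) (He : e * e = 1).

(* w^(-s) exp(-w) dw/dx along the ray w = x exp(i e th) *)
Let phase th : C := RtoC (e * th) * Ci.
Let K (x th : R) : C := Cexp (RtoC (1 - s) * phase th - RtoC (s * ln x) - RtoC x * Cexp (phase th)).

Let Kth (x th : R) : C := (RtoC e * Ci * (RtoC (1 - s) - RtoC x * Cexp (phase th)) * K x th)%C.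

Lemma phase_deriv th : Cderiv phase th (RtoC e * Ci)%C.
Proof.
  unfold phase; eapply Cderiv_ext; [|apply Cderiv_mult; [apply Cderiv_RtoC|apply Cderiv_const]].
  2:{ apply (is_derive_scal (fun t => t)), is_derive_id. }
  unfold one; simpl; rewrite Rmult_1_r; ring.
Qed.

Lemma K_deriv_th x th : Cderiv (K x) th (Kth x th).
Proof.
  unfold Kth, K; eapply Cderiv_ext; [|apply Cderiv_Cexp, Cderiv_minus; [apply Cderiv_minus; [apply Cderiv_scal, phase_deriv|apply Cderiv_const]|apply Cderiv_scal, Cderiv_Cexp, phase_deriv]].
  cbv beta; ring.
Qed.

Lemma Kth_deriv_th x th :
  Cderiv (Kth x) th (RtoC e * Ci * (RtoC (1 - s) - RtoC x * Cexp (phase th)) * Kth x th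
                      + RtoC x * Cexp (phase th) * K x th)%C.
Proof.
  unfold Kth at 1; eapply Cderiv_ext; [|apply (Cderiv_mult (fun th => RtoC e * Ci * (RtoC (1 - s) - RtoC x * Cexp (phase th)))%C (K x));
    [apply Cderiv_scal, Cderiv_minus; [apply Cderiv_const|apply Cderiv_scal, Cderiv_Cexp, phase_deriv]|apply K_deriv_th]].
  assert (E : (RtoC e * RtoC e)%C = RtoC 1) by (rewrite <- RtoC_mult, He; reflexivity).
  assert (Ei : (Ci * Ci)%C = RtoC (-1)) by (apply injective_projections; simpl; ring).
  replace (RtoC e * Ci * (0 - RtoC x * (RtoC e * Ci * Cexp (phase th))) * K x th)%C
    with (- (RtoC e * RtoC e) * (Ci * Ci) * (RtoC x * Cexp (phase th)) * K x th)%C by ring.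
  rewrite E, Ei; ring.
Qed.

Lemma Cmod_phase th : Cmod (Cexp (phase th)) = 1.
Proof. unfold phase; rewrite Cmod_Cexp, re_mult_Ci; simpl; rewrite Ropp_0; apply exp_0. Qed.

Lemma Cmod_K x th : Cmod (K x th) = exp (- s * ln x - x * cos (e * th)).
Proof.
  unfold K; rewrite Cmod_Cexp; f_equal.
  unfold phase, Cexp, Ci, RtoC, Re, Im; simpl.
  replace (e * th * 0 - 0 * 1) with 0 by ring; replace (e * th * 1 + 0 * 0) with (e * th) by ring.
  rewrite exp_0; ring.
Qed.

Lemma Rabs_e : Rabs e = 1.
Proof.
  assert (H : Rabs e * Rabs e = 1) by (rewrite <- Rabs_mult, He; apply Rabs_R1).
  generalize (Rabs_pos e); nra.
Qed.

Lemma cos_e th : cos (e * th) = cos th.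
Proof.
  assert (H : (e - 1) * (e + 1) = 0) by lra; apply Rmult_integral in H; destruct H as [H|H].
  - f_equal; nra.
  - replace (e * th) with (- th) by nra; apply cos_neg.
Qed.

Lemma K_cont th x : 0 < x -> Ccont (fun x => K x th) x.
Proof.
  intro Hx; unfold K; apply Ccont_Cexp, Ccont_minus; [apply Ccont_minus; [apply Ccont_const|]|].
  - apply Ccont_RtoC, (continuous_scal_r (K := R_AbsRing) (V := R_NormedModule) s ln), continuous_ln, Hx.
  - apply Ccont_mult; [apply Ccont_RtoC, continuous_id|apply Ccont_const].
Qed.

(** The Cauchy-Riemann equation in polar form: the derivative of [K] in the angle equals i e times
    the derivative of x K in x. The integral along the ray therefore varies with the angle only
    through boundary terms, which are the integrands on the two arcs. *)
Lemma Kth_int a b th : 0 < a <= b ->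
  CInt (fun x => Kth x th) a b (RtoC e * Ci * (RtoC b * K b th - RtoC a * K a th))%C.
Proof.
  intro Hab.
  replace (RtoC e * Ci * (RtoC b * K b th - RtoC a * K a th))%C
    with (RtoC e * Ci * (RtoC b * K b th) - RtoC e * Ci * (RtoC a * K a th))%C by ring.
  apply (CInt_Cderiv (fun x => RtoC e * Ci * (RtoC x * K x th))%C); intros x Hx; rewrite Rmin_left, Rmax_right in Hx by lra.
  - unfold Kth, K.
    eapply Cderiv_ext; [|apply Cderiv_scal, (Cderiv_mult RtoC); [apply Cderiv_RtoC, is_derive_id|]].
    2:{ apply Cderiv_Cexp, Cderiv_minus; [apply Cderiv_minus; [apply Cderiv_const|]|apply Cderiv_scal_l].
        apply Cderiv_RtoC, (is_derive_scal ln), is_derive_Reals, derivable_pt_lim_ln; lra. }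
    unfold one; simpl; rewrite (RtoC_mult s (/ x)), (RtoC_inv x), RtoC_minus by lra; field.
    intro E; apply RtoC_inj in E; lra.
  - unfold Kth; apply Ccont_mult; [|apply K_cont; lra].
    apply Ccont_mult; [apply Ccont_const|]; apply Ccont_minus; [apply Ccont_const|].
    apply Ccont_mult; [apply Ccont_RtoC, continuous_id|apply Ccont_const].
Qed.

(** Differentiation under the integral: the second-order remainder in the angle is bounded uniformly
    for x in [a, b]. *)
Lemma K_int_deriv a b (I : R -> C) : 0 < a <= b -> (forall th, CInt (fun x => K x th) a b (I th)) ->
  forall th, Cderiv I th (RtoC e * Ci * (RtoC b * K b th - RtoC a * K a th))%C.
Proof.
  intros Hab HI th.
  set (M := exp (s * Rabs (ln a) + s * Rabs (ln b) + b)).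
  (* Bound for the second derivative of [K x] in the angle; M bounds [K], and 1 + b bounds its
     logarithmic derivative. *)
  set (B := (1 + b) * ((1 + b) * M) + b * M).
  assert (HM : forall x t, a <= x <= b -> Cmod (K x t) <= M).
  { intros x t Hx; rewrite Cmod_K; apply exp_le_compat.
    generalize (COS_bound (e * t)); intro.
    assert (ln a <= ln x) by (apply ln_le; lra).
    generalize (Rle_abs (- ln a)) (Rabs_pos (ln b)); rewrite Rabs_Ropp; intros; nra. }
  assert (HM0 : 0 <= M) by (left; apply exp_pos).
  assert (HF : forall x t, a <= x <= b -> Cmod (RtoC e * Ci * (RtoC (1 - s) - RtoC x * Cexp (phase t))) <= 1 + b).
  { intros x t Hx; rewrite !Cmod_mult, Cmod_Ci, Cmod_R, Rabs_e, !Rmult_1_l.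
    eapply Rle_trans; [apply Cmod_minus_le|]; rewrite Cmod_mult, Cmod_phase, !Cmod_R, !Rabs_pos_eq; lra. }
  apply Cderiv_quadratic with (B * (b - a)) 1; [lra|]; intros h _.
  replace (B * (b - a) * h ^ 2) with ((B * h ^ 2) * (b - a)) by ring.
  apply (CInt_norm_const (fun x => K x (th + h)%R - K x th - RtoC h * Kth x th)%C); [lra| |].
  - intros x Hx; eapply (Cderiv_second_order (K x) (Kth x) _ B th h).
    intros t _; split; [apply K_deriv_th|split; [apply Kth_deriv_th|]]; eapply Rle_trans; [apply Cmod_triangle|]; unfold B; apply Rplus_le_compat.
    + rewrite Cmod_mult; apply Rmult_le_compat; try apply Cmod_ge_0; [apply HF, Hx|].
      unfold Kth; rewrite Cmod_mult; apply Rmult_le_compat; try apply Cmod_ge_0; [apply HF, Hx|apply HM, Hx].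
    + rewrite !Cmod_mult, Cmod_phase, Cmod_R, Rabs_pos_eq, Rmult_1_r by lra.
      apply Rmult_le_compat; [lra|apply Cmod_ge_0|lra|apply HM, Hx].
  - apply CInt_minus; [apply CInt_minus; apply HI|apply CInt_scal, Kth_int, Hab].
Qed.

(** The contributions of the arcs of radii a and b. For 0 < s < 1 they vanish as a tends to 0 and b
    to infinity. *)
Lemma rotation_bound a b (I : R -> C) : 0 < a <= b -> (forall th, CInt (fun x => K x th) a b (I th)) ->
  Cmod (I (PI / 2) - I 0) <= 2 * Rpower a (1 - s) + 3 * Rpower b (- s).
Proof.
  intros Hab HI.
  assert (HPI := PI_4); assert (HP0 := PI_RGT_0).
  set (V := fun x th => x * exp (- s * ln x - x * cos th)).
  assert (HV : forall x th, 0 < x -> Cmod (RtoC x * K x th) = V x th).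
  { intros x th Hx; unfold V; rewrite Cmod_mult, Cmod_R, Cmod_K, cos_e, Rabs_pos_eq by lra; reflexivity. }
  assert (HA : forall x, 0 < x -> x * exp (- s * ln x) = Rpower x (1 - s)).
  { intros x Hx; unfold Rpower; rewrite <- (exp_ln x) at 1 by exact Hx; rewrite <- exp_plus; f_equal; ring. }
  (* On the large arc b sin th exp(-b cos th) is an exact derivative, and the summand 1 in [dg]
     absorbs the part with the cosine. The constants 2 and 3 come from pi/2 <= 2 and 1 + pi/2 <=
     3. *)
  set (g := fun th => Rpower a (1 - s) * th + Rpower b (- s) * (exp (- b * cos th) + th)).
  set (dg := fun th => Rpower a (1 - s) + Rpower b (- s) * (b * sin th * exp (- b * cos th) + 1)).
  apply Rle_trans with (g (PI / 2) - g 0).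
  - apply (Cderiv_le I (fun th => RtoC e * Ci * (RtoC b * K b th - RtoC a * K a th))%C g dg); [lra| | |].
    + intros th _; apply (K_int_deriv a b); assumption.
    + intros th _; unfold g, dg; auto_derive; [exact Logic.I|ring].
    + intros th Hth; rewrite !Cmod_mult, Cmod_Ci, Cmod_R, Rabs_e, !Rmult_1_l.
      eapply Rle_trans; [apply Cmod_minus_le|]; rewrite !HV by lra; unfold dg, V; rewrite Rplus_comm.
      assert (Hc : 0 <= cos th) by (apply cos_ge_0; lra).
      assert (Hsn : 0 <= sin th) by (apply sin_ge_0; lra).
      apply Rplus_le_compat.
      * rewrite <- HA by lra; apply Rmult_le_compat_l; [lra|]; apply exp_le_compat; nra.
      * replace (b * exp (- s * ln b - b * cos th)) with (Rpower b (- s) * (b * exp (- b * cos th))).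
        2:{ unfold Rpower; rewrite <- Rmult_assoc, (Rmult_comm _ b), Rmult_assoc, <- exp_plus; f_equal; f_equal; ring. }
        apply Rmult_le_compat_l; [left; apply exp_pos|].
        (* 1 <= sin + cos, and (b cos) exp(-b cos) <= 1 *)
        set (E := exp (- b * cos th)); assert (HE : 0 < E) by apply exp_pos.
        assert (H1 : 1 <= sin th + cos th).
        { assert (1 <= (sin th + cos th) * (sin th + cos th)); [|nra].
          generalize (sin2_cos2 th); unfold Rsqr; nra. }
        assert (H2 : b * cos th * E <= 1).
        { assert (Hx := exp_ineq1_le (b * cos th)).
          assert (HE' : E * exp (b * cos th) = 1) by (unfold E; rewrite <- exp_plus, <- exp_0; f_equal; ring).
          rewrite <- HE'; nra. }
        assert (b * E <= b * E * (sin th + cos th)); [|lra].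
        rewrite <- (Rmult_1_r (b * E)) at 1; apply Rmult_le_compat_l; [nra|exact H1].
  - unfold g; rewrite cos_PI2, cos_0, !Rmult_0_r, exp_0.
    assert (H1 := exp_pos (- b * 1)).
    assert (H2 : 0 < Rpower a (1 - s)) by apply exp_pos; assert (H3 : 0 < Rpower b (- s)) by apply exp_pos.
    nra.
Qed.

Lemma K_at_0 x : K x 0 = (cp x (- s) * Cexp (- x))%C.
Proof.
  unfold K, phase, cp; rewrite Rmult_0_r; replace (0 * Ci)%C with (RtoC 0) by ring.
  rewrite Cexp_0, <- Cexp_plus; f_equal; rewrite RtoC_mult; ring.
Qed.

Lemma K_at_PI2 x :
  K x (PI / 2) = (Cexp (RtoC (1 - s) * (RtoC (e * (PI / 2)) * Ci)) * (cp x (- s) * Cexp (- (RtoC (e * x) * Ci))))%C.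
Proof.
  assert (E : Cexp (phase (PI / 2)) = (RtoC e * Ci)%C).
  { unfold phase, Cexp, Ci, RtoC, Re, Im; simpl.
    replace (e * (PI / 2) * 0 - 0 * 1) with 0 by ring; replace (e * (PI / 2) * 1 + 0 * 0) with (e * (PI / 2)) by ring.
    rewrite exp_0, cos_e, cos_PI2.
    assert (Hsin : sin (e * (PI / 2)) = e).
    { assert (H : (e - 1) * (e + 1) = 0) by lra; apply Rmult_integral in H; destruct H as [H|H].
      - replace e with 1 by lra; rewrite Rmult_1_l; apply sin_PI2.
      - replace e with (-1) by lra; replace (-1 * (PI / 2)) with (- (PI / 2)) by ring; rewrite sin_neg, sin_PI2; ring. }
    rewrite Hsin; apply injective_projections; simpl; ring. }
  unfold K; rewrite E; unfold phase, cp; rewrite <- !Cexp_plus; f_equal; rewrite !RtoC_mult; ring.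
Qed.

Lemma rotation a b l0 l1 : 0 < a <= b ->
  CInt (fun x => cp x (- s) * Cexp (- x))%C a b l0 ->
  CInt (fun x => cp x (- s) * Cexp (- (RtoC (e * x) * Ci)))%C a b l1 ->
  Cmod (Cexp (RtoC (1 - s) * (RtoC (e * (PI / 2)) * Ci)) * l1 - l0) <= 2 * Rpower a (1 - s) + 3 * Rpower b (- s).
Proof.
  intros Hab H0 H1.
  set (I := fun th => @RInt C_R_CompleteNormedModule (fun x => K x th) a b).
  assert (HI : forall th, CInt (fun x => K x th) a b (I th)).
  { intro th; apply (RInt_correct (V := C_R_CompleteNormedModule)).
    apply (ex_RInt_continuous (V := C_R_CompleteNormedModule)); intros x Hx.
    rewrite Rmin_left, Rmax_right in Hx by lra; apply K_cont; lra. }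
  replace l0 with (I 0); [replace (_ * l1)%C with (I (PI / 2)); [apply rotation_bound; assumption|]|].
  - apply (CInt_unique _ _ _ _ _ (HI (PI / 2))).
    apply CInt_ext with (2 := CInt_scal _ _ _ _ _ H1); intros; rewrite K_at_PI2; reflexivity.
  - apply (CInt_unique _ _ _ _ _ (HI 0)).
    apply CInt_ext with (2 := H0); intros; rewrite K_at_0; reflexivity.
Qed.

End Rotation.

(** The value at 0 is -1, so that the square is always 1. *)
Definition zsgn (k : Z) : R := if Z_lt_dec 0 k then 1 else -1.

Lemma zsgn_sqr (k : Z) : zsgn k * zsgn k = 1.
Proof. unfold zsgn; destruct (Z_lt_dec 0 k); ring. Qed.

Lemma zsgn_abs (k : Z) : k <> 0%Z -> IZR k = zsgn k * IZR (Z.abs k).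
Proof.
  intro Hk; unfold zsgn; destruct (Z_lt_dec 0 k).
  - rewrite Z.abs_eq by lia; ring.
  - rewrite Z.abs_neq, opp_IZR by lia; ring.
Qed.

Lemma Clog_two_pi_i (k : Z) : k <> 0%Z ->
  Clog (two_pi_i k) = (RtoC (ln (2 * PI * IZR (Z.abs k))) + RtoC (zsgn k * (PI / 2)) * Ci)%C.
Proof.
  intro Hk; assert (HP := PI_RGT_0).
  assert (Ha : 0 < IZR (Z.abs k)) by (apply IZR_lt; lia).
  assert (Hc : 0 < 2 * PI * IZR (Z.abs k)) by (apply Rmult_lt_0_compat; lra).
  assert (EM : Cmod (two_pi_i k) = 2 * PI * IZR (Z.abs k)).
  { unfold two_pi_i; rewrite Cmod_mult, Cmod_Ci, Cmod_R, Rmult_1_r, Rabs_mult, (Rabs_pos_eq (2 * PI)), <- abs_IZR by lra.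
    reflexivity. }
  assert (ER : Re (two_pi_i k) = 0) by (unfold two_pi_i; rewrite re_mult_Ci; simpl; ring).
  assert (EI : Im (two_pi_i k) = 2 * PI * IZR k) by (unfold two_pi_i, Ci, Im; simpl; ring).
  unfold Clog, Carg; rewrite EM, ER, EI; unfold Rdiv at 1 2; rewrite Rmult_0_l, acos_0.
  apply injective_projections; simpl; [ring|].
  unfold zsgn; destruct (Rle_dec 0 (2 * PI * IZR k)) as [h|h]; destruct (Z_lt_dec 0 k) as [h'|h']; try ring.
  - assert (IZR k < 0) by (apply IZR_lt; lia); nra.
  - exfalso; apply h; assert (0 < IZR k) by (apply IZR_lt; lia); nra.
Qed.

Lemma CIntg_eps (f : R -> C) (Fa Fb : (R -> Prop) -> Prop) (l : C) (eps : R) :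
  CIntg f Fa Fb l -> 0 < eps ->
  filter_prod Fa Fb (fun ab => exists y, CInt f (fst ab) (snd ab) y /\ Cmod (y - l) < eps).
Proof.
  intros H He; apply (H (fun y => Cmod (y - l) < eps)).
  assert (He2 : 0 < eps / 2) by lra; exists (mkposreal _ He2).
  intros y Hy; apply Cmod_ball_C in Hy; simpl in Hy; lra.
Qed.

Lemma at_right_elim (P : R -> Prop) (a : R) :
  at_right a P -> exists d, 0 < d /\ forall x, a < x < a + d -> P x.
Proof.
  intros [d Hd]; exists d; split; [apply cond_pos|]; intros x Hx; apply Hd; [|lra].
  unfold ball; simpl; unfold AbsRing_ball, abs, minus, plus, opp; simpl; apply Rabs_def1; lra.
Qed.

Lemma cp_mult (x y : R) (w : C) : 0 < x -> 0 < y -> cp (x * y) w = (cp x w * cp y w)%C.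
Proof. intros; unfold cp; rewrite <- Cexp_plus, ln_mult, RtoC_plus by assumption; f_equal; ring. Qed.

Lemma cp_plus (x : R) (v w : C) : cp x (v + w) = (cp x v * cp x w)%C.
Proof. unfold cp; rewrite <- Cexp_plus; f_equal; ring. Qed.

Lemma cp_1 (x : R) : 0 < x -> cp x 1 = RtoC x.
Proof. intro; unfold cp; rewrite Cmult_1_l, Cexp_RtoC, exp_ln by assumption; reflexivity. Qed.

Lemma Rpower_small_0 (s eps : R) : 0 < s -> 0 < eps -> exists d, 0 < d /\ forall x, 0 < x < d -> Rpower x s < eps.
Proof.
  intros Hs He; exists (exp (ln eps / s)); split; [apply exp_pos|]; intros x Hx.
  unfold Rpower; rewrite <- (exp_ln eps) by exact He; apply exp_increasing.
  assert (H : ln x < ln eps / s) by (rewrite <- (ln_exp (ln eps / s)); apply ln_increasing; lra).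
  apply (Rmult_lt_compat_l s) in H; [|exact Hs].
  replace (s * (ln eps / s)) with (ln eps) in H by (field; lra); exact H.
Qed.

Lemma Rpower_small_infty (s eps : R) : 0 < s -> 0 < eps -> exists M, 0 < M /\ forall x, M < x -> Rpower x (- s) < eps.
Proof.
  intros Hs He; destruct (Rpower_small_0 s eps Hs He) as [d [Hd H]].
  exists (/ d); split; [apply Rinv_0_lt_compat, Hd|]; intros x Hx.
  assert (Hi := Rinv_0_lt_compat _ Hd).
  replace (Rpower x (- s)) with (Rpower (/ x) s).
  - apply H; split; [apply Rinv_0_lt_compat; lra|].
    rewrite <- (Rinv_inv d); apply Rinv_lt_contravar; [|exact Hx]; apply Rmult_lt_0_compat; lra.
  - unfold Rpower; rewrite ln_Rinv by lra; f_equal; ring.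
Qed.

(** The Fourier transform of y^(-s) at the frequency k: absolute integrability fails at infinity, so
    the value is obtained as a limit of truncated integrals, over the integer upper ends that
    unfolding produces. *)
Lemma Mellin_Fourier (s : R) (k : Z) (U : nat -> C) : 0 < s < 1 -> k <> 0%Z ->
  (forall n, CIntg (fun y => cp y (- s) * Fourier_exp (- k) y)%C (at_right 0) (at_point (INR (S n))) (U n)) ->
  Clim U (Cexp ((s - 1) * Clog (two_pi_i k)) * CGamma (1 - s))%C.
Proof.
  intros Hs Hk HU.
  set (e := zsgn k); set (c := 2 * PI * IZR (Z.abs k)).
  assert (He : e * e = 1) by apply zsgn_sqr.
  assert (Hc : 0 < c).
  { unfold c; assert (0 < IZR (Z.abs k)) by (apply IZR_lt; lia); generalize PI_RGT_0; intro; apply Rmult_lt_0_compat; lra. }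
  set (P := Cexp ((s - 1) * Clog (two_pi_i k))).
  set (W := Cexp (RtoC (1 - s) * (RtoC (e * (PI / 2)) * Ci))).
  (* The factor from turning the ray times the factor from scaling by [c] is (2 pi i k)^(1-s). *)
  assert (EP : (P * (W * cp c (1 - s)))%C = RtoC 1).
  { unfold P, W, cp; rewrite Clog_two_pi_i by exact Hk; fold e c.
    rewrite <- !Cexp_plus; transitivity (Cexp 0); [f_equal; rewrite RtoC_minus; ring|apply Cexp_0]. }
  assert (HG : CIntg (fun x => cp x (- s) * Cexp (- x))%C (at_right 0) (Rbar_locally p_infty) (CGamma (1 - s))).
  { assert (Hz : 0 < Re (1 - RtoC s)) by (unfold Re; simpl; lra).
    generalize (CGamma_integral _ Hz); apply (CIntg_ext _ _ (fun t => 0 < t)); [apply spans_infty; auto|].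
    intros t Ht; unfold cp; rewrite <- Cexp_plus; f_equal; ring. }
  (* Scaling by c and rotating compares the truncated integrals. *)
  assert (key : forall a b y g, 0 < a <= b -> CInt (fun y => cp y (- s) * Fourier_exp (- k) y)%C a b y ->
    CInt (fun x => cp x (- s) * Cexp (- x))%C (c * a) (c * b) g ->
    Cmod (y - P * g) <= Cmod P * (2 * Rpower (c * a) (1 - s) + 3 * Rpower (c * b) (- s))).
  { intros a b y g Hab Hy Hg.
    destruct (ex_CInt (fun x => cp x (- s) * Cexp (- (RtoC (e * x) * Ci)))%C (c * a) (c * b)) as [L HL].
    { intros x Hx; rewrite Rmin_left in Hx by nra.
      assert (0 < x) by nra.
      apply Ccont_mult; [eapply Cderiv_cont, cp_deriv; assumption|].
      apply Ccont_Cexp, Ccont_opp, Ccont_mult; [|apply Ccont_const].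
      apply Ccont_RtoC, (continuous_scal_r (K := R_AbsRing) (V := R_NormedModule) e (fun x => x)), continuous_id. }
    assert (EL : L = (cp c (1 - s) * y)%C).
    { assert (HL' := CInt_comp_lin (fun x => cp x (- s) * Cexp (- (RtoC (e * x) * Ci)))%C c 0 a b L).
      rewrite !Rplus_0_r in HL'; specialize (HL' HL).
      apply (CInt_unique _ _ _ _ _ HL').
      apply CInt_ext with (2 := CInt_scal (cp c (1 - s)) _ _ _ _ Hy).
      intros x Hx; rewrite Rmin_left in Hx by lra; rewrite Rplus_0_r.
      rewrite cp_mult by lra.
      replace (1 - s)%C with (1 + - s)%C by ring; rewrite cp_plus, cp_1 by exact Hc.
      unfold Fourier_exp.
      replace (RtoC (2 * PI * IZR (- k) * x) * Ci)%C with (- (RtoC (e * (c * x)) * Ci))%C.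
      - ring.
      - rewrite opp_IZR, (zsgn_abs k Hk); fold e; unfold c.
        replace (2 * PI * - (e * IZR (Z.abs k)) * x) with (- (e * (2 * PI * IZR (Z.abs k) * x))) by ring.
        rewrite RtoC_opp; ring. }
    assert (HR := rotation s e Hs He (c * a) (c * b) g L ltac:(nra) Hg HL); fold W in HR.
    replace (y - P * g)%C with (P * (W * L - g))%C.
    - rewrite Cmod_mult; apply Rmult_le_compat_l; [apply Cmod_ge_0|exact HR].
    - rewrite EL; transitivity (P * (W * cp c (1 - s)) * y - P * g)%C; [ring|]; rewrite EP; ring. }
  intros eps Heps.
  (* The errors add up to at most (1 + 6 |P|) d: d from truncating [U n] at a, 5 |P| d from the
     arcs, |P| d from the Gamma integral. *)
  assert (HPm := Cmod_ge_0 P); set (d := eps / (2 + 8 * (Cmod P + 1))).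
  assert (Hd : 0 < d) by (apply Rdiv_lt_0_compat; lra).
  destruct (CIntg_eps _ _ _ _ d HG Hd) as [Qa Qb HQa [M HQb] HQ].
  destruct (at_right_elim _ _ HQa) as [da [Hda HQa']].
  destruct (Rpower_small_infty s d ltac:(lra) Hd) as [M' [HM' HMp]].
  destruct (Rpower_small_0 (1 - s) d ltac:(lra) Hd) as [da' [Hda' Hdp]].
  destruct (INR_unbounded (Rmax M M' / c)) as [N HN].
  exists N; intros n Hn.
  set (b := INR (S n)).
  assert (Hb : Rmax M M' < c * b).
  { apply Rlt_div_l in HN; [|exact Hc]; assert (INR N <= INR (S n)) by (apply le_INR; lia); unfold b; nra. }
  assert (Hb1 : M < c * b) by (generalize (Rmax_l M M'); lra).
  assert (Hb2 : M' < c * b) by (generalize (Rmax_r M M'); lra).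
  assert (Hb0 : 0 < b) by (apply lt_0_INR; lia).
  destruct (CIntg_eps _ _ _ _ d (HU n) Hd) as [Ra Rb HRa HRb HR].
  destruct (at_right_elim _ _ HRa) as [dr [Hdr HRa']].
  set (a := Rmin (Rmin (da / c) (da' / c)) (Rmin dr b) / 2).
  assert (Hdac : 0 < da / c) by (apply Rdiv_lt_0_compat; lra).
  assert (Hdac' : 0 < da' / c) by (apply Rdiv_lt_0_compat; lra).
  assert (Hm0 : 0 < Rmin (Rmin (da / c) (da' / c)) (Rmin dr b)) by (repeat apply Rmin_pos; assumption).
  assert (H1 := Rmin_l (Rmin (da / c) (da' / c)) (Rmin dr b)).
  assert (H2 := Rmin_r (Rmin (da / c) (da' / c)) (Rmin dr b)).
  assert (H3 := Rmin_l (da / c) (da' / c)); assert (H4 := Rmin_r (da / c) (da' / c)).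
  assert (H5 := Rmin_l dr b); assert (H6 := Rmin_r dr b).
  assert (Ha : 0 < a) by (unfold a; lra).
  assert (Ha1 : c * a < da) by (apply Rlt_le_trans with (c * (da / c)); [apply Rmult_lt_compat_l; unfold a; lra|right; field; lra]).
  assert (Ha2 : c * a < da') by (apply Rlt_le_trans with (c * (da' / c)); [apply Rmult_lt_compat_l; unfold a; lra|right; field; lra]).
  assert (Hca : 0 < c * a) by (apply Rmult_lt_0_compat; assumption).
  destruct (HQ (c * a) (c * b)) as (g & Hg & Hge); [apply HQa'; lra|apply HQb, Hb1|].
  destruct (HR a b) as (y & Hy & Hye); [apply HRa'; unfold a in *; lra|exact HRb|].
  simpl in Hg, Hy.
  assert (HK := key a b y g ltac:(unfold a in *; lra) Hy Hg).
  assert (HK' : Cmod P * (2 * Rpower (c * a) (1 - s) + 3 * Rpower (c * b) (- s)) <= Cmod P * (5 * d)).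
  { apply Rmult_le_compat_l; [exact HPm|].
    generalize (Hdp (c * a) ltac:(lra)) (HMp (c * b) Hb2); lra. }
  assert (HPg : Cmod (P * g - P * CGamma (1 - s)) <= Cmod P * d).
  { replace (P * g - P * CGamma (1 - s))%C with (P * (g - CGamma (1 - s)))%C by ring.
    rewrite Cmod_mult; apply Rmult_le_compat_l; [exact HPm|lra]. }
  generalize (Cmod_triangle3 (U n) y (P * CGamma (1 - s))) (Cmod_triangle3 y (P * g) (P * CGamma (1 - s))).
  rewrite (Cmod_minus_sym (U n) y).
  assert (Ed : d * (2 + 8 * (Cmod P + 1)) = eps) by (unfold d; field; lra).
  assert (0 <= Cmod P * d) by (apply Rmult_le_pos; lra).
  intros; nra.
Qed.

(** * Riemann-Lebesgue lemma and pointwise convergence *)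

Lemma CInt_norm_abs (f : R -> C) (K a b : R) (l : C) :
  (forall x, Rmin a b <= x <= Rmax a b -> Cmod (f x) <= K) -> CInt f a b l -> Cmod l <= K * Rabs (b - a).
Proof.
  intros H Hl; destruct (Rle_lt_dec a b) as [h|h].
  - rewrite Rmin_left, Rmax_right in H by lra; rewrite Rabs_pos_eq by lra.
    apply (CInt_norm_const f K a b); assumption.
  - rewrite Rmin_right, Rmax_left in H by lra; rewrite Rabs_left, <- Cmod_opp by lra.
    replace (- (b - a)) with (a - b) by ring.
    apply (CInt_norm_const f K b a); [lra|exact H|apply CInt_swap, Hl].
Qed.

Lemma continuous_bounded (f : R -> C) (a b : R) :
  a <= b -> (forall x, a <= x <= b -> Ccont f x) -> exists M, forall x, a <= x <= b -> Cmod (f x) <= M.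
Proof.
  intros Hab Hf.
  destruct (continuity_ab_maj (fun x => Cmod (f x)) a b Hab) as [m [Hm _]].
  - intros x Hx; apply continuity_pt_filterlim, (Ccont_Cmod f x), Hf, Hx.
  - exists (Cmod (f m)); exact Hm.
Qed.

Lemma Fourier_exp_half (k : Z) (x : R) : k <> 0%Z -> Fourier_exp k (x + / (2 * IZR k)) = (- Fourier_exp k x)%C.
Proof.
  intro Hk; assert (Hk' : IZR k <> 0) by (intro E; apply Hk, eq_IZR, E).
  rewrite !Fourier_exp_eq.
  replace (2 * PI * IZR k * (x + / (2 * IZR k))) with (2 * PI * IZR k * x + PI) by (field; exact Hk').
  rewrite neg_cos, neg_sin; reflexivity.
Qed.

(** Shifting x by half a period h = 1/(2k) changes the sign of the exponential. Adding the integral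
    to minus its shifted copy leaves the factor f(x) - f(x - h), small by uniform continuity, and
    two end pieces of length |h|. *)
Lemma Riemann_Lebesgue_compact (f : R -> C) (c d eps : R) :
  c <= d -> (forall x, c <= x <= d -> Ccont f x) -> 0 < eps ->
  exists K : nat, forall k l, (Z.of_nat K < Z.abs k)%Z ->
    CInt (fun x => f x * Fourier_exp k x)%C c d l -> Cmod l < eps.
Proof.
  intros Hcd Hf Heps.
  (* Extend f to a function that is uniformly continuous on the whole line. *)
  set (phi := fun x => Rmax c (Rmin d x)).
  assert (Hphi : forall x, c <= phi x <= d).
  { intro x; unfold phi; split; [apply Rmax_l|apply Rmax_lub; [exact Hcd|apply Rmin_l]]. }
  assert (Hlip : forall x y, Rabs (phi x - phi y) <= Rabs (x - y)).
  { intros x y; unfold phi, Rmax, Rmin; repeat destruct Rle_dec; unfold Rabs; repeat destruct Rcase_abs; lra. }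
  assert (Hid : forall x, c <= x <= d -> phi x = x).
  { intros x Hx; unfold phi; rewrite Rmin_right, Rmax_right; lra. }
  set (F := fun x => f (phi x)).
  destruct (continuous_bounded f c d Hcd Hf) as [S HS].
  assert (HFS : forall x, Cmod (F x) <= S) by (intro; apply HS, Hphi).
  assert (HS0 : 0 <= S) by (eapply Rle_trans; [apply Cmod_ge_0|apply (HFS 0)]).
  set (eta := eps / (2 * (d - c + 1))).
  assert (Heta : 0 < eta) by (unfold eta; apply Rdiv_lt_0_compat; lra).
  destruct (unifcont_normed_1d (V := C_R_NormedModule) f c d Hf (mkposreal _ Heta)) as [delta Hdelta].
  assert (HF : forall x y, Rabs (x - y) < delta -> Cmod (F x - F y) <= eta).
  { intros x y Hxy; left; rewrite <- norm_C_R.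
    apply (Hdelta (phi y) (phi x)); auto.
    unfold ball; simpl; unfold AbsRing_ball, abs, minus, plus, opp; simpl.
    eapply Rle_lt_trans; [apply (Hlip x y)|exact Hxy]. }
  assert (HFc : forall x, Ccont F x).
  { intro x; apply Ccont_eps; intros e He.
    generalize (proj1 (Ccont_eps f (phi x)) (Hf _ (Hphi x)) e He); intros [de Hde].
    exists de; intros y Hy; apply Hde; revert Hy; unfold ball; simpl; unfold AbsRing_ball, abs, minus, plus, opp; simpl.
    intro Hy; eapply Rle_lt_trans; [apply (Hlip y x)|exact Hy]. }
  set (h0 := Rmin delta (eps / (4 * (S + 1)))).
  assert (Hh0 : 0 < h0) by (apply Rmin_pos; [apply cond_pos|apply Rdiv_lt_0_compat; lra]).
  destruct (INR_unbounded (/ h0)) as [K HK]; exists K; intros k l Hk Hl.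
  assert (Hkn : k <> 0%Z) by lia.
  assert (HkR : / h0 < Rabs (IZR k)).
  { rewrite <- abs_IZR; apply Rlt_trans with (1 := HK); rewrite INR_IZR_INZ; apply IZR_lt, Hk. }
  set (h := / (2 * IZR k)).
  assert (HkR0 : 0 < / h0) by (apply Rinv_0_lt_compat, Hh0).
  assert (Hh : Rabs h < h0).
  { unfold h; rewrite Rabs_inv, Rabs_mult, (Rabs_pos_eq 2) by lra.
    rewrite <- (Rinv_inv h0); apply Rinv_lt_contravar; [apply Rmult_lt_0_compat; lra|lra]. }
  set (E := fun x => (F x * Fourier_exp k x)%C); set (G := fun x => (F (x - h)%R * Fourier_exp k x)%C).
  assert (HGc : forall x, Ccont G x).
  { intro x; apply Ccont_mult; [|apply Fourier_exp_cont].
    apply (continuous_comp (fun x => x - h) F); [|apply HFc].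
    apply (continuous_minus (V := R_NormedModule) (fun x => x) (fun _ => h)); [apply continuous_id|apply continuous_const]. }
  assert (HE : CInt E c d l).
  { apply CInt_ext with (2 := Hl); intros x Hx; rewrite Rmin_left, Rmax_right in Hx by lra.
    unfold E, F; rewrite Hid by lra; reflexivity. }
  destruct (ex_CInt G (c + h) c (fun x _ => HGc x)) as [l1 H1].
  destruct (ex_CInt G c d (fun x _ => HGc x)) as [l2 H2].
  destruct (ex_CInt G d (d + h) (fun x _ => HGc x)) as [l3 H3].
  (* The shift turns the integral of [G] over [c + h, d + h] into -l; [l1] and [l3] account for the
     difference between this interval and [c, d]. *)
  assert (Hsum : (l1 + l2 + l3)%C = (- l)%C).
  { assert (HG := CInt_shift G h c d _ (CInt_Chasles _ _ _ _ _ _ (CInt_Chasles _ _ _ _ _ _ H1 H2) H3)).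
    apply (CInt_unique _ _ _ _ _ HG).
    replace (- l)%C with (RtoC (-1) * l)%C by ring.
    apply CInt_ext with (2 := CInt_scal (RtoC (-1)) _ _ _ _ HE); intros x _; unfold E, G.
    replace (x + h - h) with x by ring; unfold h; rewrite Fourier_exp_half by exact Hkn; ring. }
  assert (H2l : (2 * l)%C = ((l - l2) - l1 - l3)%C).
  { replace (2 * l)%C with (l - - l)%C by ring; rewrite <- Hsum; ring. }
  assert (B1 : Cmod l1 <= S * Rabs h).
  { replace (Rabs h) with (Rabs (c - (c + h))) by (rewrite <- (Rabs_Ropp h); f_equal; ring).
    apply (CInt_norm_abs G); [|exact H1]; intros; unfold G; rewrite Cmod_mult, Cmod_Fourier_exp, Rmult_1_r; apply HFS. }
  assert (B3 : Cmod l3 <= S * Rabs h).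
  { replace (Rabs h) with (Rabs (d + h - d)) by (f_equal; ring).
    apply (CInt_norm_abs G); [|exact H3]; intros; unfold G; rewrite Cmod_mult, Cmod_Fourier_exp, Rmult_1_r; apply HFS. }
  assert (B2 : Cmod (l - l2) <= eta * (d - c)).
  { apply (CInt_norm_const (fun x => E x - G x)%C); [exact Hcd| |apply CInt_minus; assumption].
    intros x _; unfold E, G.
    replace (F x * Fourier_exp k x - F (x - h)%R * Fourier_exp k x)%C with ((F x - F (x - h)%R) * Fourier_exp k x)%C by ring.
    rewrite Cmod_mult, Cmod_Fourier_exp, Rmult_1_r; apply HF.
    replace (x - (x - h)) with h by ring; eapply Rlt_le_trans; [exact Hh|apply Rmin_l]. }
  assert (B : 2 * Cmod l <= eta * (d - c) + S * Rabs h + S * Rabs h).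
  { replace (2 * Cmod l) with (Cmod (2 * l)) by (rewrite Cmod_mult, Cmod_R, Rabs_pos_eq; lra).
    rewrite H2l; eapply Rle_trans; [apply Cmod_minus_le|]; apply Rplus_le_compat; [|exact B3].
    eapply Rle_trans; [apply Cmod_minus_le|]; lra. }
  assert (E1 : eta * (d - c + 1) = eps / 2) by (unfold eta; field; lra).
  assert (E2 : S * Rabs h <= eps / 4).
  { apply Rle_trans with ((S + 1) * (eps / (4 * (S + 1)))); [|right; field; lra].
    apply Rmult_le_compat; [lra|apply Rabs_pos|lra|].
    left; eapply Rlt_le_trans; [exact Hh|apply Rmin_r]. }
  nra.
Qed.

Lemma at_left_elim (P : R -> Prop) (a : R) :
  at_left a P -> exists d, 0 < d /\ forall x, a - d < x < a -> P x.
Proof.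
  intros [d Hd]; exists d; split; [apply cond_pos|]; intros x Hx; apply Hd; [|lra].
  unfold ball; simpl; unfold AbsRing_ball, abs, minus, plus, opp; simpl; apply Rabs_def1; lra.
Qed.

Lemma prod_elim (P : R * R -> Prop) (a b : R) : filter_prod (at_right a) (at_left b) P ->
  exists d, 0 < d /\ forall x y, a < x < a + d -> b - d < y < b -> P (x, y).
Proof.
  intros [Qa Qb HQa HQb H].
  destruct (at_right_elim _ _ HQa) as [d [Hd HQa']]; destruct (at_left_elim _ _ HQb) as [d' [Hd' HQb']].
  exists (Rmin d d'); split; [apply Rmin_pos; assumption|].
  generalize (Rmin_l d d') (Rmin_r d d'); intros H1 H2 x y Hx Hy; apply H; [apply HQa'; lra|apply HQb'; lra].
Qed.

(** The majorant makes the two ends of the interval negligible uniformly in the frequency; the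
    compact case handles the middle. *)
Lemma Riemann_Lebesgue (f : R -> C) (g : R -> R) (a b m eps : R) :
  a < b -> (forall x, a < x < b -> Ccont f x) -> (forall x, a < x < b -> Cmod (f x) <= g x) ->
  is_RInt_gen g (at_right a) (at_left b) m -> 0 < eps ->
  exists K : nat, forall k l, (Z.of_nat K < Z.abs k)%Z ->
    CIntg (fun x => f x * Fourier_exp k x)%C (at_right a) (at_left b) l -> Cmod l < eps.
Proof.
  intros Hab Hf Hfg Hg Heps.
  assert (He8 : 0 < eps / 8) by lra.
  assert (Hg' : filter_prod (at_right a) (at_left b) (fun ab => exists y, is_RInt g (fst ab) (snd ab) y /\ Rabs (y - m) < eps / 8)).
  { apply (Hg (fun y => Rabs (y - m) < eps / 8)); exists (mkposreal _ He8); auto. }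
  destruct (prod_elim _ _ _ Hg') as [d [Hd HQ]]; simpl in HQ.
  set (r := Rmin (d / 2) ((b - a) / 3)).
  assert (Hr : 0 < r) by (apply Rmin_pos; lra).
  assert (Hr1 : r <= d / 2) by apply Rmin_l; assert (Hr2 : r <= (b - a) / 3) by apply Rmin_r.
  destruct (HQ (a + r) (b - r)) as [y [Hy Hym]]; [lra|lra|].
  destruct (Riemann_Lebesgue_compact f (a + r) (b - r) (eps / 2)) as [K HK]; [lra| |lra|].
  { intros; apply Hf; lra. }
  exists K; intros k l Hk Hl.
  destruct (prod_elim _ _ _ (CIntg_eps _ _ _ _ (eps / 8) Hl He8)) as [d' [Hd' HQl]]; simpl in HQl.
  set (r' := Rmin d' r / 2).
  assert (Hm : 0 < Rmin d' r) by (apply Rmin_pos; lra).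
  generalize (Rmin_l d' r) (Rmin_r d' r); intros Hm1 Hm2.
  assert (Hr' : 0 < r' < r /\ r' < d') by (unfold r'; lra).
  destruct (HQ (a + r') (b - r')) as [y' [Hy' Hym']]; [lra|lra|].
  destruct (HQl (a + r') (b - r')) as [v [Hv Hvl]]; [lra|lra|].
  set (F := fun x => (f x * Fourier_exp k x)%C).
  assert (HFc : forall x, a < x < b -> Ccont F x) by (intros; apply Ccont_mult; [auto|apply Fourier_exp_cont]).
  assert (HFg : forall x, a < x < b -> Cmod (F x) <= g x).
  { intros; unfold F; rewrite Cmod_mult, Cmod_Fourier_exp, Rmult_1_r; auto. }
  destruct (ex_CInt F (a + r') (a + r)) as [v1 Hv1]; [intros x Hx; rewrite Rmin_left, Rmax_right in Hx by lra; apply HFc; lra|].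
  destruct (ex_CInt F (a + r) (b - r)) as [v2 Hv2]; [intros x Hx; rewrite Rmin_left, Rmax_right in Hx by lra; apply HFc; lra|].
  destruct (ex_CInt F (b - r) (b - r')) as [v3 Hv3]; [intros x Hx; rewrite Rmin_left, Rmax_right in Hx by lra; apply HFc; lra|].
  assert (Ev : v = (v1 + v2 + v3)%C).
  { apply (CInt_unique _ _ _ _ _ Hv), (CInt_Chasles _ _ (b - r)); [apply (CInt_Chasles _ _ (a + r))|]; assumption. }
  assert (Hex : ex_RInt g (a + r') (b - r')) by (exists y'; exact Hy').
  destruct (ex_RInt_Chasles_1 (V := R_CompleteNormedModule) g (a + r') (a + r) (b - r') ltac:(lra) Hex) as [w1 Hw1].
  destruct (ex_RInt_Chasles_2 (V := R_CompleteNormedModule) g (a + r') (b - r) (b - r') ltac:(lra) Hex) as [w3 Hw3].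
  (* Both y and y' are within eps/8 of m, so w1 + w3 is below eps/4 whatever the frequency is. *)
  assert (Ew : y' = w1 + y + w3).
  { rewrite <- (is_RInt_unique _ _ _ _ Hy').
    apply is_RInt_unique, (is_RInt_Chasles (V := R_NormedModule) g _ (b - r)); [apply (is_RInt_Chasles (V := R_NormedModule) g _ (a + r))|]; assumption. }
  assert (B1 : Cmod v1 <= w1) by (apply (CInt_norm_le F g (a + r') (a + r)); auto; [lra|intros; apply HFg; lra]).
  assert (B3 : Cmod v3 <= w3) by (apply (CInt_norm_le F g (b - r) (b - r')); auto; [lra|intros; apply HFg; lra]).
  assert (B2 := HK k v2 Hk Hv2).
  apply Rabs_lt_between in Hym; apply Rabs_lt_between in Hym'.
  assert (Cmod l <= Cmod v + eps / 8).
  { generalize (Cmod_minus_ge l v); rewrite Cmod_minus_sym; lra. }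
  assert (Cmod v <= Cmod v1 + Cmod v2 + Cmod v3).
  { rewrite Ev; eapply Rle_trans; [apply Cmod_triangle|]; generalize (Cmod_triangle v1 v2); lra. }
  lra.
Qed.

(** * Pointwise convergence at a point of differentiability *)

Definition dslope (F : R -> C) (a : R) (l : C) (x : R) : C :=
  if Req_EM_T x a then l else ((F x - F a) / RtoC (x - a))%C.

Lemma dslope_cont_at (F : R -> C) (a : R) (l : C) : Cderiv F a l -> Ccont (dslope F a l) a.
Proof.
  intros [H1 H2]; apply Ccont_eps; intros e He.
  apply is_derive_Reals in H1; apply is_derive_Reals in H2.
  assert (He2 : 0 < e / 2) by lra.
  destruct (H1 _ He2) as [d1 Hd1]; destruct (H2 _ He2) as [d2 Hd2].
  assert (Hd : 0 < Rmin d1 d2) by (apply Rmin_pos; apply cond_pos).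
  exists (mkposreal _ Hd); refine (fun (y : R) Hy => _); unfold ball in Hy; simpl in Hy; unfold AbsRing_ball, abs, minus, plus, opp in Hy; simpl in Hy.
  unfold dslope at 2; destruct (Req_EM_T a a) as [_|n]; [|lra].
  unfold dslope; destruct (Req_EM_T y a) as [E|E].
  - replace (l - l)%C with (RtoC 0) by ring; rewrite Cmod_0; exact He.
  - set (h := y - a); assert (Hh : h <> 0) by (unfold h; lra).
    assert (Hy1 : Rabs h < d1) by (eapply Rlt_le_trans; [exact Hy|apply Rmin_l]).
    assert (Hy2 : Rabs h < d2) by (eapply Rlt_le_trans; [exact Hy|apply Rmin_r]).
    specialize (Hd1 h Hh Hy1); specialize (Hd2 h Hh Hy2).
    replace (a + h) with y in * by (unfold h; ring).
    set (q := ((F y - F a) / RtoC h)%C).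
    assert (Eq : q = (RtoC (/ h) * (F y - F a))%C) by (unfold q; rewrite RtoC_inv by exact Hh; unfold Cdiv; ring).
    replace e with (2 * (e / 2)) by field; apply Cmod_ball_C; rewrite Eq; split;
      unfold ball; simpl; unfold AbsRing_ball, abs, minus, plus, opp; simpl.
    + eapply Rle_lt_trans; [|exact Hd1]; right; f_equal; field; exact Hh.
    + eapply Rle_lt_trans; [|exact Hd2]; right; f_equal; field; exact Hh.
Qed.

Lemma dslope_cont (F : R -> C) (a x : R) (l : C) : x <> a -> Ccont F x -> Ccont (dslope F a l) x.
Proof.
  intros Hx HF.
  assert (Hd : 0 < Rabs (x - a)) by (apply Rabs_pos_lt; lra).
  apply Ccont_ext_loc with (fun y => (F y - F a) * / RtoC (y - a))%C.
  - exists (mkposreal _ Hd); refine (fun (y : R) Hy => _); unfold ball in Hy; simpl in Hy; unfold AbsRing_ball, abs, minus, plus, opp in Hy; simpl in Hy.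
    unfold dslope; destruct (Req_EM_T y a) as [->|]; [|reflexivity].
    exfalso; change (a + - x) with (a - x) in Hy; rewrite (Rabs_minus_sym a x) in Hy; lra.
  - apply Ccont_mult; [apply Ccont_minus; [exact HF|apply Ccont_const]|].
    apply Ccont_inv; [intro E; apply RtoC_inj in E; lra|].
    apply Ccont_RtoC, (continuous_minus (V := R_NormedModule) (fun x => x) (fun _ => a)); [apply continuous_id|apply continuous_const].
Qed.

Lemma locally_0_C (P : C -> Prop) : @locally C_UniformSpace (RtoC 0) P -> exists e, 0 < e /\ forall y, Cmod y < e -> P y.
Proof.
  intros [e He]; exists e; split; [apply cond_pos|]; intros y Hy; apply He, ball_C_Cmod.
  rewrite Cminus_0_r; exact Hy.
Qed.

Lemma at_left_lt (a b : R) : a < b -> at_left b (fun x => a < x < b).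
Proof.
  intro h; assert (h' : 0 < b - a) by lra; exists (mkposreal _ h'); intros y Hy Hy'.
  unfold ball in Hy; simpl in Hy; unfold AbsRing_ball, abs, minus, plus, opp in Hy; simpl in Hy.
  apply Rabs_lt_between in Hy; lra.
Qed.

Lemma CIntg_end_r (f : R -> C) (b d : R) : 0 < d -> (forall x, b - d <= x <= b -> Ccont f x) ->
  CIntg f (at_point b) (at_left b) 0.
Proof.
  intros Hd Hf P HP; destruct (locally_0_C P HP) as [e [He HPe]].
  destruct (continuous_bounded f (b - d) b ltac:(lra) Hf) as [M HM].
  assert (HM0 : 0 <= M) by (eapply Rle_trans; [apply Cmod_ge_0|apply (HM b); lra]).
  assert (Hm : 0 < Rmin d (e / (M + 1))) by (apply Rmin_pos; [exact Hd|apply Rdiv_lt_0_compat; lra]).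
  exists (fun x => x = b) (fun x => b - Rmin d (e / (M + 1)) < x < b); [reflexivity|apply at_left_lt; lra|].
  intros x y -> Hy; simpl.
  generalize (Rmin_l d (e / (M + 1))) (Rmin_r d (e / (M + 1))); intros H1 H2.
  destruct (ex_CInt f b y) as [l Hl]; [intros x Hx; rewrite Rmin_right, Rmax_left in Hx by lra; apply Hf; lra|].
  exists l; split; [exact Hl|]; apply HPe.
  eapply Rle_lt_trans; [apply (CInt_norm_abs f M b y); [|exact Hl]|].
  - intros x Hx; rewrite Rmin_right, Rmax_left in Hx by lra; apply HM; lra.
  - rewrite Rabs_left by lra.
    apply Rle_lt_trans with (M * (e / (M + 1))); [apply Rmult_le_compat_l; lra|].
    replace (M * (e / (M + 1))) with (e * (M / (M + 1))) by (field; lra).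
    rewrite <- (Rmult_1_r e) at 2; apply Rmult_lt_compat_l; [exact He|]; apply Rlt_div_l; lra.
Qed.

Lemma CIntg_end_l (f : R -> C) (a d : R) : 0 < d -> (forall x, a <= x <= a + d -> Ccont f x) ->
  CIntg f (at_right a) (at_point a) 0.
Proof.
  intros Hd Hf P HP; destruct (locally_0_C P HP) as [e [He HPe]].
  destruct (continuous_bounded f a (a + d) ltac:(lra) Hf) as [M HM].
  assert (HM0 : 0 <= M) by (eapply Rle_trans; [apply Cmod_ge_0|apply (HM a); lra]).
  assert (Hm : 0 < Rmin d (e / (M + 1))) by (apply Rmin_pos; [exact Hd|apply Rdiv_lt_0_compat; lra]).
  exists (fun x => a < x < a + Rmin d (e / (M + 1))) (fun x => x = a); [apply at_right_lt; lra|reflexivity|].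
  intros y x Hy ->; simpl.
  generalize (Rmin_l d (e / (M + 1))) (Rmin_r d (e / (M + 1))); intros H1 H2.
  destruct (ex_CInt f y a) as [l Hl]; [intros x Hx; rewrite Rmin_right, Rmax_left in Hx by lra; apply Hf; lra|].
  exists l; split; [exact Hl|]; apply HPe.
  eapply Rle_lt_trans; [apply (CInt_norm_abs f M y a); [|exact Hl]|].
  - intros x Hx; rewrite Rmin_right, Rmax_left in Hx by lra; apply HM; lra.
  - rewrite Rabs_left by lra.
    apply Rle_lt_trans with (M * (e / (M + 1))); [apply Rmult_le_compat_l; lra|].
    replace (M * (e / (M + 1))) with (e * (M / (M + 1))) by (field; lra).
    rewrite <- (Rmult_1_r e) at 2; apply Rmult_lt_compat_l; [exact He|]; apply Rlt_div_l; lra.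
Qed.

Lemma CIntg_Chasles (Fa Fb : (R -> Prop) -> Prop) {FFa : Filter Fa} {FFb : Filter Fb} (f : R -> C) (b : R) (l m : C) :
  CIntg f Fa (at_point b) l -> CIntg f (at_point b) Fb m -> CIntg f Fa Fb (l + m)%C.
Proof. intros H1 H2; exact (is_RInt_gen_Chasles f b l m H1 H2). Qed.

Lemma CIntg_at_point (f : R -> C) (a b : R) (l : C) : CIntg f (at_point a) (at_point b) l <-> CInt f a b l.
Proof. apply (is_RInt_gen_at_point (V := C_R_NormedModule)). Qed.

Lemma CIntg_point_left (Fa : (R -> Prop) -> Prop) {FFa : Filter Fa} (f : R -> C) (b d : R) (l : C) :
  0 < d -> (forall x, b - d <= x <= b -> Ccont f x) -> CIntg f Fa (at_point b) l -> CIntg f Fa (at_left b) l.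
Proof.
  intros Hd Hf H; replace l with (l + 0)%C by ring.
  apply (CIntg_Chasles _ _ f b); [exact H|apply CIntg_end_r with d; assumption].
Qed.

(** Continuity up to the ends bounds the integrand, so the pieces cut off next to the ends tend to
    0. *)
Lemma CIntg_of_CInt (f : R -> C) (a b : R) (l : C) : a < b -> (forall x, a <= x <= b -> Ccont f x) ->
  CInt f a b l -> CIntg f (at_right a) (at_left b) l.
Proof.
  intros Hab Hf H; apply (CIntg_point_left (at_right a) f b (b - a)); [lra|intros; apply Hf; lra|].
  replace l with (0 + l)%C by ring; apply (CIntg_Chasles _ _ f a); [|apply CIntg_at_point, H].
  apply CIntg_end_l with (b - a); [lra|intros; apply Hf; lra].
Qed.

Lemma is_RInt_gen_const_01 (c : R) : is_RInt_gen (fun _ => c) (at_right 0) (at_left 1) c.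
Proof.
  assert (H : is_RInt_gen (fun _ => c) (at_right 0) (at_left 1) (c * 1 - c * 0)).
  { apply (is_RInt_gen_primitive _ _ _ (fun x => c * x) (fun _ => True)).
    - apply spans_open; [lra|auto].
    - intros; auto_derive; [auto|ring].
    - intros; apply continuous_const.
    - eapply filterlim_filter_le_1; [apply filter_le_within|].
      apply (continuous_scal_r (K := R_AbsRing) (V := R_NormedModule) c (fun x => x) 0), continuous_id.
    - eapply filterlim_filter_le_1; [apply filter_le_within|].
      apply (continuous_scal_r (K := R_AbsRing) (V := R_NormedModule) c (fun x => x) 1), continuous_id. }
  generalize H; replace (c * 1 - c * 0) with c by ring; auto.
Qed.

(** From sin x >= x - x^3/6, since x^2 <= 4 on this interval. *)
Lemma sin_ge_third (x : R) : 0 <= x <= PI / 2 -> x / 3 <= sin x.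
Proof.
  intro Hx; assert (HP := PI_4).
  destruct (sin_bound x 0 ltac:(lra) ltac:(lra)) as [H _].
  unfold sin_approx, sin_term in H; simpl in H.
  assert (x * x <= 4) by nra; nra.
Qed.

(** |e(t) - 1| = 2 |sin(pi t)|. The lower bound vanishes exactly at the zeros -1, 0, 1, so it serves
    both for t = x in (0,1) and for differences of two points of (0,1). *)
Lemma Fourier_exp_1_lower (t : R) : -1 <= t <= 1 -> 2 * (Rabs t * (1 - Rabs t)) <= Cmod (Fourier_exp 1 t - 1).
Proof.
  intro Ht; assert (HP := PI2_3_2); assert (HP4 := PI_4).
  assert (E : Cmod (Fourier_exp 1 t - 1) = 2 * Rabs (sin (PI * t))).
  { rewrite Fourier_exp_eq; unfold Cmod; simpl.
    replace (2 * PI * 1 * t) with (2 * (PI * t)) by ring.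
    rewrite cos_2a_sin, sin_2a.
    set (S := sin (PI * t)); set (K := cos (PI * t)).
    assert (H : S * S + K * K = 1) by (unfold S, K; generalize (sin2_cos2 (PI * t)); unfold Rsqr; lra).
    match goal with |- sqrt ?x = _ => replace x with ((2 * S) * (2 * S)) by nra end.
    change (sqrt (Rsqr (2 * S)) = 2 * Rabs S); rewrite sqrt_Rsqr_abs, Rabs_mult, (Rabs_pos_eq 2); lra. }
  rewrite E; apply Rmult_le_compat_l; [lra|].
  assert (H : forall u, 0 <= u <= 1 -> u * (1 - u) <= Rabs (sin (PI * u))).
  { intros u Hu; eapply Rle_trans; [|apply Rle_abs].
    destruct (Rle_lt_dec u (1 / 2)) as [h|h].
    - generalize (sin_ge_third (PI * u) ltac:(nra)); nra.
    - replace (sin (PI * u)) with (sin (PI * (1 - u))).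
      + generalize (sin_ge_third (PI * (1 - u)) ltac:(nra)); nra.
      + replace (PI * (1 - u)) with (PI - PI * u) by ring; symmetry; rewrite sin_minus, sin_PI, cos_PI; ring. }
  destruct (Rle_lt_dec 0 t) as [h|h].
  - rewrite (Rabs_pos_eq t) by exact h; apply H; lra.
  - rewrite (Rabs_left t) by exact h.
    replace (PI * t) with (- (PI * - t)) by ring; rewrite sin_neg, Rabs_Ropp; apply H; lra.
Qed.

Lemma Cderiv_Fourier_1_shift (a : R) : Cderiv (fun x => Fourier_exp 1 (x - a)) a (two_pi_i 1).
Proof.
  apply Cderiv_ext with (Fourier_exp 1 (- a) * (two_pi_i 1 * Fourier_exp 1 a))%C.
  - transitivity (two_pi_i 1 * (Fourier_exp 1 (- a) * Fourier_exp 1 a))%C; [ring|].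
    rewrite <- Fourier_exp_add, Rplus_opp_l, Fourier_exp_at_0; ring.
  - assert (H := Cderiv_scal (Fourier_exp 1 (- a)) _ _ _ (Fourier_exp_deriv 1 a)).
    destruct H as [H1 H2]; split.
    + eapply is_derive_ext; [|exact H1]; intro x; cbv beta; rewrite Cmult_comm, <- Fourier_exp_add; reflexivity.
    + eapply is_derive_ext; [|exact H2]; intro x; cbv beta; rewrite Cmult_comm, <- Fourier_exp_add; reflexivity.
Qed.

Definition symsum (u : Z -> C) (N : nat) : C :=
  Csum (fun k => u (Z.of_nat (S k)) + u (- Z.of_nat (S k))%Z)%C N.

Lemma symmetric_sum_symsum (u : Z -> C) (N : nat) : symmetric_sum u N = symsum u N.
Proof.
  unfold symmetric_sum; induction N.
  - rewrite sum_n_m_zero by lia; reflexivity.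
  - rewrite sum_n_Sm by lia; rewrite IHN; reflexivity.
Qed.

(* Chernoff's argument: f - f(al) = G (e(x - al) - 1) with G integrable, so that the
   symmetric partial sums telescope to Fourier coefficients of G. *)
Lemma Dini_criterion (f : R -> C) (g : R -> R) (m al : R) (D : C) (c : Z -> C) :
  0 < al < 1 -> (forall x, 0 < x < 1 -> Ccont f x) -> (forall x, 0 < x < 1 -> Cmod (f x) <= g x) ->
  is_RInt_gen g (at_right 0) (at_left 1) m -> Cderiv f al D ->
  (forall n, is_Fourier_coeff f n (c n)) ->
  Clim (fun N => c 0%Z + symsum (fun n => Fourier_exp n al * c n) N)%C (f al).
Proof.
  intros Hal Hf Hfg Hg HD Hc.
  set (E := fun x => Fourier_exp 1 (x - al)).
  set (G := fun x => (dslope f al D x * / dslope E al (two_pi_i 1) x)%C).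
  assert (HEc : forall x, Ccont E x).
  { intro x; apply (continuous_comp (fun x => x - al) (Fourier_exp 1)); [|apply Fourier_exp_cont].
    apply (continuous_minus (V := R_NormedModule) (fun x => x) (fun _ => al)); [apply continuous_id|apply continuous_const]. }
  assert (HE1 : E al = RtoC 1) by (unfold E; rewrite Rminus_diag; apply Fourier_exp_at_0).
  (* [E] takes the value 1 also at distance 1 from [al]; on (0,1) the margin 1 - |x - al| is at
     least [mu]. *)
  set (mu := Rmin al (1 - al)).
  assert (Hmu : 0 < mu) by (apply Rmin_pos; lra).
  assert (Hlow : forall x, 0 < x < 1 -> 2 * (Rabs (x - al) * mu) <= Cmod (E x - 1)).
  { intros x Hx; eapply Rle_trans; [|apply Fourier_exp_1_lower; lra].
    apply Rmult_le_compat_l; [lra|]; apply Rmult_le_compat_l; [apply Rabs_pos|].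
    generalize (Rmin_l al (1 - al)) (Rmin_r al (1 - al)); fold mu; intros; unfold Rabs; destruct Rcase_abs; lra. }
  assert (HEn : forall x, 0 < x < 1 -> x <> al -> (E x - 1)%C <> RtoC 0).
  { intros x Hx Hxa; apply Cmod_gt_0; eapply Rlt_le_trans; [|apply Hlow, Hx].
    assert (0 < Rabs (x - al)) by (apply Rabs_pos_lt; lra); nra. }
  assert (HG : forall x, 0 < x < 1 -> (G x * (E x - 1))%C = (f x - f al)%C).
  { intros x Hx; unfold G, dslope; rewrite HE1; destruct (Req_EM_T x al) as [->|Hxa].
    - rewrite HE1; ring.
    - field; split; first [apply HEn; assumption|intro E0; apply RtoC_inj in E0; lra]. }
  assert (Hds : forall x, 0 < x < 1 -> dslope E al (two_pi_i 1) x <> RtoC 0).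
  { intros x Hx; unfold dslope; rewrite HE1; destruct (Req_EM_T x al) as [->|Hxa]; [apply two_pi_i_nz; lia|].
    apply Cmult_neq_0; [apply HEn; assumption|].
    rewrite <- RtoC_inv by lra; intro E0; apply RtoC_inj in E0; revert E0; apply Rinv_neq_0_compat; lra. }
  assert (HGc : forall x, 0 < x < 1 -> Ccont G x).
  { intros x Hx; apply Ccont_mult; [|apply Ccont_inv; [apply Hds, Hx|]].
    - destruct (Req_EM_T x al) as [->|Hxa]; [apply dslope_cont_at, HD|apply dslope_cont; auto].
    - destruct (Req_EM_T x al) as [->|Hxa]; [apply dslope_cont_at, Cderiv_Fourier_1_shift|apply dslope_cont; auto]. }
  (* Near [al] continuity bounds [G]; at distance at least d the denominator is at least 2 d mu in
     modulus. *)
  assert (HGb : exists A B, 0 <= A /\ forall x, 0 < x < 1 -> Cmod (G x) <= A * g x + B).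
  { destruct (proj1 (Ccont_eps G al) (HGc al Hal) 1 Rlt_0_1) as [d Hd].
    set (q := / (2 * (d * mu))).
    assert (Hdm : 0 < d * mu) by (apply Rmult_lt_0_compat; [apply cond_pos|exact Hmu]).
    assert (Hq : 0 < q) by (unfold q; apply Rinv_0_lt_compat; lra).
    exists q, (q * Cmod (f al) + (Cmod (G al) + 1)); split; [lra|]; intros x Hx.
    assert (Hg0 : 0 <= g x) by (eapply Rle_trans; [apply Cmod_ge_0|apply Hfg, Hx]).
    assert (H0 := Cmod_ge_0 (f al)); assert (H1 := Cmod_ge_0 (G al)).
    assert (H2 := Rmult_le_pos _ _ (Rlt_le _ _ Hq) H0); assert (H3 := Rmult_le_pos _ _ (Rlt_le _ _ Hq) Hg0).
    destruct (Rlt_le_dec (Rabs (x - al)) d) as [h|h].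
    - specialize (Hd x h); generalize (Cmod_minus_ge (G x) (G al)); lra.
    - assert (Hl : 2 * (d * mu) <= Cmod (E x - 1)) by (generalize (Hlow x Hx); nra).
      assert (H4 : Cmod (G x) * (2 * (d * mu)) <= Cmod (f x) + Cmod (f al)).
      { eapply Rle_trans; [apply Rmult_le_compat_l; [apply Cmod_ge_0|exact Hl]|].
        rewrite <- Cmod_mult, HG by exact Hx; apply Cmod_minus_le. }
      assert (H5 : Cmod (G x) <= q * (Cmod (f x) + Cmod (f al))).
      { unfold q; rewrite Rmult_comm; apply Rle_div_r; [lra|exact H4]. }
      generalize (Rmult_le_compat_l q _ _ (Rlt_le _ _ Hq) (Hfg x Hx)); lra. }
  destruct HGb as (A & B & HA & HGb).
  assert (Hg' : is_RInt_gen (fun x => A * g x + B) (at_right 0) (at_left 1) (A * m + B)).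
  { apply (is_RInt_gen_plus (V := R_NormedModule)); [apply (is_RInt_gen_scal (V := R_NormedModule)), Hg|apply is_RInt_gen_const_01]. }
  assert (HD01 : spans (at_right 0) (at_left 1) (fun x => 0 < x < 1)) by (apply spans_open; [lra|auto]).
  set (gam := fun n => (RInt_gen (V := C_R_CompleteNormedModule) (fun x => G x * Fourier_exp (- n) x)%C (at_right 0) (at_left 1) : C)).
  assert (Hgam : forall n, CIntg (fun x => G x * Fourier_exp (- n) x)%C (at_right 0) (at_left 1) (gam n)).
  { intro n.
    destruct (CIntg_dominated (fun x => G x * Fourier_exp (- n) x)%C (fun x => A * g x + B) _ (A * m + B) HD01) as [l [Hl _]]; [| |exact Hg'|].
    - intros; apply Ccont_mult; [auto|apply Fourier_exp_cont].
    - intros; rewrite Cmod_mult, Cmod_Fourier_exp, Rmult_1_r; auto.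
    - replace (gam n) with l; [exact Hl|symmetry; exact (RInt_gen_CIntg _ _ _ l Hl)]. }
  set (v := fun n => (Fourier_exp n al * gam n)%C).
  (* The coefficients of G (E - 1) are differences of neighbouring coefficients of [G], up to the
     phase e(-al) that [v] absorbs; the constant f(al) contributes at n = 0 only. *)
  assert (Hstep : forall n, (Fourier_exp n al * c n)%C = ((if Z.eq_dec n 0 then f al else RtoC 0) + (v (n - 1)%Z - v n))%C).
  { intro n.
    assert (H1 : CIntg (fun x => f x * Fourier_exp (- n) x - f al * Fourier_exp (- n) x)%C (at_right 0) (at_left 1)
              (c n - f al * (if Z.eq_dec (- n) 0 then RtoC 1 else RtoC 0))%C).
    { apply CIntg_minus; [apply Hc|]; apply CIntg_scal, CIntg_of_CInt; [lra|intros; apply Fourier_exp_cont|apply Fourier_exp_int]. }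
    assert (H2 : CIntg (fun x => f x * Fourier_exp (- n) x - f al * Fourier_exp (- n) x)%C (at_right 0) (at_left 1)
              (Fourier_exp 1 (- al) * gam (n - 1)%Z - gam n)%C).
    { apply CIntg_ext with (f := fun x => (Fourier_exp 1 (- al) * (G x * Fourier_exp (- (n - 1)) x) - G x * Fourier_exp (- n) x)%C) (D := fun x => 0 < x < 1);
        [exact HD01| |apply CIntg_minus; [apply CIntg_scal|]; apply Hgam].
      intros x Hx.
      transitivity ((f x - f al) * Fourier_exp (- n) x)%C; [|ring]; rewrite <- HG by exact Hx.
      replace (- (n - 1))%Z with (- n + 1)%Z by ring; rewrite Fourier_exp_plus.
      unfold E, Rminus; rewrite Fourier_exp_add; ring. }
    assert (EQ := CIntg_unique _ _ _ H1 H2).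
    assert (Ev : v (n - 1)%Z = (Fourier_exp n al * (Fourier_exp 1 (- al) * gam (n - 1)%Z))%C).
    { unfold v; change (Fourier_exp (n - 1) al) with (Fourier_exp (n + -1) al); rewrite Fourier_exp_plus.
      replace (Fourier_exp (-1) al) with (Fourier_exp 1 (- al)); [ring|].
      unfold Fourier_exp; f_equal; f_equal; f_equal; ring. }
    rewrite Ev; unfold v.
    replace (c n) with (f al * (if Z.eq_dec (- n) 0 then RtoC 1 else RtoC 0) + (Fourier_exp 1 (- al) * gam (n - 1)%Z - gam n))%C
      by (rewrite <- EQ; ring).
    destruct (Z.eq_dec (- n) 0); destruct (Z.eq_dec n 0); try lia; [|ring].
    subst n; rewrite Fourier_exp_0; ring. }
  assert (Hsum : forall N, (c 0%Z + symsum (fun n => Fourier_exp n al * c n) N)%C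
            = (f al + (v (- Z.of_nat (S N))%Z - v (Z.of_nat N)))%C).
  { induction N.
    - unfold symsum; simpl Csum; rewrite Cplus_0_r.
      replace (c 0%Z) with (Fourier_exp 0 al * c 0%Z)%C by (rewrite Fourier_exp_0; ring).
      rewrite Hstep; destruct (Z.eq_dec 0 0); [|lia]; reflexivity.
    - change (symsum ?u (S N)) with (symsum u N + (u (Z.of_nat (S N)) + u (- Z.of_nat (S N))%Z))%C; cbv beta.
      rewrite Cplus_assoc, IHN, !Hstep.
      destruct (Z.eq_dec (Z.of_nat (S N)) 0); [lia|]; destruct (Z.eq_dec (- Z.of_nat (S N)) 0); [lia|].
      replace (Z.of_nat (S N) - 1)%Z with (Z.of_nat N) by lia.
      replace (- Z.of_nat (S N) - 1)%Z with (- Z.of_nat (S (S N)))%Z by lia; ring. }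
  intros e He.
  destruct (Riemann_Lebesgue G (fun x => A * g x + B) 0 1 _ (e / 2) Rlt_0_1 HGc HGb Hg' ltac:(lra)) as [K HK].
  exists (S K); intros N HN; rewrite Hsum.
  replace (f al + (v (- Z.of_nat (S N))%Z - v (Z.of_nat N)) - f al)%C with (v (- Z.of_nat (S N))%Z - v (Z.of_nat N))%C by ring.
  eapply Rle_lt_trans; [apply Cmod_minus_le|]; unfold v; rewrite !Cmod_mult, !Cmod_Fourier_exp, !Rmult_1_l.
  assert (HK1 : (Z.of_nat K < Z.abs (- Z.of_nat N))%Z) by lia.
  assert (HK2 : (Z.of_nat K < Z.abs (- - Z.of_nat (S N)))%Z) by lia.
  generalize (HK _ _ HK1 (Hgam (Z.of_nat N))) (HK _ _ HK2 (Hgam (- Z.of_nat (S N))%Z)); lra.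
Qed.

(** * Hurwitz' formula for 0 < s < 1 *)

Lemma Rpower_derive (x e : R) : 0 < x -> is_derive (fun x => Rpower x e) x (e * Rpower x (e - 1)).
Proof.
  intro Hx; unfold Rpower; auto_derive; [exact Hx|].
  replace ((e - 1) * ln x) with (e * ln x + - ln x) by ring.
  rewrite exp_plus, exp_Ropp with (x := ln x), exp_ln by exact Hx; field; lra.
Qed.

Lemma Rpower_continuous (x e : R) : 0 < x -> continuous (fun x => Rpower x e) x.
Proof.
  intro Hx; apply (ex_derive_continuous (K := R_AbsRing) (V := R_NormedModule) (fun x => Rpower x e)).
  eexists; apply Rpower_derive, Hx.
Qed.

Lemma Rpower_lim_0 (e : R) : 0 < e -> filterlim (fun x => Rpower x e) (at_right 0) (locally 0).
Proof.
  intro He; apply filterlim_locally; intros eps.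
  destruct (Rpower_small_0 e eps He (cond_pos eps)) as [d [Hd H]].
  generalize (at_right_lt 0 d Hd); apply filter_imp; intros x Hx.
  unfold ball; simpl; unfold AbsRing_ball, abs, minus, plus, opp; simpl; rewrite Ropp_0, Rplus_0_r.
  rewrite Rabs_pos_eq by (left; apply exp_pos); apply H, Hx.
Qed.

Lemma Rpower_int (d b : R) (Fb : (R -> Prop) -> Prop) {FFb : Filter Fb} : 0 < d -> 0 < b ->
  spans (at_right 0) Fb (fun x => 0 < x) -> filter_le Fb (locally b) ->
  is_RInt_gen (fun x => Rpower x (d - 1)) (at_right 0) Fb (Rpower b d / d).
Proof.
  intros Hd Hb HD Hle; replace (Rpower b d / d) with (/ d * Rpower b d - / d * 0) by (field; lra).
  apply (is_RInt_gen_primitive _ _ _ (fun x => / d * Rpower x d) (fun x => 0 < x)); auto.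
  - intros x Hx; evar_last; [apply (is_derive_scal (fun x => Rpower x d)), Rpower_derive, Hx|].
    field; lra.
  - intros x Hx; apply Rpower_continuous, Hx.
  - apply (filterlim_comp _ _ _ (fun x => Rpower x d) (fun y => / d * y) _ (locally 0)); [apply Rpower_lim_0, Hd|].
    apply (continuous_scal_r (K := R_AbsRing) (V := R_NormedModule) (/ d) (fun x => x) 0), continuous_id.
  - eapply filterlim_filter_le_1; [exact Hle|].
    apply (continuous_scal_r (K := R_AbsRing) (V := R_NormedModule) (/ d) (fun x => Rpower x d) b), Rpower_continuous, Hb.
Qed.

Lemma Rpower_int_point (d b : R) : 0 < d -> 0 < b ->
  is_RInt_gen (fun x => Rpower x (d - 1)) (at_right 0) (at_point b) (Rpower b d / d).
Proof.
  intros Hd Hb; apply Rpower_int; auto.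
  - typeclasses eauto.
  - apply spans_point_r; [exact Hb|]; intros; lra.
  - intros P HP; exact (locally_singleton b P HP).
Qed.

Lemma Rpower_int_left (d b : R) : 0 < d -> 0 < b ->
  is_RInt_gen (fun x => Rpower x (d - 1)) (at_right 0) (at_left b) (Rpower b d / d).
Proof.
  intros Hd Hb; apply Rpower_int; auto.
  - typeclasses eauto.
  - apply spans_open; [exact Hb|]; intros; lra.
  - apply filter_le_within.
Qed.

Lemma CIntg_RtoC (Fa Fb : (R -> Prop) -> Prop) {FFa : Filter Fa} {FFb : Filter Fb} (g : R -> R) (m : R) :
  is_RInt_gen g Fa Fb m -> CIntg (fun x => RtoC (g x)) Fa Fb (RtoC m).
Proof.
  intros H P [e HP].
  assert (HP' : locally m (fun y => P (RtoC y))).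
  { exists e; intros y Hy; apply HP; split; [exact Hy|apply ball_center]. }
  generalize (H _ HP'); unfold filtermapi; apply filter_imp; intros [a b] [y [Hy HPy]].
  exists (RtoC y); split; [|exact HPy]; apply CInt_parts; split; simpl; [exact Hy|].
  evar_last; [apply (is_RInt_const (V := R_NormedModule))|]; unfold scal; simpl; unfold mult; simpl; ring.
Qed.

Lemma cp_cont (x : R) (w : C) : 0 < x -> Ccont (fun x => cp x w) x.
Proof. intro Hx; eapply Cderiv_cont, cp_deriv, Hx. Qed.

Lemma Cderiv_shift (F : R -> C) (a x : R) (l : C) : Cderiv F (a + x) l -> Cderiv (fun x => F (a + x)) x l.
Proof.
  intros [H1 H2]; split.
  - evar_last; [apply (is_derive_comp (fun t => fst (F t)) (fun x => a + x) x _ 1 H1); auto_derive; [auto|ring]|].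
    unfold scal; simpl; unfold mult; simpl; ring.
  - evar_last; [apply (is_derive_comp (fun t => snd (F t)) (fun x => a + x) x _ 1 H2); auto_derive; [auto|ring]|].
    unfold scal; simpl; unfold mult; simpl; ring.
Qed.

Lemma Cderiv_Csum (F : nat -> R -> C) (x : R) (l : nat -> C) (n : nat) :
  (forall k, Cderiv (F k) x (l k)) -> Cderiv (fun t => Csum (fun k => F k t) n) x (Csum l n).
Proof.
  intro H; induction n; [exact (Cderiv_const 0 x)|].
  exact (Cderiv_plus (fun t => Csum (fun k => F k t) n) (F n) x _ _ IHn (H n)).
Qed.

Section RealStrip.

Variables (zeta : C -> R -> C) (s : R).
Hypotheses (Hzeta : is_Hurwitz_zeta zeta) (Hs : 0 < s < 1).

Lemma cp_shift_deriv (n : nat) (x : R) (w : C) : 0 < x ->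
  Cderiv (fun x => cp (INR n + x) w) x (w * cp (INR n + x) (w - 1))%C.
Proof.
  intro Hx; apply (Cderiv_shift (fun x => cp x w)), cp_deriv; generalize (pos_INR n); lra.
Qed.

(** The second derivatives of the [zPhi s N] are bounded uniformly in N, so the quadratic estimate
    for the increment survives the limit, together with the limit of the first derivatives at x. *)
Lemma zeta_deriv (x : R) : 0 < x -> exists D, Cderiv (fun x => zeta s x) x D.
Proof.
  intro Hx.
  assert (Hn := one_minus_nz s ltac:(lra)).
  set (F1 := fun N t => (- s * Csum (fun n => cp (INR n + t) (- s - 1)) N - cp (INR N + t) (- s))%C).
  set (F2 := fun N t => (s * (s + 1) * Csum (fun n => cp (INR n + t) (- s - 2)) N + s * cp (INR N + t) (- s - 1))%C).
  assert (H1 : forall N t, 0 < t -> Cderiv (zPhi s N) t (F1 N t)).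
  { intros N t Ht; unfold zPhi, F1.
    apply Cderiv_ext with (Csum (fun n => - s * cp (INR n + t) (- s - 1)) N - / (1 - s) * ((1 - s) * cp (INR N + t) (1 - s - 1)))%C.
    - rewrite Csum_scal; replace (1 - s - 1)%C with (- s)%C by ring; field; exact Hn.
    - apply (Cderiv_minus (fun x => Csum (fun n => cp (INR n + x) (- s)) N) (fun x => cp (INR N + x) (1 - s) / (1 - s))%C).
      + apply (Cderiv_Csum (fun n x => cp (INR n + x) (- s))); intro k; apply cp_shift_deriv, Ht.
      + destruct (Cderiv_scal (/ (1 - s)) _ _ _ (cp_shift_deriv N t (1 - s) Ht)) as [G1 G2]; split;
          (eapply is_derive_ext; [|eassumption]); intro u; unfold Cdiv; rewrite Cmult_comm; reflexivity. }
  assert (H2 : forall N t, 0 < t -> Cderiv (F1 N) t (F2 N t)).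
  { intros N t Ht; unfold F1, F2.
    apply Cderiv_ext with (- s * Csum (fun n => (- s - 1) * cp (INR n + t) (- s - 1 - 1)) N - - s * cp (INR N + t) (- s - 1))%C.
    - rewrite Csum_scal; replace (- s - 1 - 1)%C with (- s - 2)%C by ring; ring.
    - apply (Cderiv_minus (fun x => - s * Csum (fun n => cp (INR n + x) (- s - 1)) N)%C (fun x => cp (INR N + x) (- s))).
      + apply Cderiv_scal, (Cderiv_Csum (fun n x => cp (INR n + x) (- s - 1))); intro k; apply cp_shift_deriv, Ht.
      + apply cp_shift_deriv, Ht. }
  (* For |h| < x/2 the segment from x to x + h stays in [lo, oo), where [F2] is bounded
     independently of N. *)
  set (lo := x / 2).
  destruct (power_sum lo (1 + s) ltac:(unfold lo; lra) ltac:(lra)) as [S2 HS2].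
  set (B := 2 * S2 + Rpower lo (- s - 1)).
  assert (HRe : forall e : R, Re (- RtoC s - RtoC e) = - s - e) by (intro; unfold Re; simpl; ring).
  assert (H3 : forall N t, lo <= t -> Cmod (F2 N t) <= B).
  { intros N t Ht; assert (HN := pos_INR N); unfold F2, B.
    assert (Hlo : 0 < lo) by (unfold lo; lra).
    eapply Rle_trans; [apply Cmod_triangle|]; rewrite !Cmod_mult; apply Rplus_le_compat.
    - rewrite <- RtoC_plus, !Cmod_R, !Rabs_pos_eq by lra; apply Rmult_le_compat; [nra|apply Cmod_ge_0|nra|].
      eapply Rle_trans; [|apply (proj1 (proj2 HS2) N)]; apply Cmod_Csum_le; intros k _.
      assert (Hk := pos_INR k); rewrite Cmod_cp, HRe.
      replace (- s - 2) with (- (1 + (1 + s))) by ring; apply Rpower_antitone; lra.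
    - rewrite Cmod_R, Rabs_pos_eq, Cmod_cp, HRe by lra; rewrite <- (Rmult_1_l (Rpower lo _)).
      apply Rmult_le_compat; [lra|left; apply exp_pos|lra|apply Rpower_antitone; lra]. }
  destruct (power_sum x s Hx ltac:(lra)) as [S1 HS1].
  destruct (series_dominated (fun n => cp (INR n + x) (- s - 1)) (fun n => Rpower (INR n + x) (- (1 + s))) S1) as [L [HL _]]; [|exact HS1|].
  { intro n; rewrite Cmod_cp, HRe; right; f_equal; ring. }
  exists (- s * L - 0)%C.
  assert (HF1 : Clim (fun N => F1 N x) (- s * L - 0)%C).
  { apply Clim_minus; [apply Clim_scal, HL|]; apply cp_lim_0; [exact Hx|unfold Re; simpl; lra]. }
  apply Cderiv_quadratic with B lo; [unfold lo; lra|]; intros h Hh; apply Rabs_lt_between in Hh.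
  replace (zeta s (x + h)%R - zeta s x - RtoC h * (- s * L - 0))%C
    with ((zeta s (x + h)%R - zeta s x - RtoC h * (- s * L - 0)) - 0)%C by ring.
  apply Clim_le with (u := fun N => (zPhi s N (x + h) - zPhi s N x - RtoC h * F1 N x)%C).
  - apply Clim_minus; [|apply Clim_scal, HF1].
    apply Clim_minus; apply (zeta_real_lim zeta _ s Hzeta); auto; unfold lo in *; lra.
  - exists O; intros N _; rewrite Cminus_0_r.
    apply (Cderiv_second_order (zPhi s N) (F1 N) (F2 N)); intros t Ht.
    assert (lo <= t).
    { eapply Rle_trans; [|apply Ht]; apply Rmin_glb; unfold lo in *; lra. }
    assert (0 < t) by (unfold lo in *; lra); auto.
Qed.

(** Starting from [S N] keeps the term with n = 0, which is singular as x tends to 0, out of the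
    tail. The bound therefore holds uniformly down to x = 0, and the limit can be integrated over
    (0,1). *)
Lemma zeta_tail : exists A S, is_sum A S /\ forall N x, 0 < x -> Cmod (zeta s x - zPhi s (Datatypes.S N) x) <= S - Rsum A N.
Proof.
  destruct (power_sum 1 s ltac:(lra) ltac:(lra)) as [S HS].
  exists (fun n => Rpower (INR n + 1) (- (1 + s))), S; split; [exact HS|]; intros N x Hx.
  apply Clim_le with (1 := zeta_real_lim zeta x s Hzeta Hx Hs).
  exists (Datatypes.S N); intros M HM.
  replace M with (Datatypes.S N + (M - Datatypes.S N))%nat by lia; set (m := (M - Datatypes.S N)%nat).
  rewrite !zPhi_zq, Csum_app by lra.
  match goal with |- Cmod ?z <= _ => replace z with (/ (1 - s) * Csum (fun k => zq (INR (Datatypes.S N + k) + x) s) m)%C by ring end.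
  rewrite Cmod_mult, Cmod_inv by (apply one_minus_nz; lra).
  rewrite <- RtoC_minus, Cmod_R, Rabs_pos_eq by lra.
  apply Rle_trans with (Rsum (fun k => Rpower (INR (N + k) + 1) (- (1 + s))) m).
  - rewrite Rmult_comm; apply Rle_div_l; [lra|]; rewrite Rmult_comm, <- Rsum_scal.
    apply Cmod_Csum_le; intros k _.
    assert (HNk := pos_INR (N + k)).
    rewrite Nat.add_succ_l, S_INR.
    eapply Rle_trans; [apply zq_bound; simpl; lra|].
    rewrite <- RtoC_minus, !Cmod_R, !Rabs_pos_eq by lra; simpl Re.
    rewrite Rmult_assoc; apply Rmult_le_compat_l; [lra|].
    rewrite <- (Rmult_1_l (Rpower (INR (N + k) + 1) _)).
    apply Rmult_le_compat; [lra|left; apply exp_pos|lra|apply Rpower_antitone; lra].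
  - destruct HS as [_ [HS _]]; specialize (HS (N + m)%nat); rewrite Rsum_app in HS; lra.
Qed.

(** Only the first term x^(-s) of the series is singular at 0, and its exponent exceeds -1. *)
Lemma zeta_dominated : exists g m, is_RInt_gen g (at_right 0) (at_left 1) m /\
  forall x, 0 < x < 1 -> Cmod (zeta s x) <= g x.
Proof.
  destruct zeta_tail as (A & S & HS & HT).
  exists (fun x => Rpower x (1 - s - 1) + (Rpower 2 (1 - s) / (1 - s) + S)); eexists; split.
  - apply (is_RInt_gen_plus (V := R_NormedModule)); [apply Rpower_int_left; lra|apply is_RInt_gen_const_01].
  - intros x Hx; specialize (HT O x ltac:(lra)); simpl Rsum in HT; rewrite Rminus_0_r in HT.
    generalize (Cmod_minus_ge (zeta s x) (zPhi s 1 x)); intro H.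
    assert (HP : Cmod (zPhi s 1 x) <= Rpower x (1 - s - 1) + Rpower 2 (1 - s) / (1 - s)).
    { unfold zPhi; simpl Csum; simpl INR; eapply Rle_trans; [apply Cmod_minus_le|]; apply Rplus_le_compat.
      - rewrite Cplus_0_l, Rplus_0_l, Cmod_cp; right; f_equal; unfold Re; simpl; ring.
      - rewrite Cmod_div by (apply one_minus_nz; lra).
        rewrite <- RtoC_minus, Cmod_R, Rabs_pos_eq, Cmod_cp by lra; simpl Re.
        unfold Rdiv; apply Rmult_le_compat_r; [left; apply Rinv_0_lt_compat; lra|].
        unfold Rpower; apply exp_le_compat, Rmult_le_compat_l; [lra|]; apply ln_le; lra. }
    lra.
Qed.

(** * Fourier coefficients of zeta(s, x) by unfolding *)

Section Coefficient.

Variable k : Z.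

Let U (b : R) : C := RInt_gen (V := C_R_CompleteNormedModule) (fun y => cp y (- s) * Fourier_exp (- k) y)%C (at_right 0) (at_point b).

Lemma U_int (b : R) : 0 < b -> CIntg (fun y => cp y (- s) * Fourier_exp (- k) y)%C (at_right 0) (at_point b) (U b).
Proof.
  intro Hb.
  assert (HD : spans (at_right 0) (at_point b) (fun x => 0 < x)) by (apply spans_point_r; [exact Hb|intros; lra]).
  destruct (CIntg_dominated (fun y => cp y (- s) * Fourier_exp (- k) y)%C (fun x => Rpower x (1 - s - 1)) _ (Rpower b (1 - s) / (1 - s)) HD) as [l [Hl _]];
    [| |apply (Rpower_int_point (1 - s) b); lra|].
  - intros; apply Ccont_mult; [apply cp_cont; assumption|apply Fourier_exp_cont].
  - intros x Hx; rewrite Cmod_mult, Cmod_Fourier_exp, Cmod_cp, Rmult_1_r; right; f_equal; unfold Re; simpl; ring.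
  - replace (U b) with l; [exact Hl|symmetry; exact (RInt_gen_CIntg _ _ _ l Hl)].
Qed.

Lemma Fourier_exp_shift_nat (n : nat) (m : Z) (x : R) : Fourier_exp m (INR n + x) = Fourier_exp m x.
Proof.
  rewrite Fourier_exp_add; replace (Fourier_exp m (INR n)) with (Fourier_exp (m * Z.of_nat n) 1).
  - rewrite Fourier_exp_at_1; ring.
  - unfold Fourier_exp; rewrite mult_IZR, <- INR_IZR_INZ; do 3 f_equal; ring.
Qed.

(** Translation by n maps (0,1) to (n, n + 1) and leaves the exponential unchanged, so the integrals
    of the terms join to one over (0, N + 1). *)
Lemma power_sum_int (N : nat) :
  CIntg (fun x => Csum (fun n => cp (INR n + x) (- s)) (S N) * Fourier_exp (- k) x)%C (at_right 0) (at_left 1) (U (INR (S N))).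
Proof.
  assert (HD01 : spans (at_right 0) (at_left 1) (fun x => 0 < x < 1)) by (apply spans_open; [lra|auto]).
  induction N.
  - apply CIntg_ext with (f := fun y => (cp y (- s) * Fourier_exp (- k) y)%C) (D := fun x => 0 < x < 1); [exact HD01| |].
    + intros x _; simpl; rewrite Rplus_0_l; ring.
    + apply (CIntg_point_left (at_right 0) _ 1 (1 / 2)); [lra| |apply (U_int 1); lra].
      intros; apply Ccont_mult; [apply cp_cont; lra|apply Fourier_exp_cont].
  - set (f := fun y => (cp y (- s) * Fourier_exp (- k) y)%C).
    assert (HN : 0 < INR (S N)) by (apply lt_0_INR; lia).
    assert (HN1 : INR (S (S N)) = INR (S N) + 1) by apply S_INR.
    assert (Hfc : forall y, 0 < y -> Ccont f y) by (intros; apply Ccont_mult; [apply cp_cont; assumption|apply Fourier_exp_cont]).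
    destruct (ex_CInt f (INR (S N)) (INR (S (S N)))) as [V HV].
    { intros y Hy; rewrite Rmin_left in Hy by lra; apply Hfc; lra. }
    replace (U (INR (S (S N)))) with (U (INR (S N)) + V)%C.
    2:{ assert (HU2 : CIntg f (at_right 0) (at_point (INR (S (S N)))) (U (INR (S (S N))))) by (apply U_int; lra).
        refine (CIntg_unique f _ _ _ HU2).
        apply (CIntg_Chasles _ _ f (INR (S N))); [apply U_int, HN|apply CIntg_at_point, HV]. }
    apply CIntg_ext with (f := fun x => (Csum (fun n => cp (INR n + x) (- s)) (S N) * Fourier_exp (- k) x + f (x + INR (S N))%R)%C) (D := fun x => 0 < x < 1); [exact HD01| |].
    + intros x _; unfold f; rewrite (Rplus_comm x), Fourier_exp_shift_nat.
      change (Csum ?u (S (S N))) with (Csum u (S N) + u (S N))%C; cbv beta; ring.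
    + apply CIntg_plus; [exact IHN|].
      apply CIntg_of_CInt; [lra| |apply CInt_shift; rewrite Rplus_0_l, (Rplus_comm 1), <- HN1; exact HV].
      intros x Hx; unfold f; apply Ccont_mult.
      * eapply Cderiv_cont; eapply Cderiv_ext; [reflexivity|].
        assert (HC := Cderiv_shift (fun x => cp x (- s)) (INR (S N)) x _ (cp_deriv (INR (S N) + x) (- s) ltac:(lra))).
        destruct HC as [C1 C2]; split; (eapply is_derive_ext; [|eassumption]); intro t; cbv beta; rewrite (Rplus_comm t); reflexivity.
      * apply (continuous_ext (Fourier_exp (- k))); [|apply Fourier_exp_cont].
        intro t; rewrite (Rplus_comm t), Fourier_exp_shift_nat; reflexivity.
Qed.

Let dk : C := if Z.eq_dec k 0 then RtoC 1 else RtoC 0.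

(** On [0,1] the correction (b + x)^(1-s) / (1 - s) differs from its value at x = 0 by at most
    b^(-s). Up to this error, collected in [r], it affects the coefficient with k = 0 only. *)
Lemma zPhi_int (N : nat) : exists r, Cmod r <= Rpower (INR (S N)) (- s) /\
  CIntg (fun x => zPhi s (S N) x * Fourier_exp (- k) x)%C (at_right 0) (at_left 1)
    (U (INR (S N)) - dk * (cp (INR (S N)) (1 - s) / (1 - s)) - r)%C.
Proof.
  assert (HD01 : spans (at_right 0) (at_left 1) (fun x => 0 < x < 1)) by (apply spans_open; [lra|auto]).
  assert (Hn := one_minus_nz s ltac:(lra)).
  set (b := INR (S N)); assert (Hb : 0 < b) by (apply lt_0_INR; lia).
  set (rho := fun x => ((cp (b + x) (1 - s) - cp b (1 - s)) / (1 - s) * Fourier_exp (- k) x)%C).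
  assert (Hrc : forall x, 0 <= x <= 1 -> Ccont rho x).
  { intros x Hx; apply Ccont_mult; [|apply Fourier_exp_cont].
    apply Ccont_mult; [|apply Ccont_const]; apply Ccont_minus; [|apply Ccont_const].
    eapply Cderiv_cont, (Cderiv_shift (fun x => cp x (1 - s))), cp_deriv; lra. }
  destruct (ex_CInt rho 0 1) as [r Hr]; [intros x Hx; rewrite Rmin_left, Rmax_right in Hx by lra; apply Hrc, Hx|].
  exists r; split.
  - replace (Rpower b (- s)) with (Rpower b (- s) * (1 - 0)) by ring.
    apply (CInt_norm_const rho); [lra| |exact Hr]; intros x Hx.
    unfold rho; rewrite Cmod_mult, Cmod_Fourier_exp, Rmult_1_r, Cmod_div by exact Hn.
    assert (H := cp_diff b (b + x) (1 - s) ltac:(lra) ltac:(unfold Re; simpl; lra)).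
    rewrite <- RtoC_minus, Cmod_R, Rabs_pos_eq in * by lra; simpl Re in H.
    apply Rle_div_l; [lra|]; eapply Rle_trans; [exact H|].
    replace (1 - s - 1) with (- s) by ring; replace (b + x - b) with x by ring.
    assert (0 < Rpower b (- s)) by apply exp_pos.
    assert (0 <= (1 - s) * Rpower b (- s)) by nra; nra.
  - assert (Hc : CIntg (fun x => cp b (1 - s) / (1 - s) * Fourier_exp (- k) x)%C (at_right 0) (at_left 1) (cp b (1 - s) / (1 - s) * dk)%C).
    { apply CIntg_scal, CIntg_of_CInt; [lra|intros; apply Fourier_exp_cont|].
      generalize (Fourier_exp_int (- k)); unfold dk; destruct (Z.eq_dec (- k) 0), (Z.eq_dec k 0); try lia; auto. }
    replace (U b - dk * (cp b (1 - s) / (1 - s)) - r)%C with (U b - (cp b (1 - s) / (1 - s) * dk + r))%C by ring.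
    apply CIntg_ext with (f := fun x => (Csum (fun n => cp (INR n + x) (- s)) (S N) * Fourier_exp (- k) x
       - (cp b (1 - s) / (1 - s) * Fourier_exp (- k) x + rho x))%C) (D := fun x => 0 < x < 1); [exact HD01| |].
    + intros x _; unfold zPhi, rho; fold b; field; exact Hn.
    + apply CIntg_minus; [apply power_sum_int|]; apply CIntg_plus; [exact Hc|].
      apply CIntg_of_CInt; [lra|exact Hrc|exact Hr].
Qed.

Lemma zeta_coeff_real :
  is_Fourier_coeff (fun x => zeta s x) k
    (if Z.eq_dec k 0 then RtoC 0 else (Cexp ((s - 1) * Clog (two_pi_i k)) * CGamma (1 - s))%C).
Proof.
  assert (HD01 : spans (at_right 0) (at_left 1) (fun x => 0 < x < 1)) by (apply spans_open; [lra|auto]).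
  assert (Hn := one_minus_nz s ltac:(lra)).
  destruct zeta_dominated as (g & m & Hg & Hgz).
  assert (Hc : forall x, 0 < x < 1 -> Ccont (fun x => zeta s x) x).
  { intros x Hx; destruct (zeta_deriv x ltac:(lra)) as [D HD]; apply (Cderiv_cont _ _ _ HD). }
  destruct (CIntg_dominated (fun x => zeta s x * Fourier_exp (- k) x)%C g _ m HD01) as [c [Hcint _]]; [| |exact Hg|].
  { intros; apply Ccont_mult; [auto|apply Fourier_exp_cont]. }
  { intros; rewrite Cmod_mult, Cmod_Fourier_exp, Rmult_1_r; auto. }
  destruct zeta_tail as (A & S & HS & HT).
  assert (HL : Clim (fun N => U (INR (Datatypes.S N)) - dk * (cp (INR (Datatypes.S N)) (1 - s) / (1 - s)))%C c).
  { apply Clim_squeeze with (fun N => (S - Rsum A N) + Rpower (INR (Datatypes.S N)) (- s)).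
    - intro N; destruct (zPhi_int N) as (r & Hr & HI).
      set (u := (U (INR (Datatypes.S N)) - dk * (cp (INR (Datatypes.S N)) (1 - s) / (1 - s)))%C) in *.
      assert (HB : Cmod (c - (u - r)) <= S - Rsum A N).
      { apply (CIntg_norm_le (fun x => zeta s x * Fourier_exp (- k) x - zPhi s (Datatypes.S N) x * Fourier_exp (- k) x)%C (fun _ => S - Rsum A N) _ _ _ HD01).
        - intros x Hx.
          replace (zeta s x * Fourier_exp (- k) x - zPhi s (Datatypes.S N) x * Fourier_exp (- k) x)%C
            with ((zeta s x - zPhi s (Datatypes.S N) x) * Fourier_exp (- k) x)%C by ring.
          rewrite Cmod_mult, Cmod_Fourier_exp, Rmult_1_r; apply HT; lra.
        - apply CIntg_minus; assumption.
        - apply is_RInt_gen_const_01. }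
      replace (u - c)%C with (r - (c - (u - r)))%C by ring.
      eapply Rle_trans; [apply Cmod_minus_le|]; lra.
    - replace (Finite 0) with (Finite (0 + 0)) by (f_equal; ring).
      apply is_lim_seq_plus'; [apply is_sum_lim, HS|].
      apply (is_lim_seq_incr_1 (fun N => Rpower (INR N) (- s))).
      apply is_lim_seq_spec; intros e; destruct (Rpower_small_infty s e ltac:(lra) (cond_pos e)) as [M [HM0 HM]].
      destruct (INR_unbounded M) as [N HN]; exists N; intros n Hn'; rewrite Rminus_0_r, Rabs_pos_eq by (left; apply exp_pos).
      apply HM; assert (INR N <= INR n) by (apply le_INR, Hn'); lra. }
  unfold is_Fourier_coeff; revert HL; unfold dk; destruct (Z.eq_dec k 0) as [Hk|Hk]; intro HL.
  (* For k = 0 the truncated integral of y^(-s) equals the correction b^(1-s) / (1 - s) exactly, so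
     every approximant is 0. *)
  - replace (RtoC 0) with c; [exact Hcint|].
    apply (Clim_unique _ _ _ HL), Clim_ext with (fun _ => RtoC 0); [|apply Clim_const].
    intro N; set (b := INR (Datatypes.S N)); assert (Hb : 0 < b) by (apply lt_0_INR; lia).
    replace (U b) with (cp b (1 - s) / (1 - s))%C; [ring|].
    assert (Hs1 : 0 < 1 - s) by lra.
    assert (H := CIntg_RtoC (at_right 0) (at_point b) _ _ (Rpower_int_point (1 - s) b Hs1 Hb)).
    rewrite RtoC_div, <- cp_RtoC, RtoC_minus in H by lra.
    refine (CIntg_unique (fun y => cp y (- s) * Fourier_exp (- k) y)%C _ _ _ (U_int b Hb)).
    apply (CIntg_ext (fun x => RtoC (Rpower x (1 - s - 1))) _ (fun x => 0 < x)); [apply spans_point_r; [exact Hb|intros; lra]| |exact H].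
    intros x Hx; rewrite Hk, Fourier_exp_0, Cmult_1_r, <- RtoC_opp, cp_RtoC; do 2 f_equal; ring.
  - replace (_ * CGamma _)%C with c; [exact Hcint|].
    apply (Clim_unique (fun N => U (INR (Datatypes.S N)))).
    + eapply Clim_ext; [|exact HL]; intro N; simpl; ring.
    + apply Mellin_Fourier; auto; intro n; apply U_int, lt_0_INR; lia.
Qed.

End Coefficient.

Lemma Hurwitz_formula_real (al : R) : 0 < al < 1 ->
  Clim (symsum (fun n => Fourier_exp n al * (Cexp ((s - 1) * Clog (two_pi_i n)) * CGamma (1 - s)))%C) (zeta s al).
Proof.
  intro Hal.
  destruct zeta_dominated as (g & m & Hg & Hgz).
  destruct (zeta_deriv al ltac:(lra)) as [D HD].
  set (c := fun k : Z => if Z.eq_dec k 0 then RtoC 0 else (Cexp ((s - 1) * Clog (two_pi_i k)) * CGamma (1 - s))%C).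
  assert (Hc : forall x, 0 < x < 1 -> Ccont (fun x => zeta s x) x).
  { intros x Hx; destruct (zeta_deriv x ltac:(lra)) as [D' HD']; apply (Cderiv_cont _ _ _ HD'). }
  assert (H := Dini_criterion (fun x => zeta s x) g m al D c Hal Hc Hgz Hg HD zeta_coeff_real).
  eapply Clim_ext; [|exact H].
  intro N; cbv beta; change (c 0%Z) with (RtoC 0); rewrite Cplus_0_l.
  apply Csum_ext; intros j _; unfold c.
  destruct (Z.eq_dec (Z.of_nat (S j)) 0); [lia|]; destruct (Z.eq_dec (- Z.of_nat (S j)) 0); [lia|]; reflexivity.
Qed.

End RealStrip.

(** * Fourier series with slowly varying coefficients *)

(** Interpolation between the Lipschitz bound and the trivial bound 2: with u = M y, both u for u <=
    1 and the constant 1 for u > 1 are at most u^d. The separate [y] stands for the distance of x to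
    0 or to 1. *)
Lemma Fourier_exp_Holder (m : Z) (x y M d : R) :
  0 < d <= 1 -> 0 < y -> 1 <= M -> Rabs (IZR m) <= M -> Cmod (Fourier_exp m x - 1) <= 2 * PI * (Rabs (IZR m) * y) ->
  Cmod (Fourier_exp m x - 1) <= 2 * PI * (Rpower M d * Rpower y d).
Proof.
  intros Hd Hy HM Hm H; assert (HP := PI2_3_2).
  assert (E : Rpower M d * Rpower y d = Rpower (M * y) d).
  { unfold Rpower; rewrite <- exp_plus, ln_mult by lra; f_equal; ring. }
  rewrite E; set (u := M * y); assert (Hu : 0 < u) by (unfold u; nra).
  destruct (Rle_lt_dec u 1) as [h|h].
  - eapply Rle_trans; [exact H|]; apply Rmult_le_compat_l; [lra|].
    apply Rle_trans with u; [unfold u; apply Rmult_le_compat_r; lra|].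
    rewrite <- (Rpower_1 u Hu) at 1; unfold Rpower; apply exp_le_compat.
    assert (ln u <= 0) by (rewrite <- ln_1; apply ln_le; lra); nra.
  - apply Rle_trans with 2.
    + eapply Rle_trans; [apply Cmod_minus_le|]; rewrite Cmod_Fourier_exp, Cmod_1; lra.
    + assert (1 <= Rpower u d); [|nra].
      unfold Rpower; rewrite <- exp_0; apply exp_le_compat.
      assert (0 < ln u) by (rewrite <- ln_1; apply ln_increasing; lra); nra.
Qed.

Lemma Rpower_reflect_int (d : R) : 0 < d -> 
  is_RInt_gen (fun x => Rpower (1 - x) (d - 1)) (at_right 0) (at_left 1) (/ d).
Proof.
  intro Hd; replace (/ d) with (- / d * 0 - - / d * 1) by ring.
  assert (Hder : forall x, x < 1 -> is_derive (fun x => - / d * Rpower (1 - x) d) x (Rpower (1 - x) (d - 1))).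
  { intros x Hx.
    evar_last; [apply (is_derive_scal (fun x => Rpower (1 - x) d)), (is_derive_comp (fun y => Rpower y d) (fun x => 1 - x) x _ (-1) (Rpower_derive (1 - x) d ltac:(lra)))|].
    - auto_derive; [auto|ring].
    - unfold scal; simpl; unfold mult; simpl; field; lra. }
  apply (is_RInt_gen_primitive _ _ _ (fun x => - / d * Rpower (1 - x) d) (fun x => x < 1)).
  - apply spans_open; [lra|]; intros; lra.
  - exact Hder.
  - intros x Hx; apply (continuous_comp (fun x => 1 - x) (fun y => Rpower y (d - 1))).
    + apply (continuous_minus (V := R_NormedModule) (fun _ => 1) (fun x => x)); [apply continuous_const|apply continuous_id].
    + apply Rpower_continuous; lra.
  - eapply filterlim_filter_le_1; [apply filter_le_within|].
    assert (H := ex_derive_continuous (K := R_AbsRing) (V := R_NormedModule) (fun x => - / d * Rpower (1 - x) d) 0 (ex_intro _ _ (Hder 0 Rlt_0_1))).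
    unfold continuous in H; replace (- / d * 1) with (- / d * Rpower (1 - 0) d); [exact H|].
    f_equal; unfold Rpower; rewrite Rminus_0_r, ln_1, Rmult_0_r, exp_0; reflexivity.
  - apply (filterlim_comp _ _ _ (fun x => Rpower (1 - x) d) (fun y => - / d * y) _ (locally 0)).
    + apply (filterlim_comp _ _ _ (fun x => 1 - x) (fun y => Rpower y d) _ (at_right 0)); [|apply Rpower_lim_0, Hd].
      intros P HP; destruct (at_right_elim _ _ HP) as [r [Hr HPr]]; unfold filtermap.
      generalize (at_left_lt (1 - r) 1 ltac:(lra)); apply filter_imp; intros x Hx; apply HPr; lra.
    + apply (continuous_scal_r (K := R_AbsRing) (V := R_NormedModule) (- / d) (fun x => x) 0), continuous_id.
Qed.

(** The weight (n + 1)^d on the differences is what makes the summed-by-parts series decay like a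
    power d at the ends. The two sides of 0 are controlled separately, as the phase of (2 pi i
    n)^(s-1) jumps between them. *)
Definition slowly_varying (c : Z -> C) (A : nat -> R) (d SA : R) : Prop :=
  c 0%Z = RtoC 0 /\ 0 < d <= 1 /\
  (forall n : nat, Cmod (c (Z.of_nat (S n)) - c (Z.of_nat n)) <= A n) /\
  (forall n : nat, Cmod (c (- Z.of_nat (S n))%Z - c (- Z.of_nat n)%Z) <= A n) /\
  is_sum (fun n => A n * Rpower (INR n + 1) d) SA /\
  Clim (fun n => c (Z.of_nat n)) 0 /\ Clim (fun n => c (- Z.of_nat n)%Z) 0.

Section SlowlyVarying.

Variables (c : Z -> C) (A : nat -> R) (d SA : R).
Hypothesis Hc : slowly_varying c A d SA.

Let Hc0 := proj1 Hc.
Let Hd := proj1 (proj2 Hc).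
Let HAp := proj1 (proj2 (proj2 Hc)).
Let HAm := proj1 (proj2 (proj2 (proj2 Hc))).
Let HS := proj1 (proj2 (proj2 (proj2 (proj2 Hc)))).
Let Hcp := proj1 (proj2 (proj2 (proj2 (proj2 (proj2 Hc))))).
Let Hcm := proj2 (proj2 (proj2 (proj2 (proj2 (proj2 Hc))))).

(** One difference from each side of 0, so that the partial sums follow the symmetric partial sums.
    Over all n >= 0 the exponents -n and n + 1 run through every integer once. *)
Definition BV_term (n : nat) (x : R) : C :=
  ((c (- Z.of_nat (S n))%Z - c (- Z.of_nat n)%Z) * Fourier_exp (- Z.of_nat n) x
   - (c (Z.of_nat (S n)) - c (Z.of_nat n)) * Fourier_exp (Z.of_nat (S n)) x)%C.

(* (e^{2 pi i x} - 1) sum c_n e^{2 pi i n x}, summed by parts *)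
Definition BV_sum (x : R) : C := Cser (fun n => BV_term n x).

Lemma A_pos n : 0 <= A n.
Proof. eapply Rle_trans; [apply Cmod_ge_0|apply HAp]. Qed.

Lemma A_sum : exists S, is_sum (fun n => 2 * A n) S.
Proof.
  assert (HP : forall n, 1 <= Rpower (INR n + 1) d).
  { intro n; assert (Hn := pos_INR n); unfold Rpower; apply Rle_trans with (exp 0); [rewrite exp_0; lra|]; apply exp_le_compat.
    assert (0 <= ln (INR n + 1)) by (rewrite <- ln_1; apply ln_le; lra); apply Rmult_le_pos; lra. }
  destruct (is_sum_le A (fun n => A n * Rpower (INR n + 1) d) SA) as [S H]; [|exact HS|].
  - intro n; split; [apply A_pos|]; rewrite <- (Rmult_1_r (A n)) at 1; apply Rmult_le_compat_l; [apply A_pos|apply HP].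
  - exists (2 * S); apply is_sum_scal; [lra|exact H].
Qed.

Lemma BV_term_bound n x : Cmod (BV_term n x) <= 2 * A n.
Proof.
  unfold BV_term; eapply Rle_trans; [apply Cmod_minus_le|].
  rewrite !Cmod_mult, !Cmod_Fourier_exp, !Rmult_1_r; generalize (HAp n) (HAm n); lra.
Qed.

Lemma BV_sum_lim x : Clim (Csum (fun n => BV_term n x)) (BV_sum x).
Proof.
  destruct A_sum as [S H]; apply Cser_dominated with (fun n => 2 * A n) S; [intro; apply BV_term_bound|exact H].
Qed.

Lemma BV_term_cont n x : Ccont (BV_term n) x.
Proof. apply Ccont_minus; apply Ccont_mult; [apply Ccont_const|apply Fourier_exp_cont|apply Ccont_const|apply Fourier_exp_cont]. Qed.

Lemma BV_sum_cont x : Ccont BV_sum x.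
Proof.
  destruct A_sum as [S H]; apply Ccont_eps; intros e He.
  destruct (proj2 (proj2 H) (e / 3) ltac:(lra)) as [N HN]; specialize (HN N (le_n _)).
  assert (HT : forall y, Cmod (BV_sum y - Csum (fun n => BV_term n y) N) < e / 3).
  { intro y; eapply Rle_lt_trans; [apply (Clim_series_bound _ (fun n => 2 * A n) S); [intro; apply BV_term_bound|exact H|apply BV_sum_lim]|lra]. }
  assert (HC : Ccont (fun y => Csum (fun n => BV_term n y) N) x).
  { clear; induction N; [apply (Ccont_const 0)|].
    apply (Ccont_plus (fun y => Csum (fun n => BV_term n y) N) (BV_term N)); [exact IHN|apply BV_term_cont]. }
  generalize (proj1 (Ccont_eps _ _) HC (e / 3) ltac:(lra)); apply filter_imp; intros y Hy.
  set (u := Csum (fun n => BV_term n y) N) in *; set (v := Csum (fun n => BV_term n x) N) in *.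
  generalize (HT y) (HT x) (Cmod_triangle3 (BV_sum y) u (BV_sum x)) (Cmod_triangle3 u v (BV_sum x)).
  rewrite (Cmod_minus_sym v (BV_sum x)); fold u v; lra.
Qed.

(** Multiplication by e(x) shifts all frequencies by one, which accounts for the asymmetric boundary
    frequencies N + 1 and -N. *)
Lemma summation_by_parts (x : R) (N : nat) :
  ((Fourier_exp 1 x - 1) * symsum (fun n => Fourier_exp n x * c n) N)%C =
  (Csum (fun n => BV_term n x) N + (c (Z.of_nat N) * Fourier_exp (Z.of_nat (S N)) x
    - c (- Z.of_nat N)%Z * Fourier_exp (- Z.of_nat N) x))%C.
Proof.
  induction N.
  - unfold symsum; simpl Csum; simpl (Z.of_nat 0); simpl (- 0)%Z; rewrite Hc0; ring.
  - change (symsum ?u (S N)) with (symsum u N + (u (Z.of_nat (S N)) + u (- Z.of_nat (S N))%Z))%C; cbv beta.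
    rewrite Cmult_plus_distr_l, IHN.
    change (Csum ?u (S N)) with (Csum u N + u N)%C; cbv beta; unfold BV_term.
    replace (Fourier_exp (Z.of_nat (S (S N))) x) with (Fourier_exp 1 x * Fourier_exp (Z.of_nat (S N)) x)%C
      by (rewrite <- Fourier_exp_plus; f_equal; lia).
    replace (Fourier_exp (- Z.of_nat N) x) with (Fourier_exp 1 x * Fourier_exp (- Z.of_nat (S N)) x)%C
      by (rewrite <- Fourier_exp_plus; f_equal; lia).
    ring.
Qed.

Lemma boundary_lim x : Clim (fun N => (c (Z.of_nat N) * Fourier_exp (Z.of_nat (S N)) x
    - c (- Z.of_nat N)%Z * Fourier_exp (- Z.of_nat N) x))%C 0.
Proof.
  apply Clim_squeeze with (fun N => Cmod (c (Z.of_nat N) - 0) + Cmod (c (- Z.of_nat N)%Z - 0)).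
  - intro N; rewrite !Cminus_0_r; eapply Rle_trans; [apply Cmod_minus_le|].
    rewrite !Cmod_mult, !Cmod_Fourier_exp; lra.
  - replace (Finite 0) with (Finite (0 + 0)) by (f_equal; ring); apply is_lim_seq_plus'; apply Clim_abs; assumption.
Qed.

Lemma symsum_BV_lim x : Clim (fun N => (Fourier_exp 1 x - 1) * symsum (fun n => Fourier_exp n x * c n) N)%C (BV_sum x).
Proof.
  eapply Clim_ext; [intro N; symmetry; apply summation_by_parts|].
  replace (BV_sum x) with (BV_sum x + 0)%C by ring; apply Clim_plus; [apply BV_sum_lim|apply boundary_lim].
Qed.

(** At x = 0 the factor e(x) - 1 kills every partial sum before the limit is taken; this zero is
    what the decay at the ends is measured from. *)
Lemma BV_sum_0 : BV_sum 0 = RtoC 0.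
Proof.
  apply (Clim_unique _ _ _ (symsum_BV_lim 0)), Clim_ext with (fun _ => RtoC 0); [|apply Clim_const].
  intro n; rewrite Fourier_exp_at_0; ring.
Qed.

(** The parameter [y] serves both ends, as x near 0 and, by periodicity, as 1 - x near 1. The
    constant 4 pi is 2 pi for each of the two differences in a term. *)
Lemma BV_sum_Holder (x y : R) : 0 < y ->
  (forall m, Cmod (Fourier_exp m x - 1) <= 2 * PI * (Rabs (IZR m) * y)) ->
  Cmod (BV_sum x) <= 4 * PI * SA * Rpower y d.
Proof.
  intros Hy Hlip; assert (HP := PI_RGT_0).
  replace (BV_sum x) with (BV_sum x - BV_sum 0)%C by (rewrite BV_sum_0; ring).
  replace (BV_sum x - BV_sum 0)%C with ((BV_sum x - BV_sum 0) - 0)%C by ring.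
  apply Clim_le with (1 := Clim_minus _ _ _ _ (BV_sum_lim x) (BV_sum_lim 0)).
  exists O; intros N _; rewrite Cminus_0_r, <- Csum_minus.
  apply Rle_trans with (Rsum (fun n => (4 * PI * Rpower y d) * (A n * Rpower (INR n + 1) d)) N).
  - apply Cmod_Csum_le; intros n _; assert (Hn := pos_INR n); unfold BV_term; rewrite !Fourier_exp_at_0.
    set (u := (c (- Z.of_nat (S n))%Z - c (- Z.of_nat n)%Z)%C); set (v := (c (Z.of_nat (S n)) - c (Z.of_nat n))%C).
    match goal with |- Cmod ?z <= _ => replace z with (u * (Fourier_exp (- Z.of_nat n) x - 1) - v * (Fourier_exp (Z.of_nat (S n)) x - 1))%C by ring end.
    assert (HE : forall m, Rabs (IZR m) <= INR n + 1 -> Cmod (Fourier_exp m x - 1) <= 2 * PI * (Rpower (INR n + 1) d * Rpower y d)).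
    { intros m Hm; apply Fourier_exp_Holder; auto; lra. }
    eapply Rle_trans; [apply Cmod_minus_le|]; rewrite !Cmod_mult.
    assert (E1 := HE (- Z.of_nat n)%Z ltac:(rewrite opp_IZR, Rabs_Ropp, <- INR_IZR_INZ, Rabs_pos_eq; lra)).
    assert (E2 := HE (Z.of_nat (S n)) ltac:(rewrite <- INR_IZR_INZ, S_INR, Rabs_pos_eq; lra)).
    apply Rle_trans with (A n * (2 * PI * (Rpower (INR n + 1) d * Rpower y d)) + A n * (2 * PI * (Rpower (INR n + 1) d * Rpower y d))); [|right; ring].
    apply Rplus_le_compat; apply Rmult_le_compat; try apply Cmod_ge_0; [apply HAm|exact E1|apply HAp|exact E2].
  - rewrite Rsum_scal; replace (4 * PI * SA * Rpower y d) with ((4 * PI * Rpower y d) * SA) by ring.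
    apply Rmult_le_compat_l; [|apply HS].
    assert (0 < Rpower y d) by apply exp_pos; nra.
Qed.

Lemma BV_sum_left x : 0 < x -> Cmod (BV_sum x) <= 4 * PI * SA * Rpower x d.
Proof.
  intro Hx; apply BV_sum_Holder; [exact Hx|]; intro m.
  eapply Rle_trans; [apply Fourier_exp_lip|]; rewrite (Rabs_pos_eq x); lra.
Qed.

Lemma BV_sum_right x : x < 1 -> Cmod (BV_sum x) <= 4 * PI * SA * Rpower (1 - x) d.
Proof.
  intro Hx; apply BV_sum_Holder; [lra|]; intro m.
  replace (Fourier_exp m x) with (Fourier_exp m (x - 1)).
  - eapply Rle_trans; [apply Fourier_exp_lip|]; rewrite (Rabs_left (x - 1)) by lra; right; ring.
  - transitivity (Fourier_exp m (x - 1) * Fourier_exp m 1)%C; [rewrite Fourier_exp_at_1; ring|].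
    rewrite <- Fourier_exp_add; f_equal; ring.
Qed.

Variable f : R -> C.
Hypothesis Hf : forall x, 0 < x < 1 -> ((Fourier_exp 1 x - 1) * f x)%C = BV_sum x.

Lemma Fourier_1_lower x : 0 < x < 1 -> 2 * (x * (1 - x)) <= Cmod (Fourier_exp 1 x - 1).
Proof. intro Hx; eapply Rle_trans; [|apply Fourier_exp_1_lower; lra]; rewrite Rabs_pos_eq; lra. Qed.

Lemma Fourier_1_nz x : 0 < x < 1 -> (Fourier_exp 1 x - 1)%C <> RtoC 0.
Proof. intro Hx; apply Cmod_gt_0; generalize (Fourier_1_lower x Hx); nra. Qed.

Lemma BV_pointwise x : 0 < x < 1 -> Clim (symsum (fun n => Fourier_exp n x * c n)%C) (f x).
Proof.
  intro Hx; assert (Hn := Fourier_1_nz x Hx).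
  apply Clim_ext with (fun N => / (Fourier_exp 1 x - 1) * ((Fourier_exp 1 x - 1) * symsum (fun n => Fourier_exp n x * c n) N))%C.
  - intro N; field; exact Hn.
  - replace (f x) with (/ (Fourier_exp 1 x - 1) * BV_sum x)%C by (rewrite <- Hf by exact Hx; field; exact Hn).
    apply Clim_scal, symsum_BV_lim.
Qed.

Lemma BV_cont x : 0 < x < 1 -> Ccont f x.
Proof.
  intro Hx; apply Ccont_ext_loc with (fun x => BV_sum x * / (Fourier_exp 1 x - 1))%C.
  - assert (Hr : 0 < Rmin x (1 - x)) by (apply Rmin_pos; lra).
    exists (mkposreal _ Hr); intros y Hy; unfold ball in Hy; simpl in Hy; unfold AbsRing_ball, abs, minus, plus, opp in Hy; simpl in Hy.
    apply Rabs_lt_between in Hy; generalize (Rmin_l x (1 - x)) (Rmin_r x (1 - x)); intros.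
    rewrite <- Hf by lra; field; apply Fourier_1_nz; lra.
  - apply Ccont_mult; [apply BV_sum_cont|]; apply Ccont_inv; [apply Fourier_1_nz, Hx|].
    apply Ccont_minus; [apply Fourier_exp_cont|apply Ccont_const].
Qed.

Lemma SA_pos : 0 <= SA.
Proof. apply (proj1 (proj2 HS) O). Qed.

(** Division by e(x) - 1 costs one power at each end: its modulus is at least 2 x (1 - x), hence at
    least x on the left half and 1 - x on the right half. *)
Lemma BV_bound x : 0 < x < 1 ->
  Cmod (f x) <= 4 * PI * SA * (Rpower x (d - 1) + Rpower (1 - x) (d - 1)).
Proof.
  intro Hx; assert (HP := PI_RGT_0); assert (HSA := SA_pos).
  assert (HC : 0 <= 4 * PI * SA) by nra.
  assert (HR : forall y, 0 < y -> Rpower y d = y * Rpower y (d - 1)).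
  { intros y Hy; rewrite <- (Rpower_1 y Hy) at 2; rewrite <- Rpower_plus; f_equal; ring. }
  assert (HL := Fourier_1_lower x Hx).
  assert (HM : Cmod (Fourier_exp 1 x - 1) * Cmod (f x) = Cmod (BV_sum x)) by (rewrite <- Cmod_mult, Hf; auto).
  assert (H0 := Cmod_ge_0 (f x)).
  assert (P1 : 0 < Rpower x (d - 1)) by apply exp_pos; assert (P2 : 0 < Rpower (1 - x) (d - 1)) by apply exp_pos.
  destruct (Rle_lt_dec x (1 / 2)) as [h|h].
  - apply Rle_trans with (4 * PI * SA * Rpower x (d - 1)); [|apply Rmult_le_compat_l; lra].
    apply Rmult_le_reg_l with x; [lra|].
    replace (x * (4 * PI * SA * Rpower x (d - 1))) with (4 * PI * SA * Rpower x d) by (rewrite HR by lra; ring).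
    eapply Rle_trans; [|apply BV_sum_left; lra]; rewrite <- HM; apply Rmult_le_compat_r; [exact H0|nra].
  - apply Rle_trans with (4 * PI * SA * Rpower (1 - x) (d - 1)); [|apply Rmult_le_compat_l; lra].
    apply Rmult_le_reg_l with (1 - x); [lra|].
    replace ((1 - x) * (4 * PI * SA * Rpower (1 - x) (d - 1))) with (4 * PI * SA * Rpower (1 - x) d) by (rewrite (HR (1 - x)) by lra; ring).
    eapply Rle_trans; [|apply BV_sum_right; lra]; rewrite <- HM; apply Rmult_le_compat_r; [exact H0|nra].
Qed.

Lemma BV_envelope : exists m, is_RInt_gen (fun x => 4 * PI * SA * (Rpower x (d - 1) + Rpower (1 - x) (d - 1))) (at_right 0) (at_left 1) m.
Proof.
  eexists; apply (is_RInt_gen_scal (V := R_NormedModule)), (is_RInt_gen_plus (V := R_NormedModule));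
    [apply Rpower_int_left; lra|apply Rpower_reflect_int; lra].
Qed.

Lemma spans_01 : spans (at_right 0) (at_left 1) (fun x => 0 < x < 1).
Proof. apply spans_open; [lra|auto]. Qed.

Lemma CIntg_fst (Fa Fb : (R -> Prop) -> Prop) {FFa : Filter Fa} {FFb : Filter Fb} (h : R -> C) (l : C) :
  CIntg h Fa Fb l -> is_RInt_gen (fun x => fst (h x)) Fa Fb (fst l).
Proof.
  intros H P [e HP].
  assert (HP' : @locally C_UniformSpace l (fun z => P (fst z))).
  { exists e; intros y [Hy _]; apply HP, Hy. }
  generalize (H _ HP'); unfold filtermapi; apply filter_imp; intros [a b] [y [Hy HPy]].
  exists (fst y); split; [apply CInt_parts in Hy; apply Hy|exact HPy].
Qed.

Lemma BV_integrable : integrable01 f.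
Proof.
  destruct BV_envelope as [m Hm]; split.
  - destruct (CIntg_dominated f _ _ m spans_01 BV_cont BV_bound Hm) as [l [Hl _]]; exists l; exact Hl.
  (* The real integral of |f| is read off as the real part of a complex one, to which the domination
     criterion applies. *)
  - destruct (CIntg_dominated (fun x => RtoC (Cmod (f x))) (fun x => 4 * PI * SA * (Rpower x (d - 1) + Rpower (1 - x) (d - 1))) _ m spans_01) as [l [Hl _]]; [| |exact Hm|].
    + intros; apply Ccont_RtoC, Ccont_Cmod, BV_cont; assumption.
    + intros; rewrite Cmod_R, Rabs_pos_eq by apply Cmod_ge_0; apply BV_bound; assumption.
    + exists (fst l); apply (CIntg_fst _ _ _ _ Hl).
Qed.

(** Uniform convergence permits integration term by term, and orthogonality leaves a single
    difference of coefficients. *)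
Lemma BV_sum_coeff (k : Z) : CInt (fun x => BV_sum x * Fourier_exp (- k) x)%C 0 1 (c (k - 1)%Z - c k)%C.
Proof.
  destruct (ex_CInt (fun x => BV_sum x * Fourier_exp (- k) x)%C 0 1) as [h Hh].
  { intros; apply Ccont_mult; [apply BV_sum_cont|apply Fourier_exp_cont]. }
  replace (c (k - 1)%Z - c k)%C with h; [exact Hh|].
  set (del := fun j : Z => if Z.eq_dec j 0 then RtoC 1 else RtoC 0).
  set (v := fun n => ((c (- Z.of_nat (S n))%Z - c (- Z.of_nat n)%Z) * del (- Z.of_nat n + - k)%Z
   - (c (Z.of_nat (S n)) - c (Z.of_nat n)) * del (Z.of_nat (S n) + - k)%Z)%C).
  assert (Hv : forall n, CInt (fun x => BV_term n x * Fourier_exp (- k) x)%C 0 1 (v n)).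
  { intro n; apply CInt_ext with (fun x => (c (- Z.of_nat (S n))%Z - c (- Z.of_nat n)%Z) * Fourier_exp (- Z.of_nat n + - k) x
      - (c (Z.of_nat (S n)) - c (Z.of_nat n)) * Fourier_exp (Z.of_nat (S n) + - k) x)%C.
    - intros x _; unfold BV_term; rewrite !Fourier_exp_plus; ring.
    - apply CInt_minus; apply CInt_scal, Fourier_exp_int. }
  destruct A_sum as [S0 HS0].
  assert (HL : Clim (Csum v) h).
  { apply Clim_squeeze with (fun N => S0 - Rsum (fun n => 2 * A n) N); [|apply is_sum_lim, HS0].
    intro N; rewrite Cmod_minus_sym.
    replace (S0 - Rsum (fun n => 2 * A n) N) with ((S0 - Rsum (fun n => 2 * A n) N) * (1 - 0)) by ring.
    apply (CInt_norm_const (fun x => BV_sum x * Fourier_exp (- k) x - Csum (fun n => BV_term n x * Fourier_exp (- k) x) N)%C); [lra| |].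
    - intros x _.
      replace (Csum (fun n => BV_term n x * Fourier_exp (- k) x)%C N) with (Fourier_exp (- k) x * Csum (fun n => BV_term n x) N)%C
        by (rewrite <- Csum_scal; apply Csum_ext; intros; ring).
      match goal with |- Cmod ?z <= _ => replace z with ((BV_sum x - Csum (fun n => BV_term n x) N) * Fourier_exp (- k) x)%C by ring end.
      rewrite Cmod_mult, Cmod_Fourier_exp, Rmult_1_r.
      apply (Clim_series_bound _ (fun n => 2 * A n) S0); [intro; apply BV_term_bound|exact HS0|apply BV_sum_lim].
    - apply CInt_minus; [exact Hh|apply (CInt_Csum (fun n x => BV_term n x * Fourier_exp (- k) x)%C), Hv]. }
  apply (Clim_unique _ _ _ HL); intros e He; exists (S (Z.to_nat (Z.abs k))); intros N HN.
  replace (Csum v N) with (c (k - 1)%Z - c k)%C.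
  { replace (c (k - 1)%Z - c k - (c (k - 1)%Z - c k))%C with (RtoC 0) by ring; rewrite Cmod_0; exact He. }
  (* A frequency k <= 0 occurs only in the term n = -k, a frequency k > 0 only in the term n = k -
     1. *)
  symmetry; destruct (Z_le_gt_dec k 0) as [hk|hk].
  - rewrite (Csum_single v N (Z.to_nat (- k))); [|lia|].
    + unfold v, del; rewrite Nat2Z.inj_succ, Z2Nat.id by lia.
      destruct (Z.eq_dec (- - k + - k) 0); [|lia]; destruct (Z.eq_dec (Z.succ (- k) + - k) 0); [lia|].
      replace (- Z.succ (- k))%Z with (k - 1)%Z by lia; rewrite Z.opp_involutive; ring.
    + intros n _ Hn; unfold v, del.
      destruct (Z.eq_dec (- Z.of_nat n + - k) 0); [lia|]; destruct (Z.eq_dec (Z.of_nat (S n) + - k) 0); [lia|]; ring.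
  - rewrite (Csum_single v N (Z.to_nat (k - 1))); [|lia|].
    + unfold v, del; rewrite Nat2Z.inj_succ, Z2Nat.id by lia.
      destruct (Z.eq_dec (- (k - 1) + - k) 0); [lia|]; destruct (Z.eq_dec (Z.succ (k - 1) + - k) 0); [|lia].
      replace (Z.succ (k - 1)) with k by lia; ring.
    + intros n _ Hn; unfold v, del.
      destruct (Z.eq_dec (- Z.of_nat n + - k) 0); [lia|]; destruct (Z.eq_dec (Z.of_nat (S n) + - k) 0); [lia|]; ring.
Qed.

Lemma BV_coeff (k : Z) : is_Fourier_coeff f k (c k).
Proof.
  destruct BV_envelope as [m Hm].
  set (dc := fun k => RInt_gen (V := C_R_CompleteNormedModule) (fun x => f x * Fourier_exp (- k) x)%C (at_right 0) (at_left 1) : C).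
  assert (Hdc : forall k, CIntg (fun x => f x * Fourier_exp (- k) x)%C (at_right 0) (at_left 1) (dc k)).
  { intro j; destruct (CIntg_dominated (fun x => f x * Fourier_exp (- j) x)%C (fun x => 4 * PI * SA * (Rpower x (d - 1) + Rpower (1 - x) (d - 1))) _ m spans_01) as [l [Hl _]]; [| |exact Hm|].
    - intros; apply Ccont_mult; [apply BV_cont; assumption|apply Fourier_exp_cont].
    - intros; rewrite Cmod_mult, Cmod_Fourier_exp, Rmult_1_r; apply BV_bound; assumption.
    - replace (dc j) with l; [exact Hl|symmetry; exact (RInt_gen_CIntg _ _ _ l Hl)]. }
  set (g := fun k => (dc k - c k)%C).
  assert (Hg : forall j, g (j - 1)%Z = g j).
  { intro j.
    assert (E : (dc (j - 1)%Z - dc j)%C = (c (j - 1)%Z - c j)%C).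
    { refine (CIntg_unique (Fa := at_right 0) (Fb := at_left 1) (fun x => BV_sum x * Fourier_exp (- j) x)%C _ _ _ _).
      - apply CIntg_ext with (f := fun x => (f x * Fourier_exp (- (j - 1)) x - f x * Fourier_exp (- j) x)%C) (D := fun x => 0 < x < 1);
          [exact spans_01| |apply CIntg_minus; apply Hdc].
        intros x Hx; rewrite <- Hf by exact Hx; replace (- (j - 1))%Z with (1 + - j)%Z by ring; rewrite Fourier_exp_plus; ring.
      - apply CIntg_of_CInt; [lra| |apply BV_sum_coeff].
        intros; apply Ccont_mult; [apply BV_sum_cont|apply Fourier_exp_cont]. }
    unfold g; replace (dc (j - 1)%Z) with (dc j + (dc (j - 1)%Z - dc j))%C by ring; rewrite E; ring. }
  assert (Hconst : forall j, g j = g 0%Z).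
  { apply Z.peano_ind; [reflexivity| |].
    - intros j Hj; rewrite <- Hg; replace (Z.succ j - 1)%Z with j by lia; exact Hj.
    - intros j Hj; unfold Z.pred; change (j + -1)%Z with (j - 1)%Z; rewrite Hg; exact Hj. }
  assert (H0 : g 0%Z = RtoC 0).
  { apply Cmod_small_eq; intros e He; rewrite Cminus_0_r.
    destruct (Riemann_Lebesgue f _ 0 1 m (e / 2) Rlt_0_1 BV_cont BV_bound Hm ltac:(lra)) as [K HK].
    destruct (Hcp (e / 2) ltac:(lra)) as [N HN].
    set (n := S (max K N)).
    assert (HKn : (Z.of_nat K < Z.abs (- Z.of_nat n))%Z) by (unfold n; lia).
    specialize (HK _ _ HKn (Hdc (Z.of_nat n))); specialize (HN n ltac:(unfold n; lia)); rewrite Cminus_0_r in HN.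
    rewrite <- (Hconst (Z.of_nat n)); unfold g; eapply Rle_trans; [apply Cmod_minus_le|]; lra. }
  unfold is_Fourier_coeff; replace (c k) with (dc k); [apply Hdc|].
  generalize (Hconst k); rewrite H0; unfold g; intro E; apply Ceq_minus; exact E.
Qed.

End SlowlyVarying.

(** * Continuation to Re s < 1 and derivatives in s *)

(** The power (2 pi i k)^(z-1) without the Gamma factor; the value 0 at k = 0 omits that frequency
    from the series. *)
Definition tpow (k : Z) (z : C) : C :=
  if Z.eq_dec k 0 then RtoC 0 else Cexp ((z - 1) * Clog (two_pi_i k)).

Definition tpow_coef (s : C) (m : nat) (k : Z) : C :=
  if Z.eq_dec k 0 then RtoC 0 else
  (Cexp ((s - 1) * Clog (two_pi_i k)) * (RtoC (/ INR (fact m)) * Clog (two_pi_i k) ^ m))%C.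

Lemma tpow_PSon (k : Z) (s : C) (r : R) : 0 < r -> PSon (tpow k) s r (fun m => tpow_coef s m k).
Proof.
  intro Hr; unfold tpow, tpow_coef; destruct (Z.eq_dec k 0).
  - apply PSon_coef_ext with (2 := PSon_const 0 s r Hr); intros [|m]; reflexivity.
  - set (L := Clog (two_pi_i k)).
    apply PSon_ext with (fun z => Cexp (L * z + - L)); [intros; f_equal; ring|].
    apply PSon_coef_ext with (2 := PSon_Cexp_lin L (- L) s r Hr).
    intro m; f_equal; f_equal; ring.
Qed.

Lemma tpow_polar (k : Z) (z : C) : k <> 0%Z ->
  tpow k z = (Cexp ((z - 1) * (RtoC (zsgn k * (PI / 2)) * Ci)) * cp (2 * PI * IZR (Z.abs k)) (z - 1))%C.
Proof.
  intro Hk; unfold tpow; destruct (Z.eq_dec k 0) as [E|_]; [contradiction|].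
  rewrite Clog_two_pi_i by exact Hk; unfold cp; rewrite <- Cexp_plus; f_equal; ring.
Qed.

Lemma Cmod_rot (k : Z) (z : C) (M : R) : Cmod (z - 1) <= M -> Cmod (Cexp ((z - 1) * (RtoC (zsgn k * (PI / 2)) * Ci))) <= exp (2 * M).
Proof.
  intro HM; assert (HP := PI_4); assert (HP0 := PI_RGT_0).
  eapply Rle_trans; [apply Cmod_le_exp|]; apply exp_le_compat.
  rewrite !Cmod_mult, Cmod_Ci, Cmod_R, Rmult_1_r.
  assert (H : Rabs (zsgn k * (PI / 2)) = PI / 2).
  { rewrite Rabs_mult, (Rabs_pos_eq (PI / 2)) by lra.
    unfold zsgn; destruct (Z_lt_dec 0 k); [rewrite Rabs_R1|rewrite Rabs_left]; lra. }
  rewrite H; generalize (Cmod_ge_0 (z - 1)); intro; nra.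
Qed.

Lemma Rpower_exp_mono (x e e' : R) : 1 <= x -> e <= e' -> Rpower x e <= Rpower x e'.
Proof.
  intros Hx He; unfold Rpower; apply exp_le_compat.
  assert (0 <= ln x) by (rewrite <- ln_1; apply ln_le; lra); nra.
Qed.

Lemma tpow_bound (k : Z) (z : C) (M e : R) : k <> 0%Z -> Cmod (z - 1) <= M -> Re z - 1 <= e <= 0 ->
  Cmod (tpow k z) <= exp (2 * M) * Rpower (IZR (Z.abs k)) e.
Proof.
  intros Hk HM He; assert (HP := PI2_3_2).
  assert (Hk1 : 1 <= IZR (Z.abs k)) by (apply IZR_le; lia).
  rewrite tpow_polar, Cmod_mult by exact Hk.
  apply Rmult_le_compat; try apply Cmod_ge_0; [apply Cmod_rot, HM|].
  rewrite Cmod_cp; replace (Re (z - 1)) with (Re z - 1) by (unfold Re; simpl; ring).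
  apply Rle_trans with (Rpower (IZR (Z.abs k)) (Re z - 1)).
  - apply Rpower_antitone; nra.
  - apply Rpower_exp_mono; lra.
Qed.

(** The points 2 pi i k and 2 pi i j lie on one ray, so the difference is an increment of x^(z-1)
    over a step of length 2 pi, of size O(x^(Re z - 2)). *)
Lemma tpow_diff (k j : Z) (z : C) (M e : R) : k <> 0%Z -> zsgn j = zsgn k -> Z.abs j = (Z.abs k + 1)%Z ->
  Cmod (z - 1) <= M -> Re z - 2 <= e <= 0 -> Re z <= 2 ->
  Cmod (tpow j z - tpow k z) <= exp (2 * M) * (2 * PI * M) * Rpower (IZR (Z.abs j)) e.
Proof.
  intros Hk Hs Hj HM He Hz; assert (HP := PI2_3_2).
  assert (Hk1 : 1 <= IZR (Z.abs k)) by (apply IZR_le; lia).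
  assert (Hjk : IZR (Z.abs j) = IZR (Z.abs k) + 1) by (rewrite Hj, plus_IZR; reflexivity).
  assert (Hj0 : j <> 0%Z) by lia.
  rewrite !tpow_polar, Hs by assumption.
  set (W := Cexp ((z - 1) * (RtoC (zsgn k * (PI / 2)) * Ci))).
  set (x := 2 * PI * IZR (Z.abs k)); set (y := 2 * PI * IZR (Z.abs j)).
  assert (Hy : y = x + 2 * PI) by (unfold x, y; rewrite Hjk; ring).
  (* 2 pi |k| >= |k| + 1 because |k| >= 1; powers with nonpositive exponent may then be taken at |j|
     instead of x. *)
  assert (Hx : IZR (Z.abs j) <= x) by (unfold x; rewrite Hjk; nra).
  replace (W * cp y (z - 1) - W * cp x (z - 1))%C with (W * (cp y (z - 1) - cp x (z - 1)))%C by ring.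
  rewrite Cmod_mult, !Rmult_assoc; apply Rmult_le_compat; try apply Cmod_ge_0; [apply Cmod_rot, HM|].
  assert (HR : Re (z - 1) = Re z - 1) by (unfold Re; simpl; ring).
  eapply Rle_trans; [apply cp_diff; [split; [nra|lra]|rewrite HR; lra]|].
  rewrite HR; replace (Re z - 1 - 1) with (Re z - 2) by ring; replace (y - x) with (2 * PI) by lra.
  assert (HC : Rpower x (Re z - 2) <= Rpower (IZR (Z.abs j)) e).
  { apply Rle_trans with (Rpower (IZR (Z.abs j)) (Re z - 2)); [apply Rpower_antitone; lra|apply Rpower_exp_mono; lra]. }
  assert (H0 : 0 < Rpower x (Re z - 2)) by apply exp_pos.
  apply Rle_trans with (M * Rpower (IZR (Z.abs j)) e * (2 * PI)); [|right; ring].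
  apply Rmult_le_compat_r; [lra|]; apply Rmult_le_compat; [apply Cmod_ge_0|lra|exact HM|exact HC].
Qed.

Lemma zsgn_pos (n : nat) : zsgn (Z.of_nat (S n)) = 1.
Proof. unfold zsgn; destruct (Z_lt_dec 0 (Z.of_nat (S n))); [reflexivity|lia]. Qed.

Lemma zsgn_neg (n : nat) : zsgn (- Z.of_nat (S n)) = -1.
Proof. unfold zsgn; destruct (Z_lt_dec 0 (- Z.of_nat (S n))); [lia|reflexivity]. Qed.

Lemma tpow_estimates (s : C) : Re s < 1 -> exists A B d rho SA,
  0 < rho <= (1 - Re s) / 4 /\ 0 < d <= 1 /\ is_sum (fun n => A n * Rpower (INR n + 1) d) SA /\
  is_lim_seq B 0 /\
  forall z, Cmod (z - s) < rho -> forall n,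
    Cmod (tpow (Z.of_nat (S n)) z - tpow (Z.of_nat n) z) <= A n /\
    Cmod (tpow (- Z.of_nat (S n)) z - tpow (- Z.of_nat n) z) <= A n /\
    Cmod (tpow (Z.of_nat (S n)) z) <= B n /\ Cmod (tpow (- Z.of_nat (S n)) z) <= B n.
Proof.
  (* In terms of [rho], Re s = 1 - 4 rho and Re z < 1 - 3 rho on the disc, so the differences have
     exponent e = -1 - 3 rho. As d <= rho, the weighted exponent e + d is at most -1 - 2 rho, which
     is summable, and e + 1 < 0 makes the coefficients tend to 0. *)
  intro Hs; set (rho := (1 - Re s) / 4); set (d := Rmin 1 rho).
  assert (Hrho : 0 < rho) by (unfold rho; lra).
  assert (Hd : 0 < d <= 1 /\ d <= rho) by (unfold d; split; [split; [apply Rmin_pos; lra|apply Rmin_l]|apply Rmin_r]).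
  set (e := Re s + rho - 2).
  set (M := Cmod s + rho + 1); set (E := exp (2 * M)).
  assert (HM1 : 1 <= M) by (unfold M; generalize (Cmod_ge_0 s); lra).
  assert (HP := PI2_3_2).
  assert (HE : 0 < E) by apply exp_pos.
  set (K := E * (2 * PI * M)).
  assert (HK : E <= K) by (unfold K; rewrite <- (Rmult_1_r E) at 1; apply Rmult_le_compat_l; nra).
  set (kappa := - (1 + (e + d))).
  assert (Hkappa : 0 < kappa) by (unfold kappa, e, rho in *; lra).
  destruct (power_sum 1 kappa Rlt_0_1 Hkappa) as [S0 HS0].
  exists (fun n => K * Rpower (INR n + 1) e), (fun n => E * Rpower (INR (S n)) (e + 1)), d, rho, (K * S0).
  split; [lra|]; split; [lra|]; split; [|split].
  - assert (HS1 := is_sum_scal K _ _ ltac:(lra) HS0).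
    destruct HS1 as (G0 & G1 & G2).
    assert (EQ : forall n, K * Rpower (INR n + 1) e * Rpower (INR n + 1) d = K * Rpower (INR n + 1) (- (1 + kappa))).
    { intro n; rewrite Rmult_assoc, <- Rpower_plus; do 2 f_equal; unfold kappa; ring. }
    assert (ER : forall N, Rsum (fun n => K * Rpower (INR n + 1) e * Rpower (INR n + 1) d) N = Rsum (fun n => K * Rpower (INR n + 1) (- (1 + kappa))) N).
    { intro N; apply Rsum_ext; intros; apply EQ. }
    split; [|split].
    + intro n; rewrite EQ; apply G0.
    + intro N; rewrite ER; apply G1.
    + intros eps Heps; destruct (G2 eps Heps) as [N HN]; exists N; intros n Hn; rewrite ER; auto.
  - replace (Finite 0) with (Rbar_mult E 0) by (simpl; f_equal; ring).
    apply is_lim_seq_mult'; [apply is_lim_seq_const|].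
    apply (is_lim_seq_incr_1 (fun N => Rpower (INR N) (e + 1))).
    apply is_lim_seq_spec; intros ep.
    destruct (Rpower_small_infty (- (e + 1)) ep ltac:(unfold e, rho in *; lra) (cond_pos ep)) as [T [HT0 HT]].
    destruct (INR_unbounded T) as [N HN]; exists N; intros n Hn'; rewrite Rminus_0_r, Rabs_pos_eq by (left; apply exp_pos).
    rewrite Ropp_involutive in HT; apply HT; assert (INR N <= INR n) by (apply le_INR, Hn'); lra.
  - intros z Hz n.
    assert (HR := Re_dist_le _ _ _ Hz).
    assert (HMz : Cmod (z - 1) <= M).
    { eapply Rle_trans; [apply Cmod_minus_le|]; rewrite Cmod_1; unfold M; generalize (Cmod_dist_le _ _ _ Hz); lra. }
    assert (Hn := pos_INR n).
    assert (HA1 : IZR (Z.abs (Z.of_nat (S n))) = INR n + 1).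
    { rewrite Z.abs_eq, <- INR_IZR_INZ, S_INR by lia; reflexivity. }
    assert (HA2 : IZR (Z.abs (- Z.of_nat (S n))) = INR n + 1) by (rewrite Z.abs_opp; exact HA1).
    assert (HB : forall k, IZR (Z.abs k) = INR n + 1 -> k <> 0%Z -> Cmod (tpow k z) <= E * Rpower (INR n + 1) (e + 1)).
    { intros k Hk Hk0; rewrite <- Hk; apply tpow_bound; auto; unfold e, rho in *; lra. }
    (* For n = 0 the difference is the single coefficient at 1 or -1, where all powers of |k| are 1
       and E <= K suffices. *)
    assert (HB0 : n = O -> forall k, IZR (Z.abs k) = INR n + 1 -> k <> 0%Z -> Cmod (tpow k z - 0) <= K * Rpower (INR n + 1) e).
    { intros En k Hk Hk0; rewrite Cminus_0_r; eapply Rle_trans; [apply HB; assumption|].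
      replace (INR n + 1) with 1 by (rewrite En; simpl; ring).
      unfold Rpower; rewrite ln_1, !Rmult_0_r, exp_0; lra. }
    rewrite S_INR; repeat split.
    + destruct n as [|n]; [apply HB0; auto; lia|].
      rewrite <- HA1; apply tpow_diff; try lia; try assumption.
      * rewrite !zsgn_pos; reflexivity.
      * unfold e, rho in *; lra.
      * unfold rho in *; lra.
    + destruct n as [|n]; [apply HB0; auto; lia|].
      rewrite <- HA2; apply tpow_diff; try lia; try assumption.
      * rewrite !zsgn_neg; reflexivity.
      * unfold e, rho in *; lra.
      * unfold rho in *; lra.
    + apply HB; [exact HA1|lia].
    + apply HB; [exact HA2|lia].
Qed.

Lemma slowly_varying_intro (c : Z -> C) (A B : nat -> R) (d SA K : R) :
  c 0%Z = RtoC 0 -> 0 < d <= 1 -> 0 <= K -> is_sum (fun n => A n * Rpower (INR n + 1) d) SA -> is_lim_seq B 0 ->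
  (forall n, Cmod (c (Z.of_nat (S n)) - c (Z.of_nat n)) <= K * A n /\
    Cmod (c (- Z.of_nat (S n))%Z - c (- Z.of_nat n)%Z) <= K * A n /\
    Cmod (c (Z.of_nat (S n))) <= K * B n /\ Cmod (c (- Z.of_nat (S n))%Z) <= K * B n) ->
  slowly_varying c (fun n => K * A n) d (K * SA).
Proof.
  intros H0 Hd HK HS HB H.
  assert (HKB : is_lim_seq (fun n => K * B n) 0).
  { replace (Finite 0) with (Rbar_mult K 0) by (simpl; f_equal; ring); apply (is_lim_seq_scal_l B K 0), HB. }
  split; [exact H0|]; split; [exact Hd|]; split; [intro n; apply H|]; split; [intro n; apply H|]; split; [|split].
  - generalize (is_sum_scal K _ SA HK HS).
    replace (fun n => K * A n * Rpower (INR n + 1) d) with (fun n => K * (A n * Rpower (INR n + 1) d)); [auto|].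
    apply functional_extensionality; intro n; ring.
  - apply Clim_incr_1, Clim_squeeze with (fun n => K * B n); [|exact HKB]; intro n; rewrite Cminus_0_r; apply H.
  - apply Clim_incr_1, Clim_squeeze with (fun n => K * B n); [|exact HKB]; intro n; rewrite Cminus_0_r; apply H.
Qed.

Lemma tpow_slowly_varying (s : C) : Re s < 1 -> exists A d SA, slowly_varying (fun k => tpow k s) A d SA.
Proof.
  intro Hs; destruct (tpow_estimates s Hs) as (A & B & d & rho & SA & Hrho & Hd & HS & HB & H).
  assert (Hz : Cmod (s - s) < rho) by (replace (s - s)%C with (RtoC 0) by ring; rewrite Cmod_0; lra).
  do 3 eexists; apply (slowly_varying_intro _ A B d SA 1 eq_refl Hd Rle_0_1 HS HB).
  intro n; rewrite !Rmult_1_l; apply H, Hz.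
Qed.

Lemma BV_term_tpow_PSon (n : nat) (al : R) (s : C) (r : R) : 0 < r ->
  PSon (fun z => BV_term (fun k => tpow k z) n al) s r (fun m => BV_term (tpow_coef s m) n al).
Proof.
  intro Hr; unfold BV_term.
  apply PSon_ext with (fun z => Fourier_exp (- Z.of_nat n) al * (tpow (- Z.of_nat (S n)) z - tpow (- Z.of_nat n) z)
    - Fourier_exp (Z.of_nat (S n)) al * (tpow (Z.of_nat (S n)) z - tpow (Z.of_nat n) z))%C; [intros; ring|].
  eapply PSon_coef_ext; [|apply PSon_minus; apply PSon_scal, PSon_minus; apply tpow_PSon, Hr].
  intro m; cbv beta; ring.
Qed.

(** The majorant of the differences holds on a whole disc around s, so Weierstrass' theorem applies;
    each term is linear in the coefficients, so its Taylor coefficients are the terms built from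
    [tpow_coef]. *)
Lemma BV_sum_tpow_PSon (al : R) (s : C) : Re s < 1 -> exists rho, 0 < rho <= (1 - Re s) / 4 /\
  PSon (fun z => BV_sum (fun k => tpow k z) al) s rho (fun m => BV_sum (tpow_coef s m) al).
Proof.
  intro Hs; destruct (tpow_estimates s Hs) as (A & B & d & rho & SA & Hrho & Hd & HS & HB & H).
  exists rho; split; [exact Hrho|].
  assert (HA0 : forall n, 0 <= A n).
  { intro n; eapply Rle_trans; [apply Cmod_ge_0|apply (H s)]; replace (s - s)%C with (RtoC 0) by ring; rewrite Cmod_0; lra. }
  destruct (is_sum_le A (fun n => A n * Rpower (INR n + 1) d) SA) as [S1 HS1]; [|exact HS|].
  { intro n; split; [apply HA0|]; rewrite <- (Rmult_1_r (A n)) at 1; apply Rmult_le_compat_l; [apply HA0|].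
    assert (Hn := pos_INR n); apply Rle_trans with (Rpower (INR n + 1) 0); [unfold Rpower; rewrite Rmult_0_l, exp_0; lra|].
    apply Rpower_exp_mono; lra. }
  assert (HP := PSon_series_taylor (fun n z => BV_term (fun k => tpow k z) n al) s rho (2 * S1) (fun n => 2 * A n)).
  destruct HP as [HP _].
  - intro n; eexists; apply BV_term_tpow_PSon; lra.
  - intros n z Hz; destruct (H z Hz n) as (H1 & H2 & _); unfold BV_term.
    eapply Rle_trans; [apply Cmod_minus_le|]; rewrite !Cmod_mult, !Cmod_Fourier_exp; lra.
  - apply is_sum_scal; [lra|exact HS1].
  - apply PSon_coef_ext with (2 := HP); intro m; unfold BV_sum, Cser.
    assert (E : forall N, Csum (fun n => taylor (fun z => BV_term (fun k => tpow k z) n al) s m) N = Csum (fun n => BV_term (tpow_coef s m) n al) N).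
    { intro N; apply Csum_ext; intros n _; apply (fun H => PSon_taylor _ _ rho (fun m => BV_term (tpow_coef s m) n al) m H), BV_term_tpow_PSon; lra. }
    f_equal; f_equal; apply Lim_seq_ext; intro N; rewrite E; reflexivity.
Qed.

Lemma CGamma_reflect_PSon (s : C) : Re s < 1 ->
  PSon (fun z => CGamma (1 - z)) s ((1 - Re s) / 4) (fun m => RtoC ((-1) ^ m) * Gamma_coef (1 - s) m)%C.
Proof.
  intro Hs; apply PSon_reflect.
  assert (E : Re (1 - s) = 1 - Re s) by (unfold Re; simpl; ring).
  rewrite <- E; apply CGamma_PSon; rewrite E; lra.
Qed.

(** * Hurwitz' formula in the half-plane Re s < 1 *)

Section Continuation.

Variables (zeta : C -> R -> C) (al : R).
Hypotheses (Hzeta : is_Hurwitz_zeta zeta) (Hal : 0 < al < 1).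

(** Both sides are limits of the same symmetric partial sums multiplied by e(al) - 1. *)
Lemma zeta_continuation_real (s : R) : 0 < s < 1 ->
  ((Fourier_exp 1 al - 1) * zeta s al)%C = (CGamma (1 - s) * BV_sum (fun k => tpow k s) al)%C.
Proof.
  intro Hs; destruct (tpow_slowly_varying s ltac:(simpl; lra)) as (A & d & SA & H).
  apply (Clim_unique _ _ _ (Clim_scal (Fourier_exp 1 al - 1) _ _ (Hurwitz_formula_real zeta s Hzeta Hs al Hal))).
  eapply Clim_ext; [|apply Clim_scal, (symsum_BV_lim _ A d SA H al)].
  intro N; cbv beta; rewrite Cmult_assoc, (Cmult_comm (CGamma _)), <- Cmult_assoc; f_equal.
  unfold symsum; rewrite <- Csum_scal; apply Csum_ext; intros j _; unfold tpow.
  destruct (Z.eq_dec (Z.of_nat (S j)) 0); [lia|]; destruct (Z.eq_dec (- Z.of_nat (S j)) 0); [lia|]; ring.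
Qed.

Let g (z : C) : C := ((Fourier_exp 1 al - 1) * zeta z al - CGamma (1 - z) * BV_sum (fun k => tpow k z) al)%C.

Lemma g_analytic (z : C) : Re z < 1 -> analytic_at g z.
Proof.
  intro Hz; apply analytic_at_minus; apply analytic_at_mult.
  - apply analytic_at_const.
  - apply (Hzeta al (proj1 Hal)); intros ->; simpl in Hz; lra.
  - apply analytic_at_PSon; eexists; eexists; apply CGamma_reflect_PSon, Hz.
  - apply analytic_at_PSon; destruct (BV_sum_tpow_PSon al z Hz) as (rho & _ & HP); eexists; eexists; exact HP.
Qed.

(** Vanishing on the real interval (0,1) forces vanishing on a disc, and from there along segments,
    which stay in the half-plane because it is convex. *)
Lemma zeta_continuation (s : C) : Re s < 1 ->
  ((Fourier_exp 1 al - 1) * zeta s al)%C = (CGamma (1 - s) * BV_sum (fun k => tpow k s) al)%C.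
Proof.
  intro Hs; apply Ceq_minus; change (g s = RtoC 0).
  (* A point of the interval (0,1), at which the real zeros 1/2 + t with 0 < t <= 1/4 cluster. *)
  set (h := RtoC (1 / 2)).
  destruct (proj1 (analytic_at_PSon _ _) (g_analytic h ltac:(simpl; lra))) as (r & a & HP).
  assert (Hr : 0 < r) by apply HP.
  assert (Ha : forall m, a m = RtoC 0).
  { apply (PSon_zeros_cluster g h 1 r a HP); [apply C1_nz|]; intros e He.
    exists (Rmin (e / 2) (1 / 4)); assert (0 < Rmin (e / 2) (1 / 4)) by (apply Rmin_pos; lra).
    generalize (Rmin_l (e / 2) (1 / 4)) (Rmin_r (e / 2) (1 / 4)); intros; rewrite Rabs_pos_eq by lra; split; [lra|].
    replace (h + RtoC (Rmin (e / 2) (1 / 4)) * 1)%C with (RtoC (1 / 2 + Rmin (e / 2) (1 / 4))) by (unfold h; rewrite RtoC_plus; ring).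
    unfold g; rewrite zeta_continuation_real by lra; ring. }
  destruct (Ceq_dec s h) as [->|Hsh].
  - rewrite (PSon_center _ _ _ _ HP); apply Ha.
  - set (dd := (s - h)%C); assert (Hd : dd <> RtoC 0) by (apply Cminus_eq_contra, Hsh).
    assert (Hd' := proj1 (Cmod_gt_0 dd) Hd).
    replace s with (h + dd)%C by (unfold dd; ring).
    apply identity_segment with (r / Cmod dd); [exact Hd| |apply Rdiv_lt_0_compat; assumption|].
    + intros t Ht; apply g_analytic.
      replace (Re (h + RtoC t * dd)) with ((1 - t) * (1 / 2) + t * Re s) by (unfold h, dd, Re; simpl; field).
      destruct (Rle_lt_dec t (1 / 2)); nra.
    + intros t Ht; apply (PSon_zero g h _ r a HP Ha).
      replace (h + RtoC t * dd - h)%C with (RtoC t * dd)%C by ring.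
      rewrite Cmod_mult, Cmod_R, Rabs_pos_eq by lra.
      apply Rlt_div_r; lra.
Qed.

(** The factor e(al) - 1 is constant in s, so both sides expand on one disc around s, and the
    product of the Gamma factor with the series becomes a Cauchy product of Taylor coefficients. *)
Lemma zeta_derivatives (s : C) (r : nat) : Re s < 1 ->
  ((Fourier_exp 1 al - 1) * C_derive_n r (fun z => zeta z al) s)%C =
  (RtoC (INR (fact r)) * Cauchy_prod (fun m => RtoC ((-1) ^ m) * Gamma_coef (1 - s) m) (fun m => BV_sum (tpow_coef s m) al) r)%C.
Proof.
  intro Hs.
  assert (Hn : (Fourier_exp 1 al - 1)%C <> RtoC 0) by (apply Fourier_1_nz, Hal).
  destruct (BV_sum_tpow_PSon al s Hs) as (rho & Hrho & HT).
  assert (HG := PSon_le _ _ _ rho _ Hrho (CGamma_reflect_PSon s Hs)).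
  assert (HM := PSon_scal (/ (Fourier_exp 1 al - 1)) _ _ _ _ (PSon_mult _ _ _ _ _ _ HG HT)).
  assert (HZ : PSon (fun z => zeta z al) s rho
    (fun m => / (Fourier_exp 1 al - 1) * Cauchy_prod (fun m => RtoC ((-1) ^ m) * Gamma_coef (1 - s) m) (fun m => BV_sum (tpow_coef s m) al) m)%C).
  { eapply PSon_ext; [|exact HM]; intros z Hz; cbv beta.
    rewrite <- zeta_continuation; [field; exact Hn|].
    generalize (Re_dist_le _ _ _ Hz); lra. }
  rewrite (PSon_derive_n _ _ _ _ r HZ); field; exact Hn.
Qed.

End Continuation.

(* The r-th derivative of Gamma(1 - z) (2 pi i k)^(z - 1) by Leibniz' rule, read as a product of Taylor series. *)
Lemma zeta_coeff_Cauchy_prod (r : nat) (s : C) (k : Z) : Re s < 1 -> k <> 0%Z ->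
  zeta_coeff r s k = (RtoC (INR (fact r)) * Cauchy_prod (fun m => RtoC ((-1) ^ m) * Gamma_coef (1 - s) m) (fun m => tpow_coef s m k) r)%C.
Proof.
  intros Hs Hk.
  assert (HG : PSon CGamma (1 - s) (Re (1 - s) / 4) (Gamma_coef (1 - s))) by (apply CGamma_PSon; unfold Re in *; simpl; lra).
  unfold zeta_coeff; change (sum_n ?u r) with (@sum_n C_AbelianMonoid u r); rewrite sum_n_Csum.
  unfold Cauchy_prod, Cpower; rewrite <- !Csum_scal.
  set (P := Cexp ((s - 1) * Clog (two_pi_i k))); set (L := Clog (two_pi_i k)).
  (* The Cauchy product is indexed by the order of the Gamma derivative, [zeta_coeff] by the power
     of the logarithm; one sum has to be reversed. *)
  assert (Hrev : forall u n, Csum u (S n) = Csum (fun i => u (n - i)%nat) (S n)).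
  { intros u n; induction n; [reflexivity|].
    change (Csum u (S (S n))) with (Csum u (S n) + u (S n))%C; rewrite IHn.
    change (S (S n)) with (1 + S n)%nat; rewrite Csum_app; change (Csum ?v 1) with (RtoC 0 + v O)%C; cbv beta; rewrite Nat.sub_0_r, Cplus_0_l, Cplus_comm; f_equal. }
  rewrite Hrev; apply Csum_ext; intros i Hi.
  replace (r - (r - i))%nat with i by lia.
  rewrite (PSon_derive_n _ _ _ _ i HG).
  unfold tpow_coef; destruct (Z.eq_dec k 0) as [E|_]; [contradiction|]; fold P; fold L.
  replace (Binomial.C r (r - i)) with (INR (fact r) * (/ INR (fact i) * / INR (fact (r - i)))).
  - rewrite !RtoC_mult, (RtoC_inv (INR (fact i))) by apply INR_fact_neq_0.
    rewrite (RtoC_inv (INR (fact (r - i)))) by apply INR_fact_neq_0.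
    field; split; intro E; apply RtoC_inj in E; apply (INR_fact_neq_0 _ E).
  - unfold Binomial.C; replace (r - (r - i))%nat with i by lia; field; split; apply INR_fact_neq_0.
Qed.

(** Bounds by fixed sequences up to a constant, a property closed under finite linear combinations;
    the coefficients in the theorem are such combinations. *)
Definition controlled (A B : nat -> R) (c : Z -> C) : Prop :=
  c 0%Z = RtoC 0 /\ exists K, 0 <= K /\ forall n : nat,
    Cmod (c (Z.of_nat (S n)) - c (Z.of_nat n)) <= K * A n /\
    Cmod (c (- Z.of_nat (S n))%Z - c (- Z.of_nat n)%Z) <= K * A n /\
    Cmod (c (Z.of_nat (S n))) <= K * B n /\ Cmod (c (- Z.of_nat (S n))%Z) <= K * B n.

Lemma controlled_Csum (A B : nat -> R) (g : nat -> C) (u : nat -> Z -> C) (N : nat) :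
  (forall i, controlled A B (u i)) -> controlled A B (fun k => Csum (fun i => g i * u i k)%C N).
Proof.
  intro Hu; induction N as [|N [IH0 [K1 [HK1 IH]]]].
  - split; [reflexivity|]; exists 0; split; [lra|]; intro n; simpl Csum.
    rewrite Cminus_0_r, Cmod_0; repeat split; lra.
  - destruct (Hu N) as [H0 [K [HK H]]]; split.
    + change (Csum (fun i => g i * u i 0%Z)%C N + g N * u N 0%Z = 0)%C; rewrite IH0, H0; ring.
    + exists (K1 + Cmod (g N) * K).
      assert (Hg := Cmod_ge_0 (g N)); split; [nra|]; intro n.
      destruct (IH n) as (I1 & I2 & I3 & I4); destruct (H n) as (J1 & J2 & J3 & J4); cbv beta in *.
      assert (HA : forall a b a' b' X, Cmod (a - b) <= K1 * X -> Cmod (a' - b') <= K * X ->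
        Cmod (a + g N * a' - (b + g N * b')) <= (K1 + Cmod (g N) * K) * X).
      { intros a b a' b' X Ha Hb; replace (a + g N * a' - (b + g N * b'))%C with ((a - b) + g N * (a' - b'))%C by ring.
        eapply Rle_trans; [apply Cmod_triangle|]; rewrite Cmod_mult.
        assert (Cmod (g N) * Cmod (a' - b') <= Cmod (g N) * (K * X)) by (apply Rmult_le_compat_l; assumption); lra. }
      assert (HB : forall a a' X, Cmod a <= K1 * X -> Cmod a' <= K * X -> Cmod (a + g N * a') <= (K1 + Cmod (g N) * K) * X).
      { intros a a' X Ha Hb; eapply Rle_trans; [apply Cmod_triangle|]; rewrite Cmod_mult.
        assert (Cmod (g N) * Cmod a' <= Cmod (g N) * (K * X)) by (apply Rmult_le_compat_l; assumption); lra. }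
      repeat split; [apply HA|apply HA|apply HB|apply HB]; assumption.
Qed.

(** Cauchy's estimate on the circle of radius rho/2, applied to the powers and to their differences,
    turns bounds on the disc into bounds for the m-th Taylor coefficients at the cost of the
    constant (rho/2)^(-m). *)
Lemma controlled_tpow_coef (s : C) : Re s < 1 -> exists A B d SA, 0 < d <= 1 /\
  is_sum (fun n => A n * Rpower (INR n + 1) d) SA /\ is_lim_seq B 0 /\ forall m, controlled A B (tpow_coef s m).
Proof.
  intro Hs; destruct (tpow_estimates s Hs) as (A & B & d & rho & SA & Hrho & Hd & HS & HB & H).
  exists A, B, d, SA; split; [exact Hd|]; split; [exact HS|]; split; [exact HB|]; intro m.
  assert (Hp : 0 < (rho / 2) ^ m) by (apply pow_lt; lra).
  assert (HC : forall f a M, PSon f s rho a -> (forall z, Cmod (z - s) < rho -> Cmod (f z) <= M) -> Cmod (a m) <= / (rho / 2) ^ m * M).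
  { intros f a M HP HM; apply Rmult_le_reg_l with ((rho / 2) ^ m); [exact Hp|].
    replace ((rho / 2) ^ m * (/ (rho / 2) ^ m * M)) with M by (field; lra).
    rewrite Rmult_comm; apply (PSon_Cauchy f s rho (rho / 2) M a m HP); [lra|exact HM]. }
  assert (HT : forall k, PSon (tpow k) s rho (fun m => tpow_coef s m k)) by (intro k; apply tpow_PSon; lra).
  split; [reflexivity|]; exists (/ (rho / 2) ^ m); split; [left; apply Rinv_0_lt_compat, Hp|]; intro n.
  assert (HD : forall k j M, (forall z, Cmod (z - s) < rho -> Cmod (tpow k z - tpow j z) <= M) ->
    Cmod (tpow_coef s m k - tpow_coef s m j) <= / (rho / 2) ^ m * M).
  { intros k j M; apply (HC (fun z => tpow k z - tpow j z)%C (fun m => tpow_coef s m k - tpow_coef s m j)%C).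
    exact (PSon_minus _ _ _ _ _ _ (HT k) (HT j)). }
  split; [|split; [|split]].
  - apply HD; intros z Hz; apply (H z Hz n).
  - apply HD; intros z Hz; apply (H z Hz n).
  - apply (HC _ _ (B n) (HT (Z.of_nat (S n)))); intros z Hz; apply (H z Hz n).
  - apply (HC _ _ (B n) (HT (- Z.of_nat (S n))%Z)); intros z Hz; apply (H z Hz n).
Qed.

Lemma BV_sum_Csum (g : nat -> C) (u : nat -> Z -> C) (x : R) (N : nat) (l : nat -> C) :
  (forall i, Clim (Csum (fun n => BV_term (u i) n x)) (l i)) ->
  Clim (Csum (fun n => BV_term (fun k => Csum (fun i => g i * u i k)%C N) n x)) (Csum (fun i => g i * l i)%C N).
Proof.
  intro Hu; induction N.
  - apply Clim_ext with (fun _ => RtoC 0); [|apply Clim_const].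
    intro M; symmetry; apply Csum_zero; intros; unfold BV_term; simpl Csum; ring.
  - apply Clim_ext with (fun M => Csum (fun n => BV_term (fun k => Csum (fun i => g i * u i k)%C N) n x) M
      + g N * Csum (fun n => BV_term (u N) n x) M)%C.
    + intro M; rewrite <- Csum_scal, <- Csum_plus; apply Csum_ext; intros n _; unfold BV_term; cbn [Csum]; ring.
    + apply Clim_plus; [exact IHN|apply Clim_scal, Hu].
Qed.

(** At k = 0 the formula for [zeta_coeff] would involve the logarithm of 0; the true coefficient
    there is 0. *)
Definition zeta_coeff0 (r : nat) (s : C) (k : Z) : C :=
  if Z.eq_dec k 0 then RtoC 0 else zeta_coeff r s k.

(** By Leibniz' rule the coefficients are a combination of the [tpow_coef s m] whose factors come
    from Gamma and do not depend on k; slow variation and the summed-by-parts series both respect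
    such combinations. *)
Lemma zeta_coeff0_slowly_varying (r : nat) (s : C) : Re s < 1 ->
  exists A d SA, slowly_varying (zeta_coeff0 r s) A d SA /\
  forall (zeta : C -> R -> C) (x : R), is_Hurwitz_zeta zeta -> 0 < x < 1 ->
    ((Fourier_exp 1 x - 1) * C_derive_n r (fun z => zeta z x) s)%C = BV_sum (zeta_coeff0 r s) x.
Proof.
  intro Hs; destruct (controlled_tpow_coef s Hs) as (A & B & d & SA & Hd & HS & HB & H).
  set (g := fun i : nat => (RtoC (INR (fact r)) * (RtoC ((-1) ^ i) * Gamma_coef (1 - s) i))%C).
  assert (E : zeta_coeff0 r s = fun k => Csum (fun i => g i * tpow_coef s (r - i) k)%C (S r)).
  { apply functional_extensionality; intro k; unfold zeta_coeff0; destruct (Z.eq_dec k 0) as [->|Hk].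
    - symmetry; apply Csum_zero; intros; change (tpow_coef s (r - k) 0) with (RtoC 0); ring.
    - rewrite zeta_coeff_Cauchy_prod by assumption; unfold Cauchy_prod; rewrite <- Csum_scal.
      apply Csum_ext; intros; unfold g; ring. }
  assert (HV : forall c, controlled A B c -> exists K, slowly_varying c (fun n => K * A n) d (K * SA)).
  { intros c [H0 [K [HK Hc]]]; exists K; apply slowly_varying_intro with B; assumption. }
  destruct (HV _ (controlled_Csum A B g (fun i => tpow_coef s (r - i)) (S r) (fun i => H (r - i)%nat))) as [K HK].
  rewrite <- E in HK; do 3 eexists; split; [exact HK|]; intros zeta x Hzeta Hx.
  rewrite zeta_derivatives by assumption; unfold Cauchy_prod; rewrite <- Csum_scal.
  refine (Clim_unique _ _ _ _ (BV_sum_lim _ _ _ _ HK x)); rewrite E.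
  rewrite (Csum_ext _ (fun i => g i * BV_sum (tpow_coef s (r - i)) x)%C) by (intros; unfold g; ring).
  apply BV_sum_Csum; intro i; destruct (HV _ (H (r - i)%nat)) as [K' HK']; apply (BV_sum_lim _ _ _ _ HK').
Qed.

Theorem proposition4 :
  forall (zeta : C -> R -> C), is_Hurwitz_zeta zeta ->
  forall (r : nat) (s : C), Re s < 1 ->
  let f := fun alpha : R => C_derive_n r (fun z : C => zeta z alpha) s in
  integrable01 f /\
  is_Fourier_coeff f 0 (RtoC 0) /\
  (forall n : Z, n <> 0%Z -> is_Fourier_coeff f n (zeta_coeff r s n)) /\
  (forall alpha : R, 0 < alpha < 1 ->
     filterlim
       (symmetric_sum (fun n : Z => (Fourier_exp n alpha * zeta_coeff r s n)%C))
       eventually (locally (f alpha))).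
Proof.
  intros zeta Hzeta r s Hs f.
  destruct (zeta_coeff0_slowly_varying r s Hs) as (A & d & SA & Hc & Hf).
  assert (Hf' := fun x Hx => Hf zeta x Hzeta Hx); fold f in Hf'.
  assert (Hcoeff : forall k, is_Fourier_coeff f k (zeta_coeff0 r s k)) by exact (BV_coeff _ A d SA Hc f Hf').
  split; [exact (BV_integrable _ A d SA Hc f Hf')|]; split; [exact (Hcoeff 0%Z)|]; split.
  - intros n Hn; generalize (Hcoeff n); unfold zeta_coeff0.
    destruct (Z.eq_dec n 0); [contradiction|auto].
  - intros x Hx; apply filterlim_Clim.
    apply Clim_ext with (2 := BV_pointwise _ A d SA Hc f Hf' x Hx).
    intro N; rewrite symmetric_sum_symsum; unfold symsum, zeta_coeff0; apply Csum_ext; intros j _.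
    destruct (Z.eq_dec (Z.of_nat (S j)) 0); [lia|]; destruct (Z.eq_dec (- Z.of_nat (S j)) 0); [lia|reflexivity].
Qed.
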